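(* Let $(c_k)_{k\in\mathbb{N}}$ be a sequence of complex numbers and let $T_c$ be the infinite matrix whose $(i,j)$ entry ($i,j\in\mathbb{N}$) is $0$ if $j<i$, $c_i$ if $j=i$, and $c_j-c_{j-1}$ if $j>i$. Then: (1) $T_c$ defines a bounded operator on $\ell^2$ if and only if $\sup_k|c_k|<\infty$ and $\sup_{n\in\mathbb{N}}2^n\sum_{j=2^n}^{2^{n+1}-1}|c_j-c_{j+1}|^2<\infty$; (2) $T_c$ is compact on $\ell^2$ if and only if $\lim_{k\to\infty}|c_k|=0$ and $\lim_{n\to\infty}2^n\sum_{j=2^n}^{2^{n+1}-1}|c_j-c_{j+1}|^2=0$; (3) for $1<q<\infty$, $T_c\in\mathcal{S}^q(\ell^2)$ if and only if $\sum_k|c_k|^q<\infty$ and $\sum_{n\in\mathbb{N}}\big(2^n\sum_{j=2^n}^{2^{n+1}-1}|c_j-c_{j+1}|^2\big)^{q/2}<\infty$.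
   Context: $\mathbb{N}=\{0,1,2,\dots\}$; $\ell^2$ is the Hilbert space of square-summable sequences indexed by $\mathbb{N}$, with the standard basis. Thus $T_c$ has first row $(c_0, c_1-c_0, c_2-c_1, \dots)$, second row $(0, c_1, c_2-c_1, c_3-c_2,\dots)$, etc. For a bounded operator $T$, the approximation numbers are $a_{n+1}(T)=\inf\{\|T-P\|:\operatorname{rank}P\le n\}$ and $T\in\mathcal{S}^q(\ell^2)$ iff $(a_n(T))_{n\ge1}\in\ell^q$. *)

(* Defs.v *)
From Stdlib Require Import Reals Lra.
From Coquelicot Require Import Coquelicot.
Open Scope R_scope.

Definition vec := nat -> C.

Definition vadd (x y : vec) : vec := fun n => Cplus (x n) (y n).
Definition vsub (x y : vec) : vec := fun n => Cminus (x n) (y n).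
Definition vscal (a : C) (x : vec) : vec := fun n => Cmult a (x n).

Definition sq_summable (x : vec) : Prop := ex_series (fun n => (Cmod (x n))^2).

Definition l2norm (x : vec) : R := sqrt (Series (fun n => (Cmod (x n))^2)).

Definition basis (j : nat) : vec := fun i => if Nat.eqb i j then RtoC 1 else RtoC 0.

Definition bounded_op (A : vec -> vec) : Prop :=
  (forall x, sq_summable x -> sq_summable (A x)) /\
  (forall x y, sq_summable x -> sq_summable y ->
     forall n, A (vadd x y) n = vadd (A x) (A y) n) /\
  (forall a x, sq_summable x -> forall n, A (vscal a x) n = vscal a (A x) n) /\
  (exists M, forall x, sq_summable x -> l2norm (A x) <= M * l2norm x).

Definition has_matrix (A : vec -> vec) (T : nat -> nat -> C) : Prop :=
  forall i j, A (basis j) i = T i j.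

Definition defines_bounded (T : nat -> nat -> C) : Prop :=
  exists A, bounded_op A /\ has_matrix A T.

Definition compact_op (A : vec -> vec) : Prop :=
  forall xs : nat -> vec,
    (forall k, sq_summable (xs k)) ->
    (exists M, forall k, l2norm (xs k) <= M) ->
    exists (phi : nat -> nat) (y : vec),
      (forall k, (phi k < phi (S k))%nat) /\ sq_summable y /\
      is_lim_seq (fun k => l2norm (vsub (A (xs (phi k))) y)) 0.

Definition defines_compact (T : nat -> nat -> C) : Prop :=
  exists A, bounded_op A /\ has_matrix A T /\ compact_op A.

Definition op_norm (A : vec -> vec) : Rbar :=
  Lub_Rbar (fun r => exists x, sq_summable x /\ l2norm x <= 1 /\ r = l2norm (A x)).

Fixpoint csum (f : nat -> C) (n : nat) : C :=
  match n with O => RtoC 0 | S m => Cplus (csum f m) (f m) end.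

Definition rank_le (P : vec -> vec) (n : nat) : Prop :=
  exists v : nat -> vec, (forall k, sq_summable (v k)) /\
    forall x, sq_summable x -> exists a : nat -> C,
      forall i, P x i = csum (fun k => Cmult (a k) (v k i)) n.

(* approximation number a_{n+1}(A) = inf { ||A - P|| : rank P <= n } *)
Definition approx_num (A : vec -> vec) (n : nat) : R :=
  real (Glb_Rbar (fun r => exists P, bounded_op P /\ rank_le P n /\
                   r = real (op_norm (fun x => vsub (A x) (P x))))).

(* real power x^q for x >= 0, with the convention 0^q = 0 (q > 0) *)
Definition rpow (x q : R) : R := if Rle_dec x 0 then 0 else Rpower x q.

Definition defines_schatten (q : R) (T : nat -> nat -> C) : Prop :=
  exists A, bounded_op A /\ has_matrix A T /\
    ex_series (fun n => rpow (approx_num A n) q).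

Definition Tc (c : nat -> C) : nat -> nat -> C := fun i j =>
  if Nat.ltb j i then RtoC 0
  else if Nat.eqb j i then c i
  else Cminus (c j) (c (Nat.pred j)).

Definition dyad (c : nat -> C) (n : nat) : R :=
  2 ^ n * sum_n_m (fun j => (Cmod (Cminus (c j) (c (S j))))^2)
                  (Nat.pow 2 n) (Nat.pow 2 (S n) - 1).

(* Main.v *)
Require Import Defs.
From Stdlib Require Import Reals Lra Lia Wf_nat FunctionalExtensionality ClassicalEpsilon.
From Coquelicot Require Import Coquelicot.
Open Scope R_scope.

(** With [d_j = c_j - c_(j-1)], the matrix is the diagonal matrix of [c] plus the strictly upper
    triangular matrix with constant columns [d_j]. Write [beta_n^2] for [2^n] times the energy
    of [d] on the [n]-th dyadic block of columns, i.e. [dyad c n].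

    Necessity. Both [|c_k|] and [beta_n / sqrt 2] are diagonal coefficients [<A e_k, f_k>] of
    the operator along pairs of orthonormal systems: the standard basis, and the normalised
    restrictions of [conj d] and of the constant [1] to disjoint dyadic blocks. Such coefficients
    are bounded when [A] is bounded and tend to [0] when [A] is compact. For the Schatten class,
    write [A] as a telescoping series of approximants at the levels [B 2^-k]; an operator of rank
    [N] and norm [M] has diagonal coefficients summing to at most [N M], and summing over the
    levels bounds [sum |<A e_k, f_k>|^q] by a multiple of [sum a_n(A)^q].

    Sufficiency. Fix [eps > 0]. The diagonal entries with [|c_i| <= eps], and the columns of the
    blocks with [beta_n <= eps], form an operator of norm [O(eps)], by a dyadic Hardy inequality.
    A block with [beta_n > eps] is cut into [O(beta_n / eps)] intervals [J] of columns with
    [|J| sum_J |d_j|^2 <= eps^2]: the diagonal squares [J x J] have norm at most [eps], and above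
    each of them the matrix has rank one. Hence the [(N+1)]-st approximation number is [O(eps)]
    for [N] of order [#{i : |c_i| > eps} + sum_(beta_n > eps) beta_n / eps]; this gives
    boundedness ([N = 0] for large [eps]), compactness, and, summing over [eps = B 2^-k], the
    Schatten estimate, where [q > 1] makes the geometric series in [eps^(q-1)] converge. *)

(** * Finite sums and square-summable sequences *)

(** The count [O(beta_n / eps)] comes from scaling. Up to a constant, [beta_n ^ 2] is the number of
    columns of the block times their energy. Cutting into [m] intervals that share both evenly
    divides this product by [m ^ 2], so [m] of order [beta_n / eps] brings it down to [eps ^ 2].
    Length and energy have to be balanced at once, hence a single cumulative weight that adds the
    two in normalised form. Above a diagonal square the rank is one because the entries of a column
    above the diagonal are all equal.

    The Schatten class is handled through approximation numbers alone. The trace bound for operators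
    of rank [N] plays the part of singular values, and the levels [B 2^-k] turn summability of q-th
    powers into counting. Necessity uses [q > 1] as well: the increments of all coarser levels
    contribute to the bound at a given level, and exchanging the two sums leaves a geometric series
    in [eps ^ (q - 1)].

    Norms are estimated as squared norms of finite sections, so that convergence is settled once,
    when a matrix is turned into an operator. *)

Fixpoint rsum (f : nat -> R) (n : nat) : R :=
  match n with O => 0 | S m => rsum f m + f m end.

Lemma sq_le_cancel (x y : R) : 0 <= y -> x ^ 2 <= y ^ 2 -> x <= y.
Proof. intros Hy H. apply Rsqr_incr_0_var; [unfold Rsqr; lra | exact Hy]. Qed.

Lemma rsum_ext (f g : nat -> R) n :
  (forall i, (i < n)%nat -> f i = g i) -> rsum f n = rsum g n.
Proof.
  induction n as [|n IH]; intros H; simpl; [reflexivity|].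
  rewrite IH by (intros; apply H; lia). rewrite H by lia. reflexivity.
Qed.

Lemma rsum_le (f g : nat -> R) n :
  (forall i, (i < n)%nat -> f i <= g i) -> rsum f n <= rsum g n.
Proof.
  induction n as [|n IH]; intros H; simpl; [lra|].
  apply Rplus_le_compat; [apply IH; intros; apply H; lia | apply H; lia].
Qed.

Lemma rsum_zero (f : nat -> R) n :
  (forall i, (i < n)%nat -> f i = 0) -> rsum f n = 0.
Proof.
  induction n as [|n IH]; intros H; simpl; [lra|].
  rewrite IH by (intros; apply H; lia). rewrite H by lia. lra.
Qed.

Lemma rsum_nonneg (f : nat -> R) n :
  (forall i, (i < n)%nat -> 0 <= f i) -> 0 <= rsum f n.
Proof.
  intros H. rewrite <- (rsum_zero (fun _ => 0) n) by reflexivity.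
  now apply rsum_le.
Qed.

Lemma rsum_plus (f g : nat -> R) n :
  rsum (fun i => f i + g i) n = rsum f n + rsum g n.
Proof. induction n as [|n IH]; simpl; [lra | rewrite IH; ring]. Qed.

Lemma rsum_scal (a : R) (f : nat -> R) n :
  rsum (fun i => a * f i) n = a * rsum f n.
Proof. induction n as [|n IH]; simpl; [ring | rewrite IH; ring]. Qed.

Lemma rsum_const (a : R) n : rsum (fun _ => a) n = INR n * a.
Proof. induction n as [|n IH]; [simpl; ring | rewrite S_INR; simpl; rewrite IH; ring]. Qed.

Lemma rsum_swap (f : nat -> nat -> R) n m :
  rsum (fun i => rsum (fun j => f i j) m) n = rsum (fun j => rsum (fun i => f i j) n) m.
Proof.
  induction n as [|n IH]; simpl.
  - symmetry. now apply rsum_zero.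
  - rewrite IH, rsum_plus. reflexivity.
Qed.

Lemma rsum_split (f : nat -> R) n m :
  rsum f (n + m) = rsum f n + rsum (fun i => f (n + i)%nat) m.
Proof.
  induction m as [|m IH]; simpl; [rewrite Nat.add_0_r; ring|].
  rewrite Nat.add_succ_r; simpl. rewrite IH. ring.
Qed.

Lemma rsum_mono (f : nat -> R) n m :
  (n <= m)%nat -> (forall i, 0 <= f i) -> rsum f n <= rsum f m.
Proof.
  intros H Hf. replace m with (n + (m - n))%nat by lia. rewrite rsum_split.
  assert (0 <= rsum (fun i => f (n + i)%nat) (m - n)) by (apply rsum_nonneg; auto).
  lra.
Qed.

Lemma rsum_term (f : nat -> R) n k :
  (forall i, 0 <= f i) -> (k < n)%nat -> f k <= rsum f n.
Proof.
  intros Hf Hk. apply Rle_trans with (rsum f (S k)).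
  - simpl. assert (0 <= rsum f k) by (apply rsum_nonneg; auto). lra.
  - apply rsum_mono; auto.
Qed.

Lemma rsum_tail_zero (f : nat -> R) n m :
  (n <= m)%nat -> (forall i, (n <= i)%nat -> f i = 0) -> rsum f m = rsum f n.
Proof.
  intros H Hf. replace m with (n + (m - n))%nat by lia. rewrite rsum_split.
  rewrite (rsum_zero (fun i => f (n + i)%nat)); [lra|]. intros; apply Hf; lia.
Qed.

Lemma rsum_delta (k : nat) (x : R) n :
  rsum (fun i => if Nat.eqb k i then x else 0) n = if Nat.ltb k n then x else 0.
Proof.
  induction n as [|n IH]; simpl; [reflexivity|]. rewrite IH.
  destruct (Nat.ltb_spec k n), (Nat.eqb_spec k n), (Nat.ltb_spec k (S n)); try lia; lra.
Qed.

Lemma rsum_fibers (g : nat -> nat) (f : nat -> R) J N :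
  (forall j, (j < J)%nat -> (g j < N)%nat) ->
  rsum f J = rsum (fun n => rsum (fun j => if Nat.eqb (g j) n then f j else 0) J) N.
Proof.
  intros H. rewrite rsum_swap. apply rsum_ext. intros j Hj.
  rewrite rsum_delta. specialize (H j Hj). apply Nat.ltb_lt in H. now rewrite H.
Qed.

Lemma rsum_fibers_le (g : nat -> nat) (f : nat -> R) J N :
  (forall j, 0 <= f j) ->
  rsum (fun n => rsum (fun j => if Nat.eqb (g j) n then f j else 0) J) N <= rsum f J.
Proof.
  intros H. rewrite rsum_swap. apply rsum_le. intros j Hj.
  rewrite rsum_delta. destruct (Nat.ltb (g j) N); [lra | apply H].
Qed.

(** Inductive step of Cauchy-Schwarz: [X * p] is at most the geometric mean of [A * b] and [a * B],
    so [2 * (X * p)] is at most their sum. *)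
Lemma sq_le_prod_step (X A B p a b : R) :
  0 <= A -> 0 <= B -> 0 <= a -> 0 <= b ->
  X ^ 2 <= A * B -> p ^ 2 <= a * b -> (X + p) ^ 2 <= (A + a) * (B + b).
Proof.
  intros HA HB Ha Hb H1 H2.
  assert (H : 2 * (X * p) <= A * b + a * B).
  { apply Rsqr_incr_0_var; [|apply Rplus_le_le_0_compat; apply Rmult_le_pos; assumption].
    unfold Rsqr.
    assert (X ^ 2 * p ^ 2 <= (A * B) * (a * b))
      by (apply Rmult_le_compat; auto; apply pow2_ge_0).
    assert (0 <= (A * b - a * B) ^ 2) by apply pow2_ge_0.
    nra. }
  nra.
Qed.

(* Cauchy-Schwarz without square roots: [p i] need only be dominated by the geometric mean. *)
Lemma rsum_CS (p a b : nat -> R) n :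
  (forall i, 0 <= a i) -> (forall i, 0 <= b i) -> (forall i, p i ^ 2 <= a i * b i) ->
  rsum p n ^ 2 <= rsum a n * rsum b n.
Proof.
  intros Ha Hb Hp. induction n as [|n IH]; cbn [rsum]; [lra|].
  apply sq_le_prod_step; auto using rsum_nonneg.
Qed.

Lemma rsum_sum_n (f : nat -> R) n : sum_n f n = rsum f (S n).
Proof.
  induction n as [|n IH].
  - rewrite sum_O. simpl. lra.
  - rewrite sum_Sn, IH. reflexivity.
Qed.

Lemma ex_series_rsum_bounded (f : nat -> R) (M : R) :
  (forall i, 0 <= f i) -> (forall n, rsum f n <= M) -> ex_series f /\ Series f <= M.
Proof.
  intros Hf HM.
  assert (He : ex_series f).
  { destruct (ex_finite_lim_seq_incr (sum_n f) M) as [l Hl].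
    - intros n. rewrite sum_Sn. specialize (Hf (S n)).
      unfold plus; simpl. lra.
    - intros n. rewrite rsum_sum_n. apply HM.
    - exists l. exact Hl. }
  split; [exact He|].
  apply Series_correct in He.
  refine (is_lim_seq_le (sum_n f) (fun _ => M) (Series f) M _ He (is_lim_seq_const M)).
  intros n. rewrite rsum_sum_n. apply HM.
Qed.

Lemma rsum_le_Series (f : nat -> R) n :
  (forall i, 0 <= f i) -> ex_series f -> rsum f n <= Series f.
Proof.
  intros Hf He. apply Rle_trans with (sum_n f n).
  - rewrite rsum_sum_n. apply rsum_mono; auto.
  - apply Series_correct in He.
    apply (is_lim_seq_incr_compare (sum_n f) (Series f) He).
    intros k. rewrite sum_Sn. specialize (Hf (S k)). unfold plus; simpl. lra.
Qed.

Lemma ex_series_iff_rsum_bounded (f : nat -> R) :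
  (forall i, 0 <= f i) -> (ex_series f <-> exists M, forall n, rsum f n <= M).
Proof.
  intros Hf; split.
  - intros He. exists (Series f). intros n. now apply rsum_le_Series.
  - intros [M HM]. now apply (ex_series_rsum_bounded f M).
Qed.

(** * Finite complex sums *)

Lemma csum_ext (f g : nat -> C) n :
  (forall i, (i < n)%nat -> f i = g i) -> csum f n = csum g n.
Proof.
  induction n as [|n IH]; intros H; simpl; [reflexivity|].
  rewrite IH by (intros; apply H; lia). rewrite H by lia. reflexivity.
Qed.

Lemma csum_zero (f : nat -> C) n :
  (forall i, (i < n)%nat -> f i = RtoC 0) -> csum f n = RtoC 0.
Proof.
  induction n as [|n IH]; intros H; simpl; [reflexivity|].
  rewrite IH by (intros; apply H; lia). rewrite H by lia. ring.
Qed.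

Lemma csum_plus (f g : nat -> C) n :
  csum (fun i => f i + g i)%C n = (csum f n + csum g n)%C.
Proof. induction n as [|n IH]; simpl; [ring | rewrite IH; ring]. Qed.

Lemma csum_minus (f g : nat -> C) n :
  csum (fun i => f i - g i)%C n = (csum f n - csum g n)%C.
Proof. induction n as [|n IH]; simpl; [ring | rewrite IH; ring]. Qed.

Lemma csum_scal (a : C) (f : nat -> C) n :
  csum (fun i => a * f i)%C n = (a * csum f n)%C.
Proof. induction n as [|n IH]; simpl; [ring | rewrite IH; ring]. Qed.

Lemma csum_swap (f : nat -> nat -> C) n m :
  csum (fun i => csum (fun j => f i j) m) n = csum (fun j => csum (fun i => f i j) n) m.
Proof.
  induction n as [|n IH]; simpl.
  - symmetry. now apply csum_zero.
  - rewrite IH, csum_plus. reflexivity.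
Qed.

Lemma csum_split (f : nat -> C) n m :
  csum f (n + m) = (csum f n + csum (fun i => f (n + i)%nat) m)%C.
Proof.
  induction m as [|m IH]; simpl; [rewrite Nat.add_0_r; ring|].
  rewrite Nat.add_succ_r; simpl. rewrite IH. ring.
Qed.

Lemma csum_tail_zero (f : nat -> C) n m :
  (n <= m)%nat -> (forall i, (n <= i)%nat -> f i = RtoC 0) -> csum f m = csum f n.
Proof.
  intros H Hf. replace m with (n + (m - n))%nat by lia. rewrite csum_split.
  rewrite (csum_zero (fun i => f (n + i)%nat)); [ring|]. intros; apply Hf; lia.
Qed.

Lemma csum_delta (k : nat) (f : nat -> C) n :
  csum (fun i => if Nat.eqb k i then f i else RtoC 0) n = if Nat.ltb k n then f k else RtoC 0.
Proof.
  induction n as [|n IH]; simpl; [reflexivity|]. rewrite IH.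
  destruct (Nat.ltb_spec k n), (Nat.eqb_spec k n), (Nat.ltb_spec k (S n));
    try lia; subst; ring.
Qed.

Lemma csum_RtoC (f : nat -> R) n : csum (fun i => RtoC (f i)) n = RtoC (rsum f n).
Proof. induction n as [|n IH]; simpl; [reflexivity | rewrite IH, RtoC_plus; reflexivity]. Qed.

Lemma csum_conj (f : nat -> C) n : Cconj (csum f n) = csum (fun i => Cconj (f i)) n.
Proof.
  induction n as [|n IH]; simpl.
  - unfold Cconj, RtoC; simpl. f_equal; ring.
  - rewrite <- IH. unfold Cconj, Cplus; simpl. f_equal; ring.
Qed.

Lemma csum_fst (f : nat -> C) n : fst (csum f n) = rsum (fun i => fst (f i)) n.
Proof. induction n as [|n IH]; simpl; [reflexivity | now rewrite IH]. Qed.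

Lemma csum_snd (f : nat -> C) n : snd (csum f n) = rsum (fun i => snd (f i)) n.
Proof. induction n as [|n IH]; simpl; [reflexivity | now rewrite IH]. Qed.

Lemma Cmod_csum_le (f : nat -> C) n : Cmod (csum f n) <= rsum (fun i => Cmod (f i)) n.
Proof.
  induction n as [|n IH]; simpl; [rewrite Cmod_0; lra|].
  eapply Rle_trans; [apply Cmod_triangle|]. lra.
Qed.

Lemma Cmod_sq (z : C) : Cmod z ^ 2 = fst z ^ 2 + snd z ^ 2.
Proof.
  unfold Cmod. rewrite pow2_sqrt; [reflexivity|].
  apply Rplus_le_le_0_compat; apply pow2_ge_0.
Qed.

Lemma Cmult_conj_sq (z : C) : (z * Cconj z)%C = RtoC (Cmod z ^ 2).
Proof.
  rewrite Cmod_sq. unfold Cmult, Cconj, RtoC; simpl. f_equal; ring.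
Qed.

Lemma Cmod_Cconj (z : C) : Cmod (Cconj z) = Cmod z.
Proof. unfold Cmod, Cconj; simpl. f_equal. ring. Qed.

Lemma Cmod_plus_sq (x y : C) : Cmod (x + y) ^ 2 <= 2 * Cmod x ^ 2 + 2 * Cmod y ^ 2.
Proof.
  rewrite !Cmod_sq. unfold Cplus; simpl.
  assert (0 <= (fst x - fst y) ^ 2) by apply pow2_ge_0.
  assert (0 <= (snd x - snd y) ^ 2) by apply pow2_ge_0. nra.
Qed.

Lemma Cmod_minus_sq (x y : C) : Cmod (x - y) ^ 2 <= 2 * Cmod x ^ 2 + 2 * Cmod y ^ 2.
Proof.
  rewrite !Cmod_sq. unfold Cminus, Cplus, Copp; simpl.
  assert (0 <= (fst x + fst y) ^ 2) by apply pow2_ge_0.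
  assert (0 <= (snd x + snd y) ^ 2) by apply pow2_ge_0. nra.
Qed.

Lemma csum_CS_weighted (f : nat -> C) (a b : nat -> R) n :
  (forall i, 0 <= a i) -> (forall i, 0 <= b i) ->
  (forall i, Cmod (f i) ^ 2 <= a i * b i) ->
  Cmod (csum f n) ^ 2 <= rsum a n * rsum b n.
Proof.
  intros Ha Hb Hf. eapply Rle_trans; [|apply (rsum_CS (fun i => Cmod (f i))); auto].
  apply pow_incr. split; [apply Cmod_ge_0 | apply Cmod_csum_le].
Qed.

Lemma csum_CS (x y : nat -> C) n :
  Cmod (csum (fun i => x i * y i)%C n) ^ 2 <=
  rsum (fun i => Cmod (x i) ^ 2) n * rsum (fun i => Cmod (y i) ^ 2) n.
Proof.
  apply csum_CS_weighted; intros i; try apply pow2_ge_0.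
  rewrite Cmod_mult, Rpow_mult_distr. lra.
Qed.

(** Truncated squared norm. A bound uniform in [n] yields summability and the bound on [l2norm]
    together, so the default value of [Series] on a divergent series never enters. *)
Definition sqn (x : vec) (n : nat) : R := rsum (fun i => Cmod (x i) ^ 2) n.

Lemma sqn_nonneg x n : 0 <= sqn x n.
Proof. apply rsum_nonneg; intros; apply pow2_ge_0. Qed.

Lemma l2norm_nonneg x : 0 <= l2norm x.
Proof. apply sqrt_pos. Qed.

Lemma sqn_le_l2norm x n : sq_summable x -> sqn x n <= l2norm x ^ 2.
Proof.
  intros H. unfold l2norm.
  assert (Hp : forall i, 0 <= Cmod (x i) ^ 2) by (intros; apply pow2_ge_0).
  assert (sqn x n <= Series (fun n => Cmod (x n) ^ 2)) by (now apply rsum_le_Series).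
  assert (0 <= sqn x n) by apply sqn_nonneg.
  rewrite pow2_sqrt; lra.
Qed.

Lemma l2_of_sqn_bounded x M : (forall n, sqn x n <= M) -> sq_summable x /\ l2norm x ^ 2 <= M.
Proof.
  intros H. assert (Hp : forall i, 0 <= Cmod (x i) ^ 2) by (intros; apply pow2_ge_0).
  destruct (ex_series_rsum_bounded _ M Hp H) as [He Hs].
  split; [exact He|]. unfold l2norm. rewrite pow2_sqrt; [exact Hs|].
  apply Rle_trans with (sqn x 0); [apply sqn_nonneg | now apply rsum_le_Series].
Qed.

Lemma l2norm_le x M : 0 <= M -> (forall n, sqn x n <= M ^ 2) -> l2norm x <= M.
Proof.
  intros HM H. destruct (l2_of_sqn_bounded x _ H) as [_ H'].
  now apply sq_le_cancel; [|apply Rle_trans with (M ^ 2)].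
Qed.

Lemma sqn_mono x n m : (n <= m)%nat -> sqn x n <= sqn x m.
Proof. intros H; apply rsum_mono; [exact H | intros; apply pow2_ge_0]. Qed.

Lemma Cmod_le_l2norm x i : sq_summable x -> Cmod (x i) <= l2norm x.
Proof.
  intros H. apply sq_le_cancel; [apply l2norm_nonneg|].
  assert (H1 := sqn_le_l2norm x (S i) H). unfold sqn in H1; cbn [rsum] in H1.
  assert (H2 := sqn_nonneg x i). unfold sqn in H2. lra.
Qed.

(** The parallelogram bound stands in for the triangle inequality; it costs constant factors, which
    the final estimates absorb. *)
Lemma sqn_vadd x y n : sqn (vadd x y) n <= 2 * sqn x n + 2 * sqn y n.
Proof.
  unfold sqn. rewrite <- !rsum_scal, <- rsum_plus. apply rsum_le. intros; apply Cmod_plus_sq.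
Qed.

Lemma sqn_vsub x y n : sqn (vsub x y) n <= 2 * sqn x n + 2 * sqn y n.
Proof.
  unfold sqn. rewrite <- !rsum_scal, <- rsum_plus. apply rsum_le. intros; apply Cmod_minus_sq.
Qed.

Lemma sqn_vscal a x n : sqn (vscal a x) n = Cmod a ^ 2 * sqn x n.
Proof.
  unfold sqn. rewrite <- rsum_scal. apply rsum_ext. intros. unfold vscal.
  now rewrite Cmod_mult, Rpow_mult_distr.
Qed.

Lemma sq_summable_iff x : sq_summable x <-> exists M, forall n, sqn x n <= M.
Proof.
  split.
  - intros H; exists (l2norm x ^ 2); intros; now apply sqn_le_l2norm.
  - intros [M H]. now apply (l2_of_sqn_bounded x M).
Qed.

Lemma sq_summable_vadd x y : sq_summable x -> sq_summable y -> sq_summable (vadd x y).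
Proof.
  rewrite !sq_summable_iff. intros [M H] [N K]. exists (2 * M + 2 * N). intros n.
  specialize (H n); specialize (K n). assert (L := sqn_vadd x y n). lra.
Qed.

Lemma l2norm_sq_vsub x y : sq_summable x -> sq_summable y ->
  sq_summable (vsub x y) /\ l2norm (vsub x y) ^ 2 <= 2 * l2norm x ^ 2 + 2 * l2norm y ^ 2.
Proof.
  intros Hx Hy. apply l2_of_sqn_bounded. intros n.
  assert (L := sqn_vsub x y n). assert (H1 := sqn_le_l2norm x n Hx).
  assert (H2 := sqn_le_l2norm y n Hy). lra.
Qed.

Lemma sq_summable_vscal a x : sq_summable x -> sq_summable (vscal a x).
Proof.
  rewrite !sq_summable_iff. intros [M H]. exists (Cmod a ^ 2 * M). intros n.
  rewrite sqn_vscal. apply Rmult_le_compat_l; [apply pow2_ge_0 | auto].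
Qed.

Lemma sqn_finite_support x N n : (forall i, (N <= i)%nat -> x i = RtoC 0) -> sqn x n <= sqn x N.
Proof.
  intros H. destruct (Nat.le_gt_cases n N) as [L|L]; [now apply sqn_mono|].
  unfold sqn. rewrite (rsum_tail_zero _ N n); [lra | lia|].
  intros i Hi. rewrite (H i Hi), Cmod_0. ring.
Qed.

(** * Gram-Schmidt and the trace bound *)

Definition ip (m : nat) (x y : vec) : C := csum (fun k => x k * Cconj (y k))%C m.

Lemma ip_self m x : ip m x x = RtoC (sqn x m).
Proof.
  unfold ip, sqn. rewrite <- csum_RtoC. apply csum_ext. intros; apply Cmult_conj_sq.
Qed.

Lemma ip_csum m (a : nat -> C) (V : nat -> vec) N y :
  ip m (fun k => csum (fun r => a r * V r k)%C N) y = csum (fun r => a r * ip m (V r) y)%C N.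
Proof.
  unfold ip. erewrite csum_ext; [|intros k _; rewrite Cmult_comm, <- csum_scal; reflexivity].
  rewrite csum_swap. apply csum_ext. intros r _. rewrite <- csum_scal.
  apply csum_ext. intros k _. ring.
Qed.

Lemma ip_minus m x x' y : ip m (fun k => x k - x' k)%C y = (ip m x y - ip m x' y)%C.
Proof. unfold ip. rewrite <- csum_minus. apply csum_ext. intros; ring. Qed.

Lemma ip_scal_l m a x y : ip m (fun k => a * x k)%C y = (a * ip m x y)%C.
Proof. unfold ip. rewrite <- csum_scal. apply csum_ext. intros; ring. Qed.

Lemma ip_conj m x y : Cconj (ip m x y) = ip m y x.
Proof.
  unfold ip. rewrite csum_conj. apply csum_ext. intros k _.
  unfold Cconj, Cmult; simpl. f_equal; ring.
Qed.

Lemma ip_zero_sym m x y : ip m x y = RtoC 0 -> ip m y x = RtoC 0.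
Proof.
  intros H. rewrite <- ip_conj, H. unfold Cconj, RtoC; simpl. f_equal; ring.
Qed.

Lemma sqn_eq_0 x m k : sqn x m = 0 -> (k < m)%nat -> x k = RtoC 0.
Proof.
  intros H Hk. apply Cmod_eq_0.
  assert (L := rsum_term (fun i => Cmod (x i) ^ 2) m k (fun i => pow2_ge_0 _) Hk).
  fold (sqn x m) in L. rewrite H in L. assert (K := Cmod_ge_0 (x k)). cbv beta in L. nra.
Qed.

(* The new vector is the normalised residual, or [0] when the residual vanishes. *)
Lemma gram_schmidt (m N : nat) (V : nat -> vec) : exists W : nat -> vec,
  (forall r s, (r < N)%nat -> (s < N)%nat -> r <> s -> ip m (W r) (W s) = RtoC 0) /\
  (forall r, (r < N)%nat ->
     ip m (W r) (W r) = RtoC 1 \/ (forall k, (k < m)%nat -> W r k = RtoC 0)) /\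
  (forall r, (r < N)%nat ->
     exists a : nat -> C, forall k, (k < m)%nat -> V r k = csum (fun s => a s * W s k)%C N).
Proof.
  induction N as [|N [W [Ho [Hn Hs]]]].
  - exists V. repeat split; intros; lia.
  - set (res := fun k => (V N k - csum (fun s => ip m (V N) (W s) * W s k) N)%C).
    assert (Hres : forall t, (t < N)%nat -> ip m res (W t) = RtoC 0).
    { intros t Ht. unfold res. rewrite ip_minus, ip_csum.
      rewrite (csum_ext _ (fun s => if Nat.eqb t s
        then (ip m (V N) (W s) * ip m (W s) (W t))%C else RtoC 0)).
      - rewrite (csum_delta t (fun s => (ip m (V N) (W s) * ip m (W s) (W t))%C)).
        apply Nat.ltb_lt in Ht as Ht'. rewrite Ht'.
        destruct (Hn t Ht) as [E|E]; [rewrite E; ring|].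
        assert (Z : ip m (V N) (W t) = RtoC 0).
        { apply csum_zero. intros k Hk. rewrite (E k Hk).
          unfold Cmult, Cconj, RtoC; simpl; f_equal; ring. }
        rewrite Z. ring.
      - intros s Hs'. destruct (Nat.eqb_spec t s) as [->|D]; [reflexivity|].
        rewrite Ho by lia. ring. }
    assert (HW : exists w : vec, exists a : C,
      (forall t, (t < N)%nat -> ip m w (W t) = RtoC 0) /\
      (ip m w w = RtoC 1 \/ (forall k, (k < m)%nat -> w k = RtoC 0)) /\
      (forall k, (k < m)%nat -> res k = (a * w k)%C)).
    { destruct (Req_dec (sqn res m) 0) as [Z|Z].
      - exists (fun _ => RtoC 0), (RtoC 0). split; [|split].
        + intros t Ht. apply csum_zero. intros; ring.
        + right; reflexivity.
        + intros k Hk. rewrite (sqn_eq_0 res m k Z Hk). ring.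
      - assert (P : 0 < sqn res m) by (assert (Q := sqn_nonneg res m); lra).
        set (rho := sqrt (sqn res m)).
        assert (Hr : 0 < rho) by now apply sqrt_lt_R0.
        assert (Hr2 : rho * rho = sqn res m) by (apply sqrt_sqrt; lra).
        exists (fun k => RtoC (/ rho) * res k)%C, (RtoC rho). split; [|split].
        + intros t Ht. rewrite ip_scal_l, (Hres t Ht). ring.
        + left. rewrite ip_self.
          change (RtoC (sqn (vscal (RtoC (/ rho)) res) m) = RtoC 1).
          rewrite sqn_vscal, <- Hr2, Cmod_R, Rabs_right.
          * f_equal. field. lra.
          * apply Rle_ge, Rlt_le, Rinv_0_lt_compat, Hr.
        + intros k _. rewrite Cmult_assoc, <- RtoC_mult, Rinv_r by lra. ring. }
    destruct HW as [w [a [Hw1 [Hw2 Hw3]]]].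
    exists (fun s => if Nat.eqb s N then w else W s).
    split; [|split].
    + intros r s Hr Hs' D.
      destruct (Nat.eqb_spec r N), (Nat.eqb_spec s N); try lia.
      * apply Hw1; lia.
      * apply ip_zero_sym, Hw1; lia.
      * apply Ho; lia.
    + intros r Hr. destruct (Nat.eqb_spec r N); [exact Hw2 | apply Hn; lia].
    + assert (Hext : forall (b : nat -> C) k,
        csum (fun s => b s * (if Nat.eqb s N then w else W s) k)%C N
        = csum (fun s => b s * W s k)%C N).
      { intros b k. apply csum_ext. intros s Hs'.
        destruct (Nat.eqb_spec s N); [lia | reflexivity]. }
      intros r Hr. destruct (Nat.eq_dec r N) as [->|D].
      * exists (fun s => if Nat.eqb s N then a else ip m (V N) (W s)).
        intros k Hk. cbn [csum]. rewrite Hext, !Nat.eqb_refl, <- (Hw3 k Hk).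
        rewrite (csum_ext _ (fun s => ip m (V N) (W s) * W s k)%C).
        -- unfold res. ring.
        -- intros s Hs'. destruct (Nat.eqb_spec s N); [lia | reflexivity].
      * destruct (Hs r) as [b Hb]; [lia|].
        exists (fun s => if Nat.eqb s N then RtoC 0 else b s).
        intros k Hk. cbn [csum]. rewrite Hext, !Nat.eqb_refl, (Hb k Hk).
        rewrite (csum_ext (fun s => (if Nat.eqb s N then RtoC 0 else b s) * W s k)%C
          (fun s => b s * W s k)%C); [ring|].
        intros s Hs'. destruct (Nat.eqb_spec s N); [lia | reflexivity].
Qed.

(** Zero vectors are allowed among the [W s], so their number stays [N] whatever the dimension of
    the span. Fourier reconstruction survives because a zero [W s] contributes nothing. *)
Lemma orthonormal_expansion (m N : nat) (V : nat -> vec) : exists W : nat -> vec,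
  (forall s, (s < N)%nat -> sqn (W s) m <= 1) /\
  (forall (a : nat -> C) k, (k < m)%nat ->
     let x := fun k => csum (fun r => a r * V r k)%C N in
     x k = csum (fun s => ip m x (W s) * W s k)%C N).
Proof.
  destruct (gram_schmidt m N V) as [W [Ho [Hn Hs]]]. exists W. split.
  - intros s Hs'. destruct (Hn s Hs') as [E|E].
    + rewrite ip_self in E. apply RtoC_inj in E. lra.
    + unfold sqn. rewrite rsum_zero; [lra|]. intros k Hk. rewrite (E k Hk), Cmod_0. ring.
  - assert (Hrec : forall r k, (r < N)%nat -> (k < m)%nat ->
      V r k = csum (fun s => ip m (V r) (W s) * W s k)%C N).
    { intros r k Hr Hk. destruct (Hs r Hr) as [b Hb]. rewrite (Hb k Hk).
      apply csum_ext. intros t Ht.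
      destruct (Hn t Ht) as [E|E]; [|rewrite (E k Hk); ring].
      f_equal. transitivity (ip m (fun k => csum (fun s => b s * W s k)%C N) (W t)).
      - rewrite ip_csum.
        rewrite (csum_ext _ (fun s => if Nat.eqb t s
          then (b s * ip m (W s) (W t))%C else RtoC 0)).
        + rewrite (csum_delta t (fun s => (b s * ip m (W s) (W t))%C)).
          apply Nat.ltb_lt in Ht. rewrite Ht, E. ring.
        + intros s Hs'. destruct (Nat.eqb_spec t s) as [->|D]; [reflexivity|].
          rewrite Ho by lia. ring.
      - unfold ip. apply csum_ext. intros j Hj. now rewrite (Hb j Hj). }
    intros a k Hk x. subst x.
    transitivity (csum (fun r => a r * csum (fun s => ip m (V r) (W s) * W s k) N)%C N).
    + apply csum_ext. intros r Hr. now rewrite <- Hrec.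
    + erewrite csum_ext; [|intros r _; rewrite <- csum_scal; reflexivity].
      rewrite csum_swap. apply csum_ext. intros s _. rewrite ip_csum.
      rewrite Cmult_comm, <- csum_scal. apply csum_ext. intros; ring.
Qed.

(* Expand the columns of [G] along an orthonormal basis [W] of the span of the [V r]: each of the
   [N] resulting rank-one terms contributes at most [M]. *)
Lemma diag_sum_le_rank_norm (m N : nat) (G V a : nat -> nat -> C) (M : R) :
  0 <= M ->
  (forall k l, (k < m)%nat -> (l < m)%nat -> G k l = csum (fun r => a l r * V r k)%C N) ->
  (forall z, sqn (fun k => csum (fun l => G k l * z l)%C m) m <= M ^ 2 * sqn z m) ->
  rsum (fun k => Cmod (G k k)) m <= INR N * M.
Proof.
  intros HM HG Hb. destruct (orthonormal_expansion m N V) as [W [Hn Hrec]].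
  set (h := fun s l => ip m (fun k => G k l) (W s)).
  assert (HGe : forall k l, (k < m)%nat -> (l < m)%nat ->
    G k l = csum (fun s => h s l * W s k)%C N).
  { intros k l Hk Hl. rewrite (HG k l Hk Hl).
    rewrite (Hrec (a l) k Hk). apply csum_ext. intros s _. f_equal.
    unfold h, ip. apply csum_ext. intros j Hj. now rewrite (HG j l Hj Hl). }
  assert (Hh : forall s, (s < N)%nat -> sqn (h s) m <= M ^ 2).
  { intros s Hs. set (z := fun l => Cconj (h s l)).
    assert (E : RtoC (sqn (h s) m) =
      csum (fun k => csum (fun l => G k l * z l) m * Cconj (W s k))%C m).
    { rewrite <- ip_self. unfold ip.
      rewrite (csum_ext _ (fun l => csum (fun k => G k l * z l * Cconj (W s k))%C m)).
      - rewrite csum_swap. apply csum_ext. intros k _.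
        rewrite (Cmult_comm (csum _ _)), <- csum_scal. apply csum_ext; intros; ring.
      - intros l _. unfold h at 1, ip. rewrite Cmult_comm. rewrite <- csum_scal.
        apply csum_ext. intros k _. unfold z. ring. }
    assert (L := csum_CS (fun k => csum (fun l => G k l * z l)%C m) (fun k => Cconj (W s k)) m).
    cbv beta in L. rewrite <- E, Cmod_R, pow2_abs in L.
    fold (sqn (fun k => csum (fun l => G k l * z l)%C m) m) in L.
    rewrite (rsum_ext (fun i => Cmod (Cconj (W s i)) ^ 2) (fun i => Cmod (W s i) ^ 2)) in L
      by (intros; now rewrite Cmod_Cconj).
    fold (sqn (W s) m) in L.
    assert (Hz : sqn z m = sqn (h s) m).
    { apply rsum_ext. intros; unfold z. now rewrite Cmod_Cconj. }
    assert (B := Hb z). rewrite Hz in B. assert (B' := Hn s Hs).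
    assert (P1 := sqn_nonneg (h s) m). assert (P2 := sqn_nonneg (W s) m).
    assert (P3 := sqn_nonneg (fun k => csum (fun l => G k l * z l)%C m) m).
    assert (0 <= M ^ 2) by apply pow2_ge_0.
    set (X := sqn (h s) m) in *.
    assert (X ^ 2 <= M ^ 2 * X) by nra.
    destruct (Rle_lt_dec X (M ^ 2)) as [Q|Q]; [exact Q|]. nra. }
  apply Rle_trans with
    (rsum (fun s => rsum (fun k => Cmod (h s k) * Cmod (W s k)) m) N).
  - rewrite rsum_swap. apply rsum_le. intros k Hk. rewrite (HGe k k Hk Hk).
    eapply Rle_trans; [apply Cmod_csum_le|]. apply rsum_le. intros; rewrite Cmod_mult; lra.
  - rewrite <- rsum_const. apply rsum_le. intros s Hs.
    apply sq_le_cancel; [exact HM|].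
    eapply Rle_trans; [apply (rsum_CS _ (fun k => Cmod (h s k) ^ 2) (fun k => Cmod (W s k) ^ 2));
      intros; try apply pow2_ge_0; rewrite Rpow_mult_distr; lra|].
    fold (sqn (h s) m). fold (sqn (W s) m).
    assert (B' := Hn s Hs). assert (B := Hh s Hs).
    assert (P1 := sqn_nonneg (h s) m). assert (P2 := sqn_nonneg (W s) m). nra.
Qed.

(** * Operators, approximation numbers and test systems *)

Lemma bounded_op_bound A : bounded_op A ->
  exists M, 0 <= M /\ forall x, sq_summable x -> l2norm (A x) <= M * l2norm x.
Proof.
  intros [_ [_ [_ [M HM]]]]. exists (Rmax M 0). split; [apply Rmax_r|].
  intros x Hx. eapply Rle_trans; [now apply HM|].
  apply Rmult_le_compat_r; [apply l2norm_nonneg | apply Rmax_l].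
Qed.

Lemma bounded_op_vsub A P : bounded_op A -> bounded_op P ->
  bounded_op (fun x => vsub (A x) (P x)).
Proof.
  intros HA HP.
  destruct (bounded_op_bound A HA) as [M [HM BA]].
  destruct (bounded_op_bound P HP) as [N [HN BP]].
  destruct HA as [A1 [A2 [A3 _]]]. destruct HP as [P1 [P2 [P3 _]]].
  split; [|split; [|split]].
  - intros x Hx. apply l2norm_sq_vsub; auto.
  - intros x y Hx Hy n. unfold vsub. rewrite (A2 x y Hx Hy n), (P2 x y Hx Hy n).
    unfold vadd. ring.
  - intros a x Hx n. unfold vsub. rewrite (A3 a x Hx n), (P3 a x Hx n).
    unfold vscal. ring.
  - exists (2 * M + 2 * N). intros x Hx.
    assert (Q := l2norm_nonneg x).
    apply sq_le_cancel; [apply Rmult_le_pos; lra|].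
    destruct (l2norm_sq_vsub (A x) (P x)) as [_ H]; auto.
    eapply Rle_trans; [exact H|]. specialize (BA x Hx). specialize (BP x Hx).
    assert (l2norm (A x) ^ 2 <= (M * l2norm x) ^ 2)
      by (apply pow_incr; split; [apply l2norm_nonneg | exact BA]).
    assert (l2norm (P x) ^ 2 <= (N * l2norm x) ^ 2)
      by (apply pow_incr; split; [apply l2norm_nonneg | exact BP]).
    assert (0 <= M * N * l2norm x ^ 2)
      by (apply Rmult_le_pos; [now apply Rmult_le_pos | apply pow2_ge_0]).
    nra.
Qed.

Lemma bounded_op_zero : bounded_op (fun _ _ => RtoC 0).
Proof.
  assert (Z : forall n, sqn (fun _ => RtoC 0) n <= 0).
  { intros n. unfold sqn. rewrite rsum_zero; [lra|]. intros; rewrite Cmod_0; ring. }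
  split; [|split; [|split]].
  - intros x _. apply sq_summable_iff. exists 0. exact Z.
  - intros; unfold vadd; ring.
  - intros; unfold vscal; ring.
  - exists 0. intros x _. rewrite Rmult_0_l. apply l2norm_le; [lra|].
    intros n. specialize (Z n). lra.
Qed.

Lemma bounded_op_csum A (z : nat -> C) (e : nat -> vec) m :
  bounded_op A -> (forall l, sq_summable (e l)) ->
  sq_summable (fun i => csum (fun l => z l * e l i)%C m) /\
  A (fun i => csum (fun l => z l * e l i)%C m) = (fun i => csum (fun l => z l * A (e l) i)%C m).
Proof.
  intros [A1 [A2 [A3 _]]] He. induction m as [|m [IS IE]].
  - assert (H0 : (fun _ : nat => RtoC 0) = vscal (RtoC 0) (e 0%nat)).
    { apply functional_extensionality; intros; unfold vscal; ring. }
    simpl. rewrite H0. split; [now apply sq_summable_vscal|].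
    apply functional_extensionality. intros i. rewrite A3 by auto. unfold vscal; ring.
  - assert (HS : (fun i => csum (fun l => z l * e l i)%C (S m)) =
      vadd (fun i => csum (fun l => z l * e l i)%C m) (vscal (z m) (e m))) by reflexivity.
    assert (Hs := sq_summable_vscal (z m) (e m) (He m)).
    split; [rewrite HS; now apply sq_summable_vadd|].
    rewrite HS. apply functional_extensionality. intros i.
    rewrite A2, IE by auto. unfold vadd. rewrite A3 by auto. reflexivity.
Qed.

Lemma l2norm_vscal a x : l2norm (vscal a x) = Cmod a * l2norm x.
Proof.
  unfold l2norm, vscal.
  rewrite (Series_ext _ (fun n => Cmod a ^ 2 * Cmod (x n) ^ 2)).
  - rewrite Series_scal_l, sqrt_mult_alt by apply pow2_ge_0.
    rewrite sqrt_pow2 by apply Cmod_ge_0. reflexivity.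
  - intros n. now rewrite Cmod_mult, Rpow_mult_distr.
Qed.

(** For a bounded operator the supremum is taken over a nonempty bounded set, so it is finite and
    [real] loses nothing. Homogeneity extends the bound from the unit ball to all of l2. *)
Lemma op_norm_spec Q : bounded_op Q ->
  0 <= real (op_norm Q) /\
  (forall x, sq_summable x -> l2norm (Q x) <= real (op_norm Q) * l2norm x) /\
  (forall K, 0 <= K -> (forall x, sq_summable x -> l2norm (Q x) <= K * l2norm x) ->
     real (op_norm Q) <= K).
Proof.
  intros HQ. destruct (bounded_op_bound Q HQ) as [M [HM BQ]].
  set (E := fun r => exists x, sq_summable x /\ l2norm x <= 1 /\ r = l2norm (Q x)).
  change (op_norm Q) with (Lub_Rbar E).
  destruct (Lub_Rbar_correct E) as [Hub Hlub].
  assert (Hb : forall K, 0 <= K ->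
    (forall x, sq_summable x -> l2norm (Q x) <= K * l2norm x) -> Rbar_le (Lub_Rbar E) K).
  { intros K HK BK. apply Hlub. intros r [x [Hx [H1 ->]]]. simpl.
    eapply Rle_trans; [now apply BK|]. assert (P := l2norm_nonneg x). nra. }
  assert (B0 : exists x0, sq_summable x0 /\ l2norm x0 <= 1).
  { assert (Z : forall n, sqn (fun _ => RtoC 0) n <= 1 ^ 2).
    { intros n. unfold sqn. rewrite rsum_zero; [lra|]. intros; rewrite Cmod_0; ring. }
    exists (fun _ => RtoC 0). split; [apply sq_summable_iff; now exists (1 ^ 2)|].
    apply l2norm_le; [lra | exact Z]. }
  destruct B0 as [x0 [Hx0 Hn0]].
  assert (E0 : Rbar_le (l2norm (Q x0)) (Lub_Rbar E)) by (apply Hub; now exists x0).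
  assert (EM := Hb M HM BQ).
  destruct (Lub_Rbar E) as [l| |]; simpl in E0, EM; try contradiction.
  simpl. split; [assert (P := l2norm_nonneg (Q x0)); lra|]. split.
  - intros x Hx. assert (P := l2norm_nonneg x).
    destruct (Req_dec (l2norm x) 0) as [Z|Z].
    (* A vector of norm zero cannot be normalised; the crude bound [BQ] already gives
       [l2norm (Q x) <= 0]. *)
    + specialize (BQ x Hx). rewrite Z in *. lra.
    + assert (L : Rbar_le (l2norm (Q (vscal (RtoC (/ l2norm x)) x))) l).
      { apply Hub. exists (vscal (RtoC (/ l2norm x)) x).
        split; [now apply sq_summable_vscal|]. split; [|reflexivity].
        rewrite l2norm_vscal, Cmod_R, Rabs_right.
        - rewrite Rinv_l by exact Z. lra.
        - apply Rle_ge, Rlt_le, Rinv_0_lt_compat. lra. }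
      destruct HQ as [_ [_ [Q3 _]]].
      rewrite (functional_extensionality _ _ (Q3 (RtoC (/ l2norm x)) x Hx)) in L.
      rewrite l2norm_vscal, Cmod_R, Rabs_right in L
        by (apply Rle_ge, Rlt_le, Rinv_0_lt_compat; lra).
      simpl in L. apply (Rmult_le_compat_r (l2norm x)) in L; [|exact P].
      replace (/ l2norm x * l2norm (Q x) * l2norm x) with (l2norm (Q x)) in L
        by (field; exact Z). exact L.
  - intros K HK BK. exact (Hb K HK BK).
Qed.

Lemma rank_le_mono P n m : (n <= m)%nat -> rank_le P n -> rank_le P m.
Proof.
  intros Hnm [v [Hv H]]. exists v. split; [exact Hv|]. intros x Hx.
  destruct (H x Hx) as [a Ha]. exists (fun k => if Nat.ltb k n then a k else RtoC 0).
  intros i. rewrite (Ha i). rewrite (csum_tail_zero _ n m).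
  - apply csum_ext. intros k Hk. apply Nat.ltb_lt in Hk. now rewrite Hk.
  - exact Hnm.
  - intros k Hk. apply Nat.ltb_ge in Hk. rewrite Hk. ring.
Qed.

Lemma rank_le_vsub P Q n m : rank_le P n -> rank_le Q m ->
  rank_le (fun x => vsub (P x) (Q x)) (n + m).
Proof.
  intros [v [Hv HP]] [w [Hw HQ]].
  exists (fun k => if Nat.ltb k n then v k else w (k - n)%nat). split.
  - intros k. destruct (Nat.ltb k n); auto.
  - intros x Hx. destruct (HP x Hx) as [a Ha]. destruct (HQ x Hx) as [b Hb].
    exists (fun k => if Nat.ltb k n then a k else Copp (b (k - n)%nat)).
    intros i. unfold vsub. rewrite (Ha i), (Hb i), csum_split.
    unfold Cminus. f_equal.
    + apply csum_ext. intros k Hk. apply Nat.ltb_lt in Hk. now rewrite Hk.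
    + transitivity (csum (fun k => (- RtoC 1) * (b k * w k i))%C m); [rewrite csum_scal; ring|].
      apply csum_ext. intros k Hk.
      replace (n + k - n)%nat with k by lia.
      destruct (Nat.ltb_spec (n + k) n); [lia|]. ring.
Qed.

(** The infimum is finite: the zero operator is a candidate and all candidates are nonnegative.
    Everything later about approximation numbers goes through these three clauses. *)
Lemma approx_num_spec A n : bounded_op A ->
  0 <= approx_num A n /\
  (forall P K, 0 <= K -> bounded_op P -> rank_le P n ->
     (forall x, sq_summable x -> l2norm (vsub (A x) (P x)) <= K * l2norm x) ->
     approx_num A n <= K) /\
  (forall eps, approx_num A n < eps -> exists P, bounded_op P /\ rank_le P n /\
     forall x, sq_summable x -> l2norm (vsub (A x) (P x)) <= eps * l2norm x).
Proof.
  intros HA. unfold approx_num.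
  set (E := fun r => exists P, bounded_op P /\ rank_le P n /\
                   r = real (op_norm (fun x => vsub (A x) (P x)))).
  destruct (Glb_Rbar_correct E) as [Hlb Hglb].
  assert (Hpos : Rbar_le 0 (Glb_Rbar E)).
  { apply Hglb. intros r [P [HP [_ ->]]]. simpl.
    apply (op_norm_spec _ (bounded_op_vsub A P HA HP)). }
  assert (Hle : forall r, E r -> Rbar_le (Glb_Rbar E) r) by (intros; now apply Hlb).
  assert (HE : exists r, E r).
  { eexists. exists (fun _ _ => RtoC 0). split; [exact bounded_op_zero|].
    split; [|reflexivity]. exists (fun _ _ => RtoC 0). split.
    - intros _. now apply bounded_op_zero with (x := fun _ => RtoC 0);
        apply sq_summable_iff; exists 0; intros; unfold sqn;
        rewrite rsum_zero; [lra | intros; rewrite Cmod_0; ring].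
    - intros x Hx. exists (fun _ => RtoC 0). intros i. symmetry.
      apply csum_zero. intros; ring. }
  destruct HE as [r0 Hr0]. assert (L0 := Hle r0 Hr0).
  destruct (Glb_Rbar E) as [g| |] eqn:Eg; simpl in Hpos, L0; try contradiction.
  simpl. split; [exact Hpos|]. split.
  - intros P K HK HP Hr HB.
    assert (L : Rbar_le g (real (op_norm (fun x => vsub (A x) (P x)))))
      by (apply Hle; now exists P).
    eapply Rle_trans; [exact L|].
    now apply (op_norm_spec _ (bounded_op_vsub A P HA HP)).
  - intros eps Heps.
    destruct (classic (exists r, E r /\ r < eps)) as [[r [[P [HP [Hr ->]]] Hlt]]|N].
    + exists P. split; [exact HP|]. split; [exact Hr|]. intros x Hx.
      eapply Rle_trans;
        [now apply (op_norm_spec _ (bounded_op_vsub A P HA HP))|].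
      apply Rmult_le_compat_r; [apply l2norm_nonneg | lra].
    + exfalso. assert (Rbar_le eps g); [|simpl in *; lra].
      apply Hglb. intros r Hr. simpl. destruct (Rle_lt_dec eps r) as [|H]; [assumption|].
      exfalso. apply N. now exists r.
Qed.

Lemma approx_num_antitone A n m : bounded_op A -> (n <= m)%nat ->
  approx_num A m <= approx_num A n.
Proof.
  intros HA Hnm. apply Rnot_lt_le. intros H.
  destruct (proj2 (proj2 (approx_num_spec A n HA)) _ H) as [P [HP [Hr HB]]].
  set (e := (approx_num A n + approx_num A m) / 2).
  destruct (proj2 (proj2 (approx_num_spec A n HA)) e) as [P' [HP' [Hr' HB']]];
    [unfold e; lra|].
  assert (approx_num A m <= e); [|unfold e in *; lra].
  apply (proj1 (proj2 (approx_num_spec A m HA)) P'); auto.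
  - destruct (approx_num_spec A n HA) as [Q _].
    destruct (approx_num_spec A m HA) as [Q' _]. unfold e; lra.
  - now apply (rank_le_mono P' n m).
Qed.

(** Coefficient against the row [f k] cut at length [L k], without conjugation; being a finite sum
    it raises no convergence question. *)
Definition fnl (f : nat -> nat -> C) (L : nat -> nat) (k : nat) (x : vec) : C :=
  csum (fun i => f k i * x i)%C (L k).

(* Plays the role of two orthonormal systems: the [e l] themselves, and the
   representing vectors of the functionals [fnl f L k]. *)
Definition test_system (e : nat -> vec) (f : nat -> nat -> C) (L : nat -> nat) : Prop :=
  (forall l, sq_summable (e l)) /\
  (forall m z n, sqn (fun i => csum (fun l => z l * e l i)%C m) n <= sqn z m) /\
  (forall x m, sq_summable x -> sqn (fun k => fnl f L k x) m <= l2norm x ^ 2).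

Lemma fnl_vsub f L k x y : fnl f L k (vsub x y) = (fnl f L k x - fnl f L k y)%C.
Proof. unfold fnl, vsub. rewrite <- csum_minus. apply csum_ext. intros; ring. Qed.

Lemma fnl_csum f L k (a : nat -> C) (v : nat -> vec) m :
  fnl f L k (fun i => csum (fun r => a r * v r i)%C m) = csum (fun r => a r * fnl f L k (v r))%C m.
Proof.
  unfold fnl. erewrite csum_ext; [|intros i _; rewrite <- csum_scal; reflexivity].
  rewrite csum_swap. apply csum_ext. intros r _. rewrite <- csum_scal.
  apply csum_ext. intros; ring.
Qed.

Lemma basis_eq l i : basis l i = if Nat.eqb i l then RtoC 1 else RtoC 0.
Proof. reflexivity. Qed.

Lemma csum_basis l (g : nat -> C) m :
  csum (fun k => basis l k * g k)%C m = if Nat.ltb l m then g l else RtoC 0.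
Proof.
  rewrite <- (csum_delta l g). apply csum_ext. intros k _. rewrite basis_eq, Nat.eqb_sym.
  destruct (Nat.eqb l k); ring.
Qed.

Lemma sqn_basis l m : sqn (basis l) m = if Nat.ltb l m then 1 else 0.
Proof.
  unfold sqn. rewrite <- rsum_delta. apply rsum_ext. intros k _.
  rewrite basis_eq, Nat.eqb_sym. destruct (Nat.eqb l k);
    [rewrite Cmod_1 | rewrite Cmod_0]; ring.
Qed.

Lemma test_system_norm e f L l : test_system e f L -> l2norm (e l) <= 1.
Proof.
  intros [_ [H _]]. apply l2norm_le; [lra|]. intros n.
  specialize (H (S l) (basis l) n). rewrite sqn_basis in H.
  replace (Nat.ltb l (S l)) with true in H by (symmetry; apply Nat.ltb_lt; lia).
  rewrite pow1. eapply Rle_trans; [|exact H]. apply Req_le, rsum_ext. intros i _.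
  rewrite (csum_basis l (fun k => e k i)).
  replace (Nat.ltb l (S l)) with true by (symmetry; apply Nat.ltb_lt; lia). reflexivity.
Qed.

Lemma test_system_fnl e f L k x : test_system e f L -> sq_summable x ->
  Cmod (fnl f L k x) <= l2norm x.
Proof.
  intros [_ [_ H]] Hx. apply sq_le_cancel; [apply l2norm_nonneg|].
  eapply Rle_trans; [|exact (H x (S k) Hx)].
  apply (rsum_term (fun k => Cmod (fnl f L k x) ^ 2)); [intros; apply pow2_ge_0 | lia].
Qed.

Lemma test_system_bounded e f L A : test_system e f L -> bounded_op A ->
  exists M, 0 <= M /\ forall k, Cmod (fnl f L k (A (e k))) <= M.
Proof.
  intros HT HA. destruct (bounded_op_bound A HA) as [M [HM B]]. exists M.
  split; [exact HM|]. intros k.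
  assert (He : sq_summable (e k)) by apply HT.
  eapply Rle_trans; [apply (test_system_fnl e); [exact HT | now apply HA]|].
  eapply Rle_trans; [now apply B|]. assert (Q := test_system_norm e f L k HT).
  assert (P := l2norm_nonneg (e k)). nra.
Qed.

Lemma is_lim_seq_0_iff (u : nat -> R) : (forall n, 0 <= u n) ->
  (is_lim_seq u 0 <-> forall eps, 0 < eps -> exists N, forall n, (N <= n)%nat -> u n < eps).
Proof.
  intros Hu. rewrite <- is_lim_seq_spec. simpl. split.
  - intros H eps He. destruct (H (mkposreal eps He)) as [N HN]. exists N. intros n Hn.
    specialize (HN n Hn). simpl in HN. rewrite Rminus_0_r, Rabs_right in HN;
      [exact HN | apply Rle_ge, Hu].
  - intros H eps. destruct (H eps (cond_pos eps)) as [N HN]. exists N. intros n Hn.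
    rewrite Rminus_0_r, Rabs_right; [now apply HN | apply Rle_ge, Hu].
Qed.

(** Bessel's inequality makes the coefficients of [x] square summable. *)
Lemma test_system_fnl_lim e f L x : test_system e f L -> sq_summable x ->
  forall eps, 0 < eps -> exists N, forall k, (N <= k)%nat -> Cmod (fnl f L k x) < eps.
Proof.
  intros [_ [_ H]] Hx eps He.
  assert (S : sq_summable (fun k => fnl f L k x)).
  { apply sq_summable_iff. exists (l2norm x ^ 2). intros m. now apply H. }
  apply ex_series_lim_0 in S. rewrite is_lim_seq_0_iff in S by (intros; apply pow2_ge_0).
  destruct (S (eps ^ 2)) as [N HN]; [now apply pow_lt|]. exists N. intros k Hk.
  specialize (HN k Hk). apply Rnot_le_lt. intros Q.
  assert (eps ^ 2 <= Cmod (fnl f L k x) ^ 2) by (apply pow_incr; lra). lra.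
Qed.

Lemma strict_mono_ge_id (phi : nat -> nat) :
  (forall k, (phi k < phi (S k))%nat) -> forall k, (k <= phi k)%nat.
Proof. intros H k. induction k as [|k IH]; [lia | specialize (H k); lia]. Qed.

(** Otherwise some subsequence of the [e j] has coefficients at least [eps], and along a further one
    [A (e j)] converges to some [y]. The coefficient of [A (e j)] differs from that of [y] by at
    most [l2norm (A (e j) - y)], and the coefficients of the fixed vector [y] tend to [0]. *)
Lemma test_system_compact e f L A : test_system e f L -> bounded_op A -> compact_op A ->
  is_lim_seq (fun k => Cmod (fnl f L k (A (e k)))) 0.
Proof.
  intros HT HA HC. apply is_lim_seq_0_iff; [intros; apply Cmod_ge_0|].
  intros eps He. apply NNPP. intros HN.
  assert (Hbad : forall N, exists n, (N <= n)%nat /\ eps <= Cmod (fnl f L n (A (e n)))).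
  { intros N. apply NNPP. intros Q. apply HN. exists N. intros n Hn.
    apply Rnot_le_lt. intros Q'. apply Q. now exists n. }
  set (psi := fun N => proj1_sig (constructive_indefinite_description _ (Hbad N))).
  assert (Hpsi : forall N, (N <= psi N)%nat /\ eps <= Cmod (fnl f L (psi N) (A (e (psi N))))).
  { intros N. unfold psi. now destruct (constructive_indefinite_description _ (Hbad N)). }
  destruct (HC (fun k => e (psi k))) as [phi [y [Hphi [Hy Hlim]]]].
  - intros k. apply HT.
  - exists 1. intros k. now apply (test_system_norm e f L).
  - rewrite is_lim_seq_0_iff in Hlim by (intros; apply l2norm_nonneg).
    destruct (Hlim (eps / 2)) as [N1 H1]; [lra|].
    destruct (test_system_fnl_lim e f L y HT Hy (eps / 2)) as [N2 H2]; [lra|].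
    set (k := max N1 N2).
    specialize (H1 k ltac:(unfold k; lia)).
    assert (Hk := strict_mono_ge_id phi Hphi k).
    destruct (Hpsi (phi k)) as [G1 G2].
    specialize (H2 (psi (phi k)) ltac:(unfold k in *; lia)).
    set (j := psi (phi k)) in *.
    assert (He' : sq_summable (A (e j))) by (apply HA, HT).
    assert (Q := test_system_fnl e f L j (vsub (A (e j)) y) HT
      (proj1 (l2norm_sq_vsub _ _ He' Hy))).
    rewrite fnl_vsub in Q.
    assert (T := Cmod_triangle (fnl f L j (A (e j)) - fnl f L j y) (fnl f L j y)).
    replace (fnl f L j (A (e j)) - fnl f L j y + fnl f L j y)%C
      with (fnl f L j (A (e j))) in T by ring. lra.
Qed.

(** * Dyadic levels and Schatten necessity *)

Lemma rpow_nonneg x q : 0 <= rpow x q.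
Proof. unfold rpow. destruct (Rle_dec x 0); [lra | apply Rlt_le, exp_pos]. Qed.

Lemma rpow_Rpower x q : 0 < x -> rpow x q = Rpower x q.
Proof. intros H. unfold rpow. destruct (Rle_dec x 0); [lra | reflexivity]. Qed.

Lemma rpow_gt_0 x q : 0 < x -> 0 < rpow x q.
Proof. intros H. rewrite rpow_Rpower by exact H. apply exp_pos. Qed.

Lemma rpow_le_0 x q : x <= 0 -> rpow x q = 0.
Proof. intros H. unfold rpow. destruct (Rle_dec x 0); [reflexivity | lra]. Qed.

Lemma rpow_mono x y q : 0 <= q -> x <= y -> rpow x q <= rpow y q.
Proof.
  intros Hq H. destruct (Rle_lt_dec x 0) as [Hx|Hx].
  - rewrite (rpow_le_0 x) by exact Hx. apply rpow_nonneg.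
  - rewrite !rpow_Rpower by lra. apply Rle_Rpower_l; lra.
Qed.

Lemma rpow_mult_distr x y q : 0 <= x -> 0 <= y -> rpow (x * y) q = rpow x q * rpow y q.
Proof.
  intros Hx Hy. destruct (Req_dec x 0) as [->|Nx].
  - rewrite Rmult_0_l, !(rpow_le_0 0) by lra. ring.
  - destruct (Req_dec y 0) as [->|Ny].
    + rewrite Rmult_0_r, !(rpow_le_0 0) by lra. ring.
    + rewrite !rpow_Rpower by (try apply Rmult_lt_0_compat; lra).
      symmetry. apply Rpower_mult_distr; lra.
Qed.

Lemma rpow_minus_1 x q : 0 <= x -> rpow x q = x * rpow x (q - 1).
Proof.
  intros Hx. destruct (Req_dec x 0) as [->|Nx].
  - rewrite rpow_le_0 by lra. ring.
  - rewrite !rpow_Rpower by lra. rewrite <- (Rpower_1 x) at 2 by lra.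
    rewrite <- Rpower_plus. f_equal. ring.
Qed.

Lemma rpow_sqrt b q : 0 <= b -> rpow (sqrt b) q = rpow b (q / 2).
Proof.
  intros Hb. destruct (Req_dec b 0) as [->|Nb].
  - rewrite sqrt_0, !rpow_le_0 by lra. reflexivity.
  - assert (0 < sqrt b) by (apply sqrt_lt_R0; lra).
    rewrite !rpow_Rpower by lra.
    rewrite <- (Rpower_sqrt b) by lra. rewrite Rpower_mult. f_equal. field.
Qed.

Lemma INR_pow2 n : INR (2 ^ n) = 2 ^ n.
Proof. rewrite pow_INR. replace (INR 2) with 2 by (simpl; lra). reflexivity. Qed.

Definition lev (B : R) (k : nat) : R := B / 2 ^ k.

Lemma lev_pos B k : 0 < B -> 0 < lev B k.
Proof. intros H. apply Rdiv_lt_0_compat; [exact H | apply pow_lt; lra]. Qed.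

Lemma lev_S B k : lev B (S k) = lev B k / 2.
Proof. unfold lev. simpl. field. apply pow_nonzero. lra. Qed.

Lemma lev_S_half B k : lev B (S k) = lev (B / 2) k.
Proof. unfold lev. simpl. field. apply pow_nonzero. lra. Qed.

Lemma lev_0 B : lev B 0 = B.
Proof. unfold lev. simpl. field. Qed.

Lemma lev_antitone B k K : 0 < B -> (k <= K)%nat -> lev B K <= lev B k.
Proof.
  intros HB H. induction H as [|K H IH]; [lra|].
  rewrite lev_S. assert (P := lev_pos B K HB). lra.
Qed.

Lemma lev_below B x : 0 < B -> 0 < x -> exists K, lev B K < x.
Proof.
  intros HB Hx. destruct (INR_unbounded (B / x)) as [K HK]. exists K.
  assert (L : INR K <= 2 ^ K).
  { rewrite <- INR_pow2. apply le_INR. apply Nat.lt_le_incl, Nat.pow_gt_lin_r. lia. }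
  assert (P : 0 < 2 ^ K) by (apply pow_lt; lra).
  unfold lev. apply Rmult_lt_reg_r with (2 ^ K); [exact P|].
  replace (B / 2 ^ K * 2 ^ K) with B by (field; lra).
  apply Rmult_lt_reg_r with (/ x); [now apply Rinv_0_lt_compat|].
  replace (x * 2 ^ K * / x) with (2 ^ K) by (field; lra). unfold Rdiv in HK. lra.
Qed.

Lemma lev_bracket B x : 0 < B -> 0 < x <= B -> exists k, lev B k < x <= 2 * lev B k.
Proof.
  intros HB [Hx HxB]. destruct (lev_below B x HB Hx) as [K HK]. revert HK.
  induction K as [|K IH]; intros HK.
  - rewrite lev_0 in HK. lra.
  - destruct (Rlt_le_dec (lev B K) x) as [H|H]; [now apply IH|].
    exists (S K). split; [exact HK|]. rewrite lev_S. lra.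
Qed.

(** The levels below [x] form a geometric progression whose largest term is at most [x], so the sum
    is comparable to that term, uniformly in [B] and in the number of levels. *)
Lemma sum_levels_below (p : R) : 0 < p -> exists D, 0 <= D /\ forall B K x, 0 < B -> 0 <= x ->
  rsum (fun k => if Rle_dec (lev B k) x then rpow (lev B k) p else 0) K <= D * rpow x p.
Proof.
  intros Hp. set (rho := rpow (1 / 2) p).
  assert (Hr0 : 0 < rho) by (apply rpow_gt_0; lra).
  assert (Hr1 : rho < 1).
  { unfold rho. rewrite rpow_Rpower by lra.
    replace 1 with (Rpower 1 p) at 2 by (unfold Rpower; rewrite ln_1, Rmult_0_r; apply exp_0).
    apply Rlt_Rpower_l; lra. }
  exists (/ (1 - rho)). assert (HD : 0 < / (1 - rho)) by (apply Rinv_0_lt_compat; lra).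
  split; [lra|]. set (D := / (1 - rho)) in *.
  assert (HDe : 1 + D * rho = D) by (unfold D; field; lra).
  (* The induction peels off the top level and halves [B]. With [Rmin x B] on the right, the peeled
     term is absorbed by the identity [1 + D * rho = D]. *)
  assert (Strong : forall K B x, 0 < B -> 0 <= x ->
    rsum (fun k => if Rle_dec (lev B k) x then rpow (lev B k) p else 0) K
      <= D * rpow (Rmin x B) p).
  { induction K as [|K IH]; intros B x HB Hx.
    - simpl. apply Rmult_le_pos; [lra | apply rpow_nonneg].
    - change (S K) with (1 + K)%nat. rewrite rsum_split. cbn [rsum].
      rewrite lev_0, Rplus_0_l.
      rewrite (rsum_ext _ (fun k => if Rle_dec (lev (B / 2) k) x
          then rpow (lev (B / 2) k) p else 0))
        by (intros i _; change (1 + i)%nat with (S i); now rewrite lev_S_half).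
      assert (I := IH (B / 2) x ltac:(lra) Hx).
      destruct (Rle_dec B x) as [H|H].
      + rewrite Rmin_right in I |- * by lra.
        assert (E : rpow (B / 2) p = rho * rpow B p).
        { unfold rho. rewrite <- rpow_mult_distr by lra. f_equal. lra. }
        rewrite E in I.
        assert (0 <= rpow B p) by apply rpow_nonneg. nra.
      + rewrite Rplus_0_l. eapply Rle_trans; [exact I|].
        apply Rmult_le_compat_l; [lra|]. apply rpow_mono; [lra|].
        apply Rle_min_compat_l. lra. }
  intros B K x HB Hx. eapply Rle_trans; [now apply Strong|].
  apply Rmult_le_compat_l; [lra|]. apply rpow_mono; [lra | apply Rmin_l].
Qed.

(** Supplies a common cutoff, so that sums over infinitely many levels or indices can be replaced by
    finite double sums, which may be exchanged freely. *)
Lemma finite_choice_bound (Q : nat -> nat -> Prop) m :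
  (forall n, (n < m)%nat -> exists k, Q n k) ->
  exists K, forall n, (n < m)%nat -> exists k, (k < K)%nat /\ Q n k.
Proof.
  induction m as [|m IH]; intros H.
  - exists 0%nat. intros; lia.
  - destruct IH as [K HK]; [intros; apply H; lia|].
    destruct (H m) as [k Hk]; [lia|]. exists (max K (S k)). intros n Hn.
    destruct (Nat.eq_dec n m) as [->|D].
    + exists k. split; [lia | exact Hk].
    + destruct (HK n) as [k' [L Hk']]; [lia|]. exists k'. split; [lia | exact Hk'].
Qed.

Lemma least_nat (Q : nat -> Prop) : (exists n, Q n) ->
  exists n, Q n /\ forall k, (k < n)%nat -> ~ Q k.
Proof.
  intros [n Hn]. induction n as [n IH] using lt_wf_ind.
  destruct (classic (exists k, (k < n)%nat /\ Q k)) as [[k [Hk HQ]]|N].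
  - now apply (IH k).
  - exists n. split; [exact Hn|]. intros k Hk HQ. apply N. now exists k.
Qed.

(** The matrix of [Q] along the two systems is a compression of [Q]: its columns are combinations of
    the coefficient sequences of the [v r], and it inherits the norm bound [M]. The trace bound for
    finite matrices then applies. *)
Lemma test_system_trace e f L Q N M m :
  test_system e f L -> bounded_op Q -> rank_le Q N -> 0 <= M ->
  (forall x, sq_summable x -> l2norm (Q x) <= M * l2norm x) ->
  rsum (fun k => Cmod (fnl f L k (Q (e k)))) m <= INR N * M.
Proof.
  intros HT HQ [v [Hv Hr]] HM HB. pose proof HT as [He [Hz Hf]].
  set (a := fun l => proj1_sig (constructive_indefinite_description _ (Hr (e l) (He l)))).
  assert (Ha : forall l i, Q (e l) i = csum (fun k => a l k * v k i)%C N).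
  { intros l. unfold a.
    now destruct (constructive_indefinite_description _ (Hr (e l) (He l))). }
  apply (diag_sum_le_rank_norm m N (fun k l => fnl f L k (Q (e l)))
    (fun r k => fnl f L k (v r)) a M HM).
  - intros k l _ _. rewrite (functional_extensionality _ _ (Ha l)). apply fnl_csum.
  - intros z. destruct (bounded_op_csum Q z e m HQ He) as [Hs Eq].
    set (y := fun i => csum (fun l => z l * e l i)%C m) in *.
    assert (E : (fun k => csum (fun l => fnl f L k (Q (e l)) * z l)%C m)
      = (fun k => fnl f L k (Q y))).
    { apply functional_extensionality. intros k. rewrite Eq, fnl_csum.
      apply csum_ext. intros; apply Cmult_comm. }
    rewrite E. eapply Rle_trans; [apply Hf; now apply HQ|].
    assert (l2norm y ^ 2 <= sqn z m) by (apply (l2_of_sqn_bounded y); intros; apply Hz).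
    assert (l2norm (Q y) ^ 2 <= (M * l2norm y) ^ 2)
      by (apply pow_incr; split; [apply l2norm_nonneg | now apply HB]).
    assert (0 <= M ^ 2) by apply pow2_ge_0. nra.
Qed.

(** [r k] is taken as the least index at which the approximation number drops below [lev B k]. The
    last clause records minimality; it later turns [INR (r k)] into a count of approximation
    numbers. *)
Lemma level_approximants A B q : bounded_op A -> 0 < B -> 0 < q ->
  ex_series (fun n => rpow (approx_num A n) q) ->
  exists (r : nat -> nat) (P : nat -> vec -> vec), forall k,
    bounded_op (P k) /\ rank_le (P k) (r k) /\
    (forall x, sq_summable x -> l2norm (vsub (A x) (P k x)) <= lev B k * l2norm x) /\
    (forall n, (n < r k)%nat -> lev B k <= approx_num A n).
Proof.
  intros HA HB Hq Hs.
  assert (Hex : forall k, exists rP : nat * (vec -> vec),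
    bounded_op (snd rP) /\ rank_le (snd rP) (fst rP) /\
    (forall x, sq_summable x -> l2norm (vsub (A x) (snd rP x)) <= lev B k * l2norm x) /\
    (forall n, (n < fst rP)%nat -> lev B k <= approx_num A n)).
  { intros k. assert (Hk := lev_pos B k HB).
    destruct (least_nat (fun n => approx_num A n < lev B k)) as [r [Hr Hmin]].
    - apply ex_series_lim_0 in Hs.
      rewrite is_lim_seq_0_iff in Hs by (intros; apply rpow_nonneg).
      destruct (Hs (rpow (lev B k) q)) as [N HN]; [now apply rpow_gt_0|].
      exists N. specialize (HN N (le_n N)). apply Rnot_le_lt. intros H.
      apply (rpow_mono _ _ q) in H; lra.
    - destruct (proj2 (proj2 (approx_num_spec A r HA)) _ Hr) as [P [HP [HrP HPb]]].
      exists (r, P). simpl. repeat (split; [assumption|]). intros n Hn.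
      apply Rnot_lt_le. now apply Hmin. }
  exists (fun k => fst (proj1_sig (constructive_indefinite_description _ (Hex k)))).
  exists (fun k => snd (proj1_sig (constructive_indefinite_description _ (Hex k)))).
  intros k. now destruct (constructive_indefinite_description _ (Hex k)).
Qed.

(* Summing the trace bound over the increments [P (k+1) - P k], of rank
   [r k + r (k+1)] and norm at most [2 * lev B k]. *)
Lemma level_approximants_trace e f L A B (r : nat -> nat) (P : nat -> vec -> vec) m :
  test_system e f L -> bounded_op A -> 0 < B -> r 0%nat = 0%nat ->
  (forall k, bounded_op (P k) /\ rank_le (P k) (r k) /\
    (forall x, sq_summable x -> l2norm (vsub (A x) (P k x)) <= lev B k * l2norm x)) ->
  forall K, rsum (fun j => Cmod (fnl f L j (P K (e j)))) m
    <= 6 * rsum (fun k => lev B k * INR (r k)) K + 4 * (lev B K * INR (r K)).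
Proof.
  intros HT HA HB Hr0 HP. pose proof HT as [He _]. induction K as [|K IH].
  - rewrite Hr0. cbn [rsum INR]. rewrite rsum_zero; [lra|]. intros j _.
    destruct (HP 0%nat) as [_ [[v [_ Hr]] _]]. rewrite Hr0 in Hr.
    destruct (Hr (e j) (He j)) as [a Ha]. unfold fnl. rewrite csum_zero; [apply Cmod_0|].
    intros i _. rewrite (Ha i). simpl. ring.
  - destruct (HP K) as [P1 [R1 B1]]. destruct (HP (S K)) as [P2 [R2 B2]].
    assert (HK := lev_pos B K HB).
    assert (T := test_system_trace e f L (fun x => vsub (P (S K) x) (P K x))
      (r (S K) + r K) (2 * lev B K) m HT (bounded_op_vsub _ _ P2 P1)
      (rank_le_vsub _ _ _ _ R2 R1) ltac:(lra)).
    assert (Hn : forall x, sq_summable x ->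
      l2norm (vsub (P (S K) x) (P K x)) <= 2 * lev B K * l2norm x).
    { intros x Hx. assert (Q := l2norm_nonneg x).
      apply sq_le_cancel; [apply Rmult_le_pos; lra|].
      assert (E : vsub (P (S K) x) (P K x)
        = vsub (vsub (A x) (P K x)) (vsub (A x) (P (S K) x))).
      { apply functional_extensionality. intros i. unfold vsub. ring. }
      rewrite E.
      assert (S1 : sq_summable (vsub (A x) (P K x)))
        by (apply l2norm_sq_vsub; [now apply HA | now apply P1]).
      assert (S2 : sq_summable (vsub (A x) (P (S K) x)))
        by (apply l2norm_sq_vsub; [now apply HA | now apply P2]).
      destruct (l2norm_sq_vsub _ _ S1 S2) as [_ Z]. eapply Rle_trans; [exact Z|].
      assert (Y1 : l2norm (vsub (A x) (P K x)) ^ 2 <= (lev B K * l2norm x) ^ 2)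
        by (apply pow_incr; split; [apply l2norm_nonneg | now apply B1]).
      assert (Y2 : l2norm (vsub (A x) (P (S K) x)) ^ 2 <= (lev B K * l2norm x) ^ 2).
      { apply pow_incr; split; [apply l2norm_nonneg|].
        eapply Rle_trans; [now apply B2|]. apply Rmult_le_compat_r; [exact Q|].
        apply lev_antitone; [exact HB | lia]. }
      lra. }
    specialize (T Hn). rewrite plus_INR in T.
    apply Rle_trans with (rsum (fun j => Cmod (fnl f L j (P K (e j)))
      + Cmod (fnl f L j (vsub (P (S K) (e j)) (P K (e j))))) m).
    + apply rsum_le. intros j _. rewrite fnl_vsub.
      assert (Z := Cmod_triangle (fnl f L j (P K (e j)))
        (fnl f L j (P (S K) (e j)) - fnl f L j (P K (e j)))).
      replace (fnl f L j (P K (e j)) + (fnl f L j (P (S K) (e j)) - fnl f L j (P K (e j))))%C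
        with (fnl f L j (P (S K) (e j))) in Z by ring. exact Z.
    (* Since [lev B K = 2 * lev B (S K)], the increment costs [4 * lev B (S K) * INR (r (S K))] plus
       [2 * lev B K * INR (r K)]. The latter joins the [4] left by the previous step, which gives
       the [6]. *)
    + rewrite rsum_plus. cbn [rsum]. rewrite lev_S. lra.
Qed.

(** The coefficients above [2 * lev B K] are summed by the trace bound for [P K]. Weighting with
    [rpow (lev B K) (q - 1)] and summing over [K] recovers the q-th powers, because every positive
    [t j] is comparable to some level. *)
Lemma test_system_schatten e f L A q :
  test_system e f L -> bounded_op A -> 1 < q ->
  ex_series (fun n => rpow (approx_num A n) q) ->
  ex_series (fun k => rpow (Cmod (fnl f L k (A (e k)))) q).
Proof.
  intros HT HA Hq Hs. pose proof HT as [He _].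
  destruct (bounded_op_bound A HA) as [M [HM BA]].
  (* [B] strictly exceeds the norm bound, so [approx_num A 0 < lev B 0]. This forces [r 0 = 0], and
     the telescoping starts from the zero operator. *)
  set (B := M + 1). assert (HB : 0 < B) by (unfold B; lra).
  destruct (level_approximants A B q HA HB ltac:(lra) Hs) as [r [P HP]].
  set (t := fun k => Cmod (fnl f L k (A (e k)))).
  assert (Ht0 : forall k, 0 <= t k) by (intros; apply Cmod_ge_0).
  assert (HtB : forall k, t k <= B).
  { intros k. unfold t. eapply Rle_trans; [apply (test_system_fnl e); auto; now apply HA|].
    eapply Rle_trans; [now apply BA|]. assert (Q := test_system_norm e f L k HT).
    assert (Q' := l2norm_nonneg (e k)). unfold B. nra. }
  assert (Hr0 : r 0%nat = 0%nat).
  { destruct (r 0%nat) as [|n] eqn:E; [reflexivity|]. exfalso.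
    destruct (HP 0%nat) as [_ [_ [_ H]]]. specialize (H 0%nat ltac:(lia)).
    rewrite lev_0 in H.
    assert (approx_num A 0 <= M); [|unfold B in H; lra].
    apply (proj1 (proj2 (approx_num_spec A 0 HA)) (fun _ _ => RtoC 0) M HM bounded_op_zero).
    - exists e. split; [exact He|]. intros x _. exists (fun _ => RtoC 0). reflexivity.
    - intros x Hx. replace (vsub (A x) (fun _ => RtoC 0)) with (A x); [now apply BA|].
      apply functional_extensionality. intros i. unfold vsub. ring. }
  set (D := fun k => lev B k * INR (r k)).
  assert (HD0 : forall k, 0 <= D k).
  { intros k. apply Rmult_le_pos; [apply Rlt_le, lev_pos, HB | apply pos_INR]. }
  (* If [t j > 2 * lev B K], replacing [A] by [P K] changes the coefficient by at most [lev B K], so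
     at least half of it survives. The [12] is twice the [6] of the telescoped bound. *)
  assert (Hlevel : forall m K,
    rsum (fun j => if Rlt_dec (2 * lev B K) (t j) then t j else 0) m <= 12 * rsum D (S K)).
  { intros m K.
    assert (G := level_approximants_trace e f L A B r P m HT HA HB Hr0
      (fun k => let H := HP k in conj (proj1 H)
        (conj (proj1 (proj2 H)) (proj1 (proj2 (proj2 H))))) K).
    apply Rle_trans with (2 * rsum (fun j => Cmod (fnl f L j (P K (e j)))) m).
    - rewrite <- rsum_scal. apply rsum_le. intros j _.
      destruct (Rlt_dec (2 * lev B K) (t j)) as [H|H];
        [|assert (Z := Cmod_ge_0 (fnl f L j (P K (e j)))); lra].
      destruct (HP K) as [P1 [_ [B1 _]]].
      assert (S1 : sq_summable (vsub (A (e j)) (P K (e j))))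
        by (apply l2norm_sq_vsub; [apply HA, He | apply P1, He]).
      assert (Z := test_system_fnl e f L j _ HT S1).
      assert (Z2 := B1 (e j) (He j)). assert (Z3 := test_system_norm e f L j HT).
      assert (Z4 := lev_pos B K HB). rewrite fnl_vsub in Z.
      assert (Z5 := Cmod_triangle (fnl f L j (A (e j)) - fnl f L j (P K (e j)))
        (fnl f L j (P K (e j)))).
      replace (fnl f L j (A (e j)) - fnl f L j (P K (e j)) + fnl f L j (P K (e j)))%C
        with (fnl f L j (A (e j))) in Z5 by ring.
      fold (t j) in Z5. assert (Z6 := l2norm_nonneg (e j)). nra.
    - fold (D K) in G. change (fun k => lev B k * INR (r k)) with D in G.
      cbn [rsum]. specialize (HD0 K). lra. }
  destruct (sum_levels_below (q - 1) ltac:(lra)) as [C1 [HC1 L1]].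
  destruct (sum_levels_below q ltac:(lra)) as [C2 [HC2 L2]].
  set (Sa := Series (fun n => rpow (approx_num A n) q)).
  (* The summand is [r k] copies of [rpow (lev B k) q], each charged to one of the [r k]
     approximation numbers that are at least [lev B k]. For a fixed approximation number the charges
     are geometric. *)
  assert (HDsum : forall KK, rsum (fun k => rpow (lev B k) (q - 1) * D k) KK <= C2 * Sa).
  { intros KK. destruct (finite_choice_bound (fun k n => n = r k) KK) as [NN HNN];
      [intros k _; now exists (r k)|].
    apply Rle_trans with (rsum (fun k => rsum (fun n =>
      if Rle_dec (lev B k) (approx_num A n) then rpow (lev B k) q else 0) NN) KK).
    - apply rsum_le. intros k Hk. destruct (HNN k Hk) as [n [Hn ->]].
      replace (rpow (lev B k) (q - 1) * D k) with (INR (r k) * rpow (lev B k) q).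
      2:{ unfold D. rewrite (rpow_minus_1 (lev B k) q) by (apply Rlt_le, lev_pos, HB). ring. }
      rewrite <- rsum_const. eapply Rle_trans; [|apply (rsum_mono _ (r k) NN); [lia|]].
      + apply rsum_le. intros n Hn'. destruct (HP k) as [_ [_ [_ H]]].
        destruct (Rle_dec (lev B k) (approx_num A n)) as [|N]; [lra|].
        exfalso. apply N. now apply H.
      + intros n. destruct (Rle_dec _ _); [apply rpow_nonneg | lra].
    - rewrite rsum_swap.
      apply Rle_trans with (rsum (fun n => C2 * rpow (approx_num A n) q) NN).
      + apply rsum_le. intros n _. apply L2; [exact HB | now apply approx_num_spec].
      + rewrite rsum_scal. apply Rmult_le_compat_l; [exact HC2|].
        apply rsum_le_Series; [intros; apply rpow_nonneg | exact Hs]. }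
  apply ex_series_iff_rsum_bounded; [intros; apply rpow_nonneg|].
  set (c4 := rpow 4 (q - 1)). assert (Hc4 : 0 < c4) by (apply rpow_gt_0; lra).
  exists (c4 * (12 * (C1 * (C2 * Sa)))). intros m.
  (* Bracketing [t j / 2] rather than [t j] places [t j] above the threshold [2 * lev B k] of
     [Hlevel]. The upper end [4 * lev B k] is the origin of [c4]. *)
  destruct (finite_choice_bound
    (fun j k => 0 < t j -> 2 * lev B k < t j <= 4 * lev B k) m) as [KK HKK].
  { intros j _. destruct (Rlt_le_dec 0 (t j)) as [H|H].
    - destruct (lev_bracket B (t j / 2) HB) as [k Hk]; [specialize (HtB j); lra|].
      exists k. intros _. lra.
    - exists 0%nat. intros; lra. }
  apply Rle_trans with (c4 * rsum (fun K => rpow (lev B K) (q - 1) *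
    rsum (fun j => if Rlt_dec (2 * lev B K) (t j) then t j else 0) m) KK).
  - erewrite (rsum_ext (fun K => rpow (lev B K) (q - 1) * _));
      [|intros K _; rewrite <- rsum_scal; reflexivity].
    rewrite rsum_swap, <- rsum_scal. apply rsum_le. intros j Hj. fold (t j).
    destruct (Rlt_le_dec 0 (t j)) as [H|H].
    + destruct (HKK j Hj) as [k [Hk Hb]]. specialize (Hb H).
      rewrite rpow_minus_1 by lra.
      apply Rle_trans with (c4 * (rpow (lev B k) (q - 1) * t j)).
      * assert (Z : rpow (t j) (q - 1) <= rpow (4 * lev B k) (q - 1))
          by (apply rpow_mono; lra).
        rewrite rpow_mult_distr in Z by lra. fold c4 in Z. nra.
      * apply Rmult_le_compat_l; [lra|].
        eapply Rle_trans; [|apply (rsum_term _ KK k); [|exact Hk]].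
        -- cbv beta. destruct (Rlt_dec (2 * lev B k) (t j)); lra.
        -- intros K. apply Rmult_le_pos; [apply rpow_nonneg|].
           destruct (Rlt_dec _ _); lra.
    + rewrite rpow_le_0 by exact H. apply Rmult_le_pos; [lra|].
      apply rsum_nonneg. intros K _. apply Rmult_le_pos; [apply rpow_nonneg|].
      destruct (Rlt_dec _ _); [apply Ht0 | lra].
  - apply Rmult_le_compat_l; [lra|].
    (* The range [k <= K] is encoded as [lev B K <= lev B k], so that after the exchange the inner
       sum over [K] is a sum of levels below [lev B k]. *)
    apply Rle_trans with (rsum (fun K => 12 * rsum (fun k =>
      D k * (if Rle_dec (lev B K) (lev B k) then rpow (lev B K) (q - 1) else 0)) KK) KK).
    + apply rsum_le. intros K HK.
      apply Rle_trans with (rpow (lev B K) (q - 1) * (12 * rsum D (S K))).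
      * apply Rmult_le_compat_l; [apply rpow_nonneg | apply Hlevel].
      * replace (rpow (lev B K) (q - 1) * (12 * rsum D (S K)))
          with (12 * rsum (fun k => rpow (lev B K) (q - 1) * D k) (S K))
          by (rewrite rsum_scal; ring).
        apply Rmult_le_compat_l; [lra|].
        eapply Rle_trans; [|apply (rsum_mono _ (S K) KK); [lia|]].
        -- apply rsum_le. intros k Hk. destruct (Rle_dec (lev B K) (lev B k)) as [|N]; [lra|].
           exfalso. apply N, lev_antitone; [exact HB | lia].
        -- intros k. apply Rmult_le_pos; [apply HD0|].
           destruct (Rle_dec _ _); [apply rpow_nonneg | lra].
    + rewrite rsum_scal. apply Rmult_le_compat_l; [lra|]. rewrite rsum_swap.
      apply Rle_trans with (C1 * rsum (fun k => rpow (lev B k) (q - 1) * D k) KK).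
      * rewrite <- rsum_scal. apply rsum_le. intros k _. rewrite rsum_scal.
        assert (Z := L1 B KK (lev B k) HB (Rlt_le _ _ (lev_pos B k HB))).
        specialize (HD0 k). nra.
      * apply Rmult_le_compat_l; [exact HC1 | apply HDsum].
Qed.

(** * Operators given by matrices *)

Definition clim (u : nat -> C) (z : C) : Prop :=
  is_lim_seq (fun n => fst (u n)) (fst z) /\ is_lim_seq (fun n => snd (u n)) (snd z).

Lemma clim_unique u z w : clim u z -> clim u w -> z = w.
Proof.
  intros [H1 H2] [K1 K2]. apply injective_projections.
  - apply is_lim_seq_unique in H1. apply is_lim_seq_unique in K1. congruence.
  - apply is_lim_seq_unique in H2. apply is_lim_seq_unique in K2. congruence.
Qed.

Lemma clim_ext u v z : (forall n, u n = v n) -> clim u z -> clim v z.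
Proof.
  intros E [H1 H2]. split; eapply is_lim_seq_ext; try eassumption;
    intros n; simpl; now rewrite E.
Qed.

Lemma clim_plus u v z w : clim u z -> clim v w -> clim (fun n => u n + v n)%C (z + w)%C.
Proof. intros [H1 H2] [K1 K2]. split; simpl; now apply is_lim_seq_plus'. Qed.

Lemma clim_scal a u z : clim u z -> clim (fun n => a * u n)%C (a * z)%C.
Proof.
  intros [H1 H2]. split; simpl.
  - apply (is_lim_seq_minus' (fun n => fst a * fst (u n)) (fun n => snd a * snd (u n)));
      now apply (is_lim_seq_scal_l _ _ (Finite _)).
  - apply (is_lim_seq_plus' (fun n => fst a * snd (u n)) (fun n => snd a * fst (u n)));
      now apply (is_lim_seq_scal_l _ _ (Finite _)).
Qed.

Lemma clim_eventually_const u N z : (forall n, (N <= n)%nat -> u n = z) -> clim u z.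
Proof.
  intros H. split.
  - apply is_lim_seq_ext_loc with (u := fun _ => fst z); [|apply is_lim_seq_const].
    exists N. intros n Hn. now rewrite (H n Hn).
  - apply is_lim_seq_ext_loc with (u := fun _ => snd z); [|apply is_lim_seq_const].
    exists N. intros n Hn. now rewrite (H n Hn).
Qed.

Lemma clim_Cmod_sq u z : clim u z -> is_lim_seq (fun n => Cmod (u n) ^ 2) (Cmod z ^ 2).
Proof.
  intros [H1 H2]. rewrite Cmod_sq.
  apply is_lim_seq_ext with (fun n => fst (u n) ^ 2 + snd (u n) ^ 2);
    [intros; now rewrite Cmod_sq|].
  apply is_lim_seq_plus'; simpl; apply (is_lim_seq_mult' _ _ _ (_ * 1)); try assumption;
    apply is_lim_seq_mult'; try assumption; apply is_lim_seq_const.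
Qed.

Lemma clim_sqn (u : nat -> vec) (y : vec) m :
  (forall i, clim (fun n => u n i) (y i)) -> is_lim_seq (fun n => sqn (u n) m) (sqn y m).
Proof.
  intros H. unfold sqn. induction m as [|m IH]; simpl.
  - apply is_lim_seq_const.
  - apply is_lim_seq_plus'; [exact IH|]. apply (clim_Cmod_sq _ _ (H m)).
Qed.

(* Finite-section bound: every finite corner of [M] has squared operator norm at most [K]. *)
Definition fsb (M : nat -> nat -> C) (K : R) : Prop := forall m J (x : vec),
  sqn (fun i => csum (fun j => M i j * x j)%C J) m <= K * sqn x J.

Lemma fsb_nonneg M K : fsb M K -> 0 <= K.
Proof.
  intros H. specialize (H 0%nat 1%nat (basis 0)). rewrite sqn_basis in H.
  unfold sqn in H. simpl in H. lra.
Qed.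

(** Testing the section on the conjugate of row [i] gives [s ^ 2 <= K * s] for [s = sqn (M i) J]. *)
Lemma fsb_row M K i J : fsb M K -> sqn (M i) J <= K.
Proof.
  intros H. assert (HK := fsb_nonneg M K H). specialize (H (S i) J (fun j => Cconj (M i j))).
  assert (E : sqn (fun j => Cconj (M i j)) J = sqn (M i) J).
  { apply rsum_ext. intros; now rewrite Cmod_Cconj. }
  rewrite E in H.
  assert (L := rsum_term (fun i0 => Cmod (csum (fun j => M i0 j * Cconj (M i j))%C J) ^ 2)
    (S i) i (fun _ => pow2_ge_0 _) (Nat.lt_succ_diag_r i)).
  cbv beta in L. change (csum (fun j => M i j * Cconj (M i j))%C J) with (ip J (M i) (M i)) in L.
  rewrite ip_self, Cmod_R, pow2_abs in L.
  assert (P := sqn_nonneg (M i) J).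
  unfold sqn at 1 in H. set (s := sqn (M i) J) in *.
  destruct (Rle_lt_dec s K) as [Q|Q]; [exact Q|].
  assert (s ^ 2 <= K * s) by exact (Rle_trans _ _ _ L H). clearbody s. nra.
Qed.

(** Real and imaginary parts are summed separately. Under [fsb] every row is square summable, so for
    [x] in l2 both series converge absolutely and no default value of [Series] appears. *)
Definition mop (M : nat -> nat -> C) (x : vec) : vec := fun i =>
  (Series (fun j => fst (M i j * x j)%C), Series (fun j => snd (M i j * x j)%C)).

Lemma is_lim_seq_rsum f : ex_series f -> is_lim_seq (rsum f) (Series f).
Proof.
  intros H. apply Series_correct in H. apply is_lim_seq_incr_1.
  eapply is_lim_seq_ext; [|exact H]. intros n. apply rsum_sum_n.
Qed.

Lemma row_product_clim (a x : vec) : sq_summable a -> sq_summable x ->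
  clim (csum (fun j => a j * x j)%C)
    (Series (fun j => fst (a j * x j)%C), Series (fun j => snd (a j * x j)%C)).
Proof.
  intros Ha Hx.
  assert (Hs : ex_series (fun j => Cmod (a j) ^ 2 + Cmod (x j) ^ 2))
    by now apply (ex_series_plus (fun j => Cmod (a j) ^ 2) (fun j => Cmod (x j) ^ 2)).
  assert (Hb : forall j, Cmod (a j * x j) <= Cmod (a j) ^ 2 + Cmod (x j) ^ 2).
  { intros j. rewrite Cmod_mult. assert (0 <= (Cmod (a j) - Cmod (x j)) ^ 2) by apply pow2_ge_0.
    assert (0 <= Cmod (a j)) by apply Cmod_ge_0. assert (0 <= Cmod (x j)) by apply Cmod_ge_0.
    nra. }
  assert (Hf : forall z : C, Rabs (fst z) <= Cmod z).
  { intros z. eapply Rle_trans; [apply Rmax_l | apply Rmax_Cmod]. }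
  assert (Hsd : forall z : C, Rabs (snd z) <= Cmod z).
  { intros z. eapply Rle_trans; [apply Rmax_r | apply Rmax_Cmod]. }
  split; cbn [fst snd].
  - eapply is_lim_seq_ext; [intros n; symmetry; apply csum_fst|].
    apply is_lim_seq_rsum. apply (ex_series_le (V := R_CompleteNormedModule)) with (2 := Hs).
    intros n. eapply Rle_trans; [|apply Hb]. apply Hf.
  - eapply is_lim_seq_ext; [intros n; symmetry; apply csum_snd|].
    apply is_lim_seq_rsum. apply (ex_series_le (V := R_CompleteNormedModule)) with (2 := Hs).
    intros n. eapply Rle_trans; [|apply Hb]. apply Hsd.
Qed.

Lemma mop_clim M K x i : fsb M K -> sq_summable x ->
  clim (csum (fun j => M i j * x j)%C) (mop M x i).
Proof.
  intros HM Hx. apply row_product_clim; [|exact Hx].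
  apply sq_summable_iff. exists K. intros J. now apply fsb_row.
Qed.

(** The sections converge coordinate by coordinate, and a bound on finitely many coordinates that is
    uniform in [J] passes to the limit. *)
Lemma mop_sqn M K x m : fsb M K -> sq_summable x ->
  sqn (mop M x) m <= K * l2norm x ^ 2.
Proof.
  intros HM Hx. assert (HK := fsb_nonneg M K HM).
  refine (is_lim_seq_le _ (fun _ => K * l2norm x ^ 2) (sqn (mop M x) m) _ _
    (clim_sqn (fun J i => csum (fun j => M i j * x j)%C J) (mop M x) m
       (fun i => mop_clim M K x i HM Hx)) (is_lim_seq_const _)).
  intros J. eapply Rle_trans; [apply HM|].
  apply Rmult_le_compat_l; [exact HK | now apply sqn_le_l2norm].
Qed.

Lemma mop_l2norm M K x : fsb M K -> sq_summable x ->
  sq_summable (mop M x) /\ l2norm (mop M x) <= sqrt K * l2norm x.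
Proof.
  intros HM Hx. assert (HK := fsb_nonneg M K HM). assert (H := fun m => mop_sqn M K x m HM Hx). split.
  - apply sq_summable_iff. eexists; exact H.
  - apply l2norm_le; [apply Rmult_le_pos; [apply sqrt_pos | apply l2norm_nonneg]|].
    intros n. rewrite Rpow_mult_distr, pow2_sqrt by exact HK. apply H.
Qed.

Lemma sq_summable_basis j : sq_summable (basis j).
Proof.
  apply sq_summable_iff. exists 1. intros n. rewrite sqn_basis.
  destruct (Nat.ltb j n); lra.
Qed.

Lemma mop_finite_columns M K J0 x i : fsb M K -> sq_summable x ->
  (forall j, (J0 <= j)%nat -> (M i j * x j)%C = RtoC 0) ->
  mop M x i = csum (fun j => M i j * x j)%C J0.
Proof.
  intros HM Hx H0. eapply clim_unique; [now apply (mop_clim M K)|].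
  apply clim_eventually_const with J0. intros n Hn. now apply csum_tail_zero.
Qed.

Lemma mop_bounded M K : fsb M K -> bounded_op (mop M).
Proof.
  intros HM. split; [|split; [|split]].
  - intros x Hx. now apply (mop_l2norm M K).
  - intros x y Hx Hy i.
    eapply clim_unique; [apply (mop_clim M K); [exact HM | now apply sq_summable_vadd]|].
    eapply clim_ext; [|apply clim_plus; apply (mop_clim M K); [exact HM|eassumption|exact HM|eassumption]].
    intros J. simpl. rewrite <- csum_plus. apply csum_ext. intros; unfold vadd; ring.
  - intros a x Hx i.
    eapply clim_unique; [apply (mop_clim M K); [exact HM | now apply sq_summable_vscal]|].
    eapply clim_ext; [|apply clim_scal; apply (mop_clim M K); [exact HM|eassumption]].
    intros J. simpl. rewrite <- csum_scal. apply csum_ext. intros; unfold vscal; ring.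
  - exists (sqrt K). intros x Hx. now apply mop_l2norm.
Qed.

Lemma mop_has_matrix M K : fsb M K -> has_matrix (mop M) M.
Proof.
  intros HM i j. rewrite (mop_finite_columns M K (S j)); [|exact HM | apply sq_summable_basis|].
  - rewrite (csum_ext _ (fun k => basis j k * M i k)%C) by (intros; ring).
    rewrite csum_basis. destruct (Nat.ltb_spec j (S j)); [reflexivity | lia].
  - intros k Hk. rewrite basis_eq. destruct (Nat.eqb_spec k j); [lia | ring].
Qed.

Lemma mop_minus M M' K K' KD x : fsb M K -> fsb M' K' ->
  fsb (fun i j => M i j - M' i j)%C KD -> sq_summable x ->
  vsub (mop M x) (mop M' x) = mop (fun i j => M i j - M' i j)%C x.
Proof.
  intros H H' HD Hx. apply functional_extensionality. intros i. symmetry.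
  eapply clim_unique; [eapply mop_clim; eassumption|].
  unfold vsub, Cminus at 2.
  replace (- mop M' x i)%C with (- RtoC 1 * mop M' x i)%C by ring.
  eapply clim_ext; [|apply clim_plus; [|apply clim_scal]; eapply mop_clim; eassumption].
  intros J. simpl. rewrite <- csum_scal, <- csum_plus. apply csum_ext. intros; ring.
Qed.

Lemma fsb_ext M M' K : (forall i j, M i j = M' i j) -> fsb M K -> fsb M' K.
Proof.
  intros E. replace M' with M; [auto|].
  apply functional_extensionality; intros; apply functional_extensionality; auto.
Qed.

Lemma fsb_plus M M' K K' : fsb M K -> fsb M' K' ->
  fsb (fun i j => M i j + M' i j)%C (2 * K + 2 * K').
Proof.
  intros H H' m J x.
  assert (E : (fun i => csum (fun j => (M i j + M' i j) * x j)%C J) =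
    vadd (fun i => csum (fun j => M i j * x j)%C J) (fun i => csum (fun j => M' i j * x j)%C J)).
  { apply functional_extensionality. intros i. unfold vadd. rewrite <- csum_plus.
    apply csum_ext. intros; ring. }
  rewrite E. eapply Rle_trans; [apply sqn_vadd|].
  specialize (H m J x). specialize (H' m J x). lra.
Qed.

Lemma fsb_minus M M' K K' : fsb M K -> fsb M' K' ->
  fsb (fun i j => M i j - M' i j)%C (2 * K + 2 * K').
Proof.
  intros H H' m J x.
  assert (E : (fun i => csum (fun j => (M i j - M' i j) * x j)%C J) =
    vsub (fun i => csum (fun j => M i j * x j)%C J) (fun i => csum (fun j => M' i j * x j)%C J)).
  { apply functional_extensionality. intros i. unfold vsub. rewrite <- csum_minus.
    apply csum_ext. intros; ring. }
  rewrite E. eapply Rle_trans; [apply sqn_vsub|].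
  specialize (H m J x). specialize (H' m J x). lra.
Qed.

(* Schur's test, with Cauchy-Schwarz applied only along the support of each row. *)
Lemma fsb_schur (M : nat -> nat -> C) (rel : nat -> nat -> bool) (u v : nat -> R) (K : R) :
  (forall i j, rel i j = false -> M i j = RtoC 0) ->
  (forall j, 0 < u j) ->
  (forall i J, rsum (fun j => Cmod (M i j) ^ 2 * u j) J <= v i) ->
  (forall j m, rsum (fun i => if rel i j then v i else 0) m <= K * u j) ->
  fsb M K.
Proof.
  intros H0 Hu Hrow Hcol m J x.
  assert (Hb : forall i j, 0 <= if rel i j then Cmod (x j) ^ 2 / u j else 0).
  { intros i j. destruct (rel i j); [|lra].
    apply Rmult_le_pos; [apply pow2_ge_0 | apply Rlt_le, Rinv_0_lt_compat, Hu]. }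
  apply Rle_trans with (rsum (fun i => rsum (fun j =>
    Cmod (x j) ^ 2 / u j * (if rel i j then v i else 0)) J) m).
  - apply rsum_le. intros i _.
    apply Rle_trans with (rsum (fun j => Cmod (M i j) ^ 2 * u j) J *
      rsum (fun j => if rel i j then Cmod (x j) ^ 2 / u j else 0) J).
    + apply csum_CS_weighted.
      * intros j. apply Rmult_le_pos; [apply pow2_ge_0 | apply Rlt_le, Hu].
      * apply Hb.
      * intros j. rewrite Cmod_mult, Rpow_mult_distr. destruct (rel i j) eqn:E.
        -- apply Req_le. field. specialize (Hu j). lra.
        -- rewrite (H0 i j E), Cmod_0. lra.
    + eapply Rle_trans.
      * apply Rmult_le_compat_r; [apply rsum_nonneg; intros; apply Hb | apply Hrow].
      * rewrite <- rsum_scal. apply rsum_le. intros j _. destruct (rel i j); lra.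
  - rewrite rsum_swap. unfold sqn. rewrite <- rsum_scal. apply rsum_le. intros j _.
    rewrite rsum_scal.
    assert (P : 0 <= Cmod (x j) ^ 2 / u j)
      by (apply Rmult_le_pos; [apply pow2_ge_0 | apply Rlt_le, Rinv_0_lt_compat, Hu]).
    apply Rle_trans with (Cmod (x j) ^ 2 / u j * (K * u j)).
    + apply Rmult_le_compat_l; [exact P | apply Hcol].
    + apply Req_le. field. specialize (Hu j). lra.
Qed.

(** Only the left factors have to lie in l2. The right factors are paired with [x] over finitely
    many columns, see [mop_rank]. *)
Definition mrank (M : nat -> nat -> C) (n : nat) : Prop :=
  exists (V : nat -> vec) (w : nat -> nat -> C), (forall r, sq_summable (V r)) /\
    forall i j, M i j = csum (fun r => V r i * w r j)%C n.

Lemma mrank_ext M M' n : (forall i j, M i j = M' i j) -> mrank M n -> mrank M' n.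
Proof.
  intros E [V [w [HV H]]]. exists V, w. split; [exact HV|]. intros; now rewrite <- E.
Qed.

Lemma mrank_plus M M' n n' : mrank M n -> mrank M' n' ->
  mrank (fun i j => M i j + M' i j)%C (n + n').
Proof.
  intros [V [w [HV H]]] [V' [w' [HV' H']]].
  exists (fun r => if Nat.ltb r n then V r else V' (r - n)%nat).
  exists (fun r => if Nat.ltb r n then w r else w' (r - n)%nat). split.
  - intros r. destruct (Nat.ltb r n); auto.
  - intros i j. rewrite (H i j), (H' i j), csum_split. f_equal.
    + apply csum_ext. intros r Hr. apply Nat.ltb_lt in Hr. now rewrite Hr.
    + apply csum_ext. intros r Hr. destruct (Nat.ltb_spec (n + r) n); [lia|].
      now replace (n + r - n)%nat with r by lia.
Qed.

Lemma mop_rank M K J0 n : fsb M K -> (forall i j, (J0 <= j)%nat -> M i j = RtoC 0) ->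
  mrank M n -> rank_le (mop M) n.
Proof.
  intros HM H0 [V [w [HV HR]]]. exists V. split; [exact HV|]. intros x Hx.
  exists (fun r => csum (fun j => w r j * x j)%C J0). intros i.
  rewrite (mop_finite_columns M K J0) by (try assumption; intros j Hj; rewrite H0 by exact Hj; ring).
  rewrite (csum_ext _ (fun j => csum (fun r => V r i * (w r j * x j))%C n)).
  - rewrite csum_swap. apply csum_ext. intros r _. rewrite csum_scal. ring.
  - intros j _. rewrite HR, Cmult_comm, <- csum_scal. apply csum_ext. intros; ring.
Qed.

(** * Dyadic blocks and the Hardy inequality *)

(** [dd c 0] is [0] because [Nat.pred 0] is [0]; column [0] has no entry above the diagonal. *)
Definition dd (c : nat -> C) (j : nat) : C := (c j - c (Nat.pred j))%C.

(* Columns [2^n < j <= 2^(n+1)] form block [n]; block [0] also absorbs columns [0] and [1]. *)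
Definition blk (j : nat) : nat := Nat.log2 (Nat.pred j).

Definition blk_energy (c : nat -> C) (n : nat) : R :=
  rsum (fun j => if Nat.eqb (blk j) n then Cmod (dd c j) ^ 2 else 0) (2 ^ S n + 1).

(** This is [beta_n ^ 2]. It equals [dyad c n] for [n >= 1], whereas [bb c 0] also counts the
    difference [c 1 - c 0], which occurs in no dyadic sum. *)
Definition bb (c : nat -> C) (n : nat) : R := 2 ^ n * blk_energy c n.

Lemma Tc_eq c i j : Tc c i j =
  ((if Nat.eqb i j then c i else RtoC 0) + (if Nat.ltb i j then dd c j else RtoC 0))%C.
Proof.
  unfold Tc, dd. destruct (Nat.ltb_spec j i), (Nat.eqb_spec j i), (Nat.eqb_spec i j),
    (Nat.ltb_spec i j); try lia; ring.
Qed.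

Lemma blk_mono i j : (i <= j)%nat -> (blk i <= blk j)%nat.
Proof. intros H. apply Nat.log2_le_mono. lia. Qed.

Lemma blk_lt_pow j : (j < 2 ^ S (blk j) + 1)%nat.
Proof.
  unfold blk. destruct (Nat.eq_dec (Nat.pred j) 0) as [E|E].
  - assert (0 < 2 ^ S (Nat.log2 (Nat.pred j)))%nat by (apply Nat.neq_0_lt_0, Nat.pow_nonzero; lia).
    lia.
  - assert (H := Nat.log2_spec (Nat.pred j) ltac:(lia)). lia.
Qed.

Lemma blk_sum_le (f : nat -> R) n J : (forall j, 0 <= f j) ->
  rsum (fun j => if Nat.eqb (blk j) n then f j else 0) J <=
  rsum (fun j => if Nat.eqb (blk j) n then f j else 0) (2 ^ S n + 1).
Proof.
  intros Hf. destruct (Nat.le_gt_cases J (2 ^ S n + 1)) as [H|H].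
  - apply rsum_mono; [exact H|]. intros j. destruct (Nat.eqb (blk j) n); [apply Hf | lra].
  - apply Req_le, rsum_tail_zero; [lia|]. intros j Hj.
    destruct (Nat.eqb_spec (blk j) n) as [E|]; [|reflexivity].
    assert (L := blk_lt_pow j). rewrite E in L. lia.
Qed.

Lemma blk_card n J : rsum (fun j => if Nat.eqb (blk j) n then 1 else 0) J <= 3 * 2 ^ n.
Proof.
  eapply Rle_trans; [apply (blk_sum_le (fun _ => 1)); intros; lra|].
  apply Rle_trans with (rsum (fun _ => 1) (2 ^ S n + 1)).
  - apply rsum_le. intros j _. destruct (Nat.eqb _ _); lra.
  - rewrite rsum_const, plus_INR, INR_pow2. simpl.
    assert (1 <= 2 ^ n) by (apply pow_R1_Rle; lra). lra.
Qed.

Lemma blk_energy_partial c n J :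
  rsum (fun j => if Nat.eqb (blk j) n then Cmod (dd c j) ^ 2 else 0) J <= blk_energy c n.
Proof. apply (blk_sum_le (fun j => Cmod (dd c j) ^ 2)). intros; apply pow2_ge_0. Qed.

Lemma blk_energy_nonneg c n : 0 <= blk_energy c n.
Proof.
  apply rsum_nonneg. intros j _. destruct (Nat.eqb _ _); [apply pow2_ge_0 | lra].
Qed.

Lemma bb_nonneg c n : 0 <= bb c n.
Proof. apply Rmult_le_pos; [apply pow_le; lra | apply blk_energy_nonneg]. Qed.

Lemma geom_tail (rho : R) (n0 N : nat) : 0 < rho < 1 ->
  rsum (fun n => if Nat.leb n0 n then rho ^ n else 0) N <= rho ^ n0 / (1 - rho).
Proof.
  intros H.
  assert (P : forall n, 0 < rho ^ n) by (intros; apply pow_lt; lra).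
  assert (Q : 0 < / (1 - rho)) by (apply Rinv_0_lt_compat; lra).
  assert (S1 : rsum (fun n => if Nat.leb n0 n then rho ^ n else 0) N
    <= (rho ^ n0 - rho ^ (max n0 N)) / (1 - rho)).
  { induction N as [|N IH]; cbn [rsum].
    - rewrite Nat.max_0_r. unfold Rdiv. rewrite Rminus_diag. lra.
    - destruct (Nat.leb_spec n0 N) as [L|L].
      + rewrite Nat.max_r in IH |- * by lia. simpl.
        apply Rle_trans with ((rho ^ n0 - rho ^ N) / (1 - rho) + rho ^ N); [lra|].
        apply Req_le. field. lra.
      + rewrite Nat.max_l in IH |- * by lia. lra. }
  eapply Rle_trans; [exact S1|]. unfold Rdiv. apply Rmult_le_compat_r; [lra|].
  specialize (P (max n0 N)). lra.
Qed.

Lemma geom_three_halves N : rsum (fun n => (3 / 2) ^ n) N <= 2 * (3 / 2) ^ N.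
Proof. induction N as [|N IH]; cbn [rsum]; [simpl; lra|]. simpl. lra. Qed.

(* Hardy's inequality: Schur's test with the weights [(3/2)^blk] and [(3/4)^blk]; any ratio
   strictly between [1] and [2] in place of [3/2] would do. *)
Lemma fsb_hardy c (bad : nat -> bool) (eps : R) :
  (forall n, bad n = true -> bb c n <= eps ^ 2) ->
  fsb (fun i j => if andb (Nat.ltb i j) (bad (blk j)) then dd c j else RtoC 0) (36 * eps ^ 2).
Proof.
  intros Hbad.
  assert (He : 0 <= eps ^ 2) by apply pow2_ge_0.
  apply (fsb_schur _ (fun i j => Nat.ltb i j) (fun j => (3 / 2) ^ blk j)
    (fun i => 4 * eps ^ 2 * (3 / 4) ^ blk i)).
  - intros i j H. now rewrite H.
  - intros j. apply pow_lt. lra.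
  - intros i J.
    rewrite (rsum_fibers blk _ J (S (blk J))).
    2:{ intros j Hj. assert (L := blk_mono j J ltac:(lia)). lia. }
    (* In a bad block the weighted energy is [(3/2) ^ n * blk_energy c n], that is
       [(3/4) ^ n * bb c n]. The columns right of row [i] start in block [blk i], and the tail from
       there sums to [4 * (3/4) ^ blk i]. *)
    apply Rle_trans with
      (rsum (fun n => eps ^ 2 * (if Nat.leb (blk i) n then (3 / 4) ^ n else 0)) (S (blk J))).
    + apply rsum_le. intros n _.
      destruct (Nat.leb_spec (blk i) n) as [L|L].
      * destruct (bad n) eqn:Eb.
        -- apply Rle_trans with (rsum (fun j => (3 / 2) ^ n *
            (if Nat.eqb (blk j) n then Cmod (dd c j) ^ 2 else 0)) J).
           ++ apply rsum_le. intros j _. destruct (Nat.eqb_spec (blk j) n) as [E|]; [|lra].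
              rewrite E, Eb. assert (P : 0 < (3 / 2) ^ n) by (apply pow_lt; lra).
              destruct (Nat.ltb i j); simpl andb; cbv iota; [lra|].
              rewrite Cmod_0. assert (Z := pow2_ge_0 (Cmod (dd c j))). nra.
           ++ rewrite rsum_scal.
              assert (Z := blk_energy_partial c n J). assert (Y := Hbad n Eb). unfold bb in Y.
              assert (P : 0 < (3 / 4) ^ n) by (apply pow_lt; lra).
              assert (E : (3 / 2) ^ n = (3 / 4) ^ n * 2 ^ n).
              { rewrite <- Rpow_mult_distr. f_equal. lra. }
              rewrite E.
              apply Rle_trans with ((3 / 4) ^ n * 2 ^ n * blk_energy c n).
              ** apply Rmult_le_compat_l; [|exact Z].
                 apply Rmult_le_pos; [lra | apply pow_le; lra].
              ** rewrite Rmult_assoc. nra.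
        -- rewrite rsum_zero.
           ++ apply Rmult_le_pos; [exact He | apply pow_le; lra].
           ++ intros j _. destruct (Nat.eqb_spec (blk j) n) as [E|]; [|reflexivity].
              rewrite E, Eb, Bool.andb_false_r, Cmod_0. ring.
      * rewrite rsum_zero; [lra|]. intros j _.
        destruct (Nat.eqb_spec (blk j) n) as [E|]; [|reflexivity].
        destruct (Nat.ltb_spec i j) as [Q|Q]; simpl andb; cbv iota.
        -- assert (R := blk_mono i j ltac:(lia)). lia.
        -- rewrite Cmod_0. ring.
    + rewrite rsum_scal. assert (G := geom_tail (3 / 4) (blk i) (S (blk J)) ltac:(lra)).
      replace (4 * eps ^ 2 * (3 / 4) ^ blk i)
        with (eps ^ 2 * ((3 / 4) ^ blk i / (1 - 3 / 4))) by field.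
      now apply Rmult_le_compat_l.
  - intros j m.
    apply Rle_trans with (4 * eps ^ 2 * rsum (fun i => (3 / 4) ^ blk i) j).
    + rewrite <- rsum_scal.
      assert (P : forall i, 0 <= 4 * eps ^ 2 * (3 / 4) ^ blk i)
        by (intros; apply Rmult_le_pos; [lra | apply pow_le; lra]).
      apply Rle_trans with
        (rsum (fun i => if Nat.ltb i j then 4 * eps ^ 2 * (3 / 4) ^ blk i else 0) (max m j)).
      * apply rsum_mono; [lia|]. intros i. destruct (Nat.ltb i j); [apply P | lra].
      * rewrite (rsum_tail_zero _ j (max m j)); [|lia|].
        -- apply rsum_le. intros i Hi. apply Nat.ltb_lt in Hi. rewrite Hi. lra.
        -- intros i Hi. apply Nat.ltb_ge in Hi. now rewrite Hi.
    (* Block [n] has at most [3 * 2 ^ n] rows of weight [(3/4) ^ n]. Summing [3 * (3/2) ^ n] up to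
       [blk j] gives at most [3 * 2 * (3/2) * (3/2) ^ blk j], hence the factor [9]. *)
    + replace (36 * eps ^ 2 * (3 / 2) ^ blk j) with (4 * eps ^ 2 * (9 * (3 / 2) ^ blk j)) by ring.
      apply Rmult_le_compat_l; [lra|].
      rewrite (rsum_fibers blk _ j (S (blk j))).
      2:{ intros i Hi. assert (L := blk_mono i j ltac:(lia)). lia. }
      apply Rle_trans with (rsum (fun n => 3 * (3 / 2) ^ n) (S (blk j))).
      * apply rsum_le. intros n _.
        apply Rle_trans with (rsum (fun i => (3 / 4) ^ n * (if Nat.eqb (blk i) n then 1 else 0)) j).
        -- apply rsum_le. intros i _. destruct (Nat.eqb_spec (blk i) n) as [E|]; [|lra].
           rewrite E. lra.
        -- rewrite rsum_scal. assert (Z := blk_card n j).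
           assert (P : 0 < (3 / 4) ^ n) by (apply pow_lt; lra).
           assert (E : (3 / 2) ^ n = (3 / 4) ^ n * 2 ^ n).
           { rewrite <- Rpow_mult_distr. f_equal. lra. }
           rewrite E. nra.
      * rewrite rsum_scal. assert (Z := geom_three_halves (S (blk j))).
        rewrite <- tech_pow_Rmult in Z.
        change (rsum (fun n => (3 / 2) ^ n)) with (rsum (pow (3 / 2))) in Z. lra.
Qed.

Lemma fsb_diag (a : nat -> C) (K : R) : (forall i, Cmod (a i) ^ 2 <= K) ->
  fsb (fun i j => if Nat.eqb i j then a i else RtoC 0) K.
Proof.
  intros Ha. assert (HK : 0 <= K) by (eapply Rle_trans; [apply pow2_ge_0 | apply (Ha 0%nat)]).
  apply (fsb_schur _ Nat.eqb (fun _ => 1) (fun _ => K)).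
  - intros i j H. now rewrite H.
  - intros; lra.
  - intros i J. rewrite (rsum_ext _ (fun j => if Nat.eqb i j then Cmod (a i) ^ 2 else 0)).
    + rewrite rsum_delta. destruct (Nat.ltb i J); [apply Ha | exact HK].
    + intros j _. destruct (Nat.eqb i j); [ring | rewrite Cmod_0; ring].
  - intros j m. rewrite (rsum_ext _ (fun i => if Nat.eqb j i then K else 0))
      by (intros i _; now rewrite Nat.eqb_sym).
    rewrite rsum_delta. destruct (Nat.ltb j m); lra.
Qed.

(** All indices satisfying [P] lie between the smallest of them, [i0], and [j]; the hypothesis at
    [i0] bounds this window by [W]. *)
Lemma count_window (P : nat -> bool) (j m : nat) (W : R) : 0 <= W ->
  (forall i, P i = true -> (i < j)%nat /\ INR (j - i) <= W) ->
  rsum (fun i => if P i then 1 else 0) m <= W.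
Proof.
  intros HW HP.
  assert (S1 : rsum (fun i => if P i then 1 else 0) m = 0 \/
    exists i0, (i0 < m)%nat /\ P i0 = true /\ rsum (fun i => if P i then 1 else 0) m <= INR (min m j - i0)).
  { induction m as [|m [IH|[i0 [Hm [H0 IH]]]]]; cbn [rsum]; [now left| |].
    - destruct (P m) eqn:E.
      + right. exists m. split; [lia|]. split; [exact E|]. rewrite IH. destruct (HP m E) as [L _].
        replace (min (S m) j - m)%nat with 1%nat by lia. simpl. lra.
      + left. lra.
    - right. exists i0. split; [lia|]. split; [exact H0|]. destruct (HP i0 H0) as [L0 _].
      destruct (P m) eqn:E.
      + destruct (HP m E) as [L _].
        replace (min (S m) j - i0)%nat with (S (min m j - i0)) by lia.
        rewrite S_INR. lra.
      + rewrite Rplus_0_r. eapply Rle_trans; [exact IH|]. apply le_INR. lia. }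
  destruct S1 as [->|[i0 [_ [H0 S1]]]]; [exact HW|].
  eapply Rle_trans; [exact S1|]. destruct (HP i0 H0) as [_ B].
  eapply Rle_trans; [|exact B]. apply le_INR. lia.
Qed.

(** * Cutting the large blocks into intervals *)

(** Selects the large blocks, which are cut into intervals; all the others go to the Hardy
    estimate. *)
Definition good (c : nat -> C) (eps : R) (n : nat) : bool :=
  if Rlt_dec eps (sqrt (bb c n)) then true else false.

Lemma good_true c eps n : good c eps n = true -> eps < sqrt (bb c n).
Proof. unfold good. destruct (Rlt_dec _ _); [auto | discriminate]. Qed.

Lemma good_false c eps n : 0 <= eps -> good c eps n = false -> bb c n <= eps ^ 2.
Proof.
  intros He. unfold good. destruct (Rlt_dec eps (sqrt (bb c n))) as [|H]; [discriminate|].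
  intros _. rewrite <- (pow2_sqrt (bb c n)) by apply bb_nonneg.
  apply pow_incr. split; [apply sqrt_pos | lra].
Qed.

(* [H] cuts the good blocks into intervals [J] with [|J| * energy J <= eps^2]: it is the integer
   part of a cumulative weight to which column [l] of a good block [n] contributes
   [(beta_n / eps) * (2^-n + |d_l|^2 * 2^n / b_n)], and entering a good block contributes [1]. *)
Lemma interval_code c eps N0 : 0 < eps ->
  (forall n, (N0 <= n)%nat -> sqrt (bb c n) <= eps) ->
  exists (H : nat -> nat) (Nmax : nat),
    (forall i j, (i <= j)%nat -> (H i <= H j)%nat) /\
    (forall i j, (i < j)%nat -> good c eps (blk j) = true -> H i = H j ->
       blk i = blk j /\
       INR (j - i) <= 2 ^ blk j * eps / sqrt (bb c (blk j)) /\
       rsum (fun l => Cmod (dd c (S i + l)) ^ 2) (j - i) <= sqrt (bb c (blk j)) * eps / 2 ^ blk j) /\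
    (forall j, (H j <= Nmax)%nat) /\
    INR Nmax <= 5 * rsum (fun n => if Rlt_dec eps (sqrt (bb c n))
                                   then sqrt (bb c n) / eps else 0) N0.
Proof.
  intros He HN0.
  set (be := fun n => sqrt (bb c n)).
  assert (Hbe2 : forall n, be n * be n = bb c n) by (intros; apply sqrt_sqrt, bb_nonneg).
  set (phi := fun l => if good c eps (blk l)
    then be (blk l) / eps * (/ 2 ^ blk l + Cmod (dd c l) ^ 2 * (2 ^ blk l / bb c (blk l))) else 0).
  set (cnt := fun n => if good c eps n then 1 else 0).
  assert (P2 : forall n, 0 < 2 ^ n) by (intros; apply pow_lt; lra).
  assert (Pbe : forall n, good c eps n = true -> eps < be n) by apply good_true.
  assert (Pbb : forall n, good c eps n = true -> 0 < bb c n).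
  { intros n Hn. rewrite <- Hbe2. specialize (Pbe n Hn). apply Rmult_lt_0_compat; lra. }
  assert (Hphi0 : forall l, 0 <= phi l).
  { intros l. unfold phi. destruct (good c eps (blk l)) eqn:Eg; [|lra].
    specialize (Pbe _ Eg). specialize (Pbb _ Eg). specialize (P2 (blk l)).
    apply Rmult_le_pos; [apply Rlt_le, Rdiv_lt_0_compat; lra|].
    apply Rplus_le_le_0_compat; [apply Rlt_le, Rinv_0_lt_compat; lra|].
    apply Rmult_le_pos; [apply pow2_ge_0 | apply Rlt_le, Rdiv_lt_0_compat; lra]. }
  assert (Hcnt0 : forall n, 0 <= cnt n) by (intros n; unfold cnt; destruct (good c eps n); lra).
  set (Psi := fun j => rsum phi (S j) + rsum cnt (S (blk j))).
  assert (HPsi0 : forall j, 0 <= Psi j)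
    by (intros; apply Rplus_le_le_0_compat; apply rsum_nonneg; auto).
  assert (HPsim : forall i j, (i <= j)%nat -> Psi i <= Psi j).
  { intros i j L. apply Rplus_le_compat; apply rsum_mono; auto; [lia|].
    assert (Q := blk_mono i j L). lia. }
  set (H := fun j => proj1_sig (nfloor_ex (Psi j) (HPsi0 j))).
  assert (HH : forall j, INR (H j) <= Psi j < INR (H j) + 1).
  { intros j. unfold H. now destruct (nfloor_ex (Psi j) (HPsi0 j)). }
  (* Through [phi] a good block contributes at most [(3 + 1) * (be n / eps)]: the [3] from the
     number of columns, the [1] from the energy. Through [cnt] it adds [1 < be n / eps]. *)
  set (tot := 5 * rsum (fun n => if Rlt_dec eps (sqrt (bb c n))
                                   then sqrt (bb c n) / eps else 0) N0).
  assert (Hbad : forall n, (N0 <= n)%nat -> good c eps n = false).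
  { intros n Hn. unfold good. destruct (Rlt_dec _ _) as [L|]; [|reflexivity].
    specialize (HN0 n Hn). lra. }
  assert (Hsmall : forall n J, rsum (fun l => if Nat.eqb (blk l) n then phi l else 0) J
    <= if good c eps n then 4 * (be n / eps) else 0).
  { intros n J. destruct (good c eps n) eqn:Eg.
    - assert (Q1 := Pbe n Eg). assert (Q2 := Pbb n Eg). assert (Q3 := P2 n).
      assert (Q4 : 0 < be n / eps) by (apply Rdiv_lt_0_compat; lra).
      rewrite (rsum_ext _ (fun l => be n / eps * (/ 2 ^ n * (if Nat.eqb (blk l) n then 1 else 0)
        + 2 ^ n / bb c n * (if Nat.eqb (blk l) n then Cmod (dd c l) ^ 2 else 0)))).
      + rewrite rsum_scal, rsum_plus, !rsum_scal.
        assert (Z1 := blk_card n J). assert (Z2 := blk_energy_partial c n J).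
        assert (Y1 : / 2 ^ n * rsum (fun l => if Nat.eqb (blk l) n then 1 else 0) J <= 3).
        { apply Rle_trans with (/ 2 ^ n * (3 * 2 ^ n)).
          - apply Rmult_le_compat_l; [apply Rlt_le, Rinv_0_lt_compat; lra | exact Z1].
          - apply Req_le. field. lra. }
        assert (Y2 : 2 ^ n / bb c n *
          rsum (fun l => if Nat.eqb (blk l) n then Cmod (dd c l) ^ 2 else 0) J <= 1).
        { apply Rle_trans with (2 ^ n / bb c n * blk_energy c n).
          - apply Rmult_le_compat_l; [apply Rlt_le, Rdiv_lt_0_compat; lra | exact Z2].
          - apply Req_le. replace (2 ^ n / bb c n * blk_energy c n)
              with (2 ^ n * blk_energy c n / bb c n) by (unfold Rdiv; ring).
            fold (bb c n). field. lra. }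
        nra.
      + intros l _. destruct (Nat.eqb_spec (blk l) n) as [E|]; [|ring].
        unfold phi. rewrite E, Eg. ring.
    - apply Req_le, rsum_zero. intros l _.
      destruct (Nat.eqb_spec (blk l) n) as [E|]; [|reflexivity].
      unfold phi. now rewrite E, Eg. }
  assert (HPsit : forall j, Psi j <= tot).
  { intros j. unfold Psi.
    set (N1 := max N0 (S (blk j))).
    rewrite (rsum_fibers blk phi (S j) N1).
    2:{ intros l Hl. assert (Q := blk_mono l j ltac:(lia)). unfold N1. lia. }
    apply Rle_trans with (rsum (fun n => if good c eps n then 4 * (be n / eps) else 0) N1
      + rsum cnt N1).
    - apply Rplus_le_compat; [apply rsum_le; intros; apply Hsmall|].
      apply rsum_mono; [unfold N1; lia | exact Hcnt0].
    - rewrite <- rsum_plus, (rsum_tail_zero _ N0 N1); [|unfold N1; lia|].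
      + unfold tot. rewrite <- rsum_scal. apply rsum_le. intros n _.
        unfold cnt, good. fold (be n). destruct (Rlt_dec eps (be n)) as [L|L]; [|lra].
        assert (1 <= be n / eps); [|lra].
        apply Rmult_le_reg_r with eps; [exact He|].
        replace (be n / eps * eps) with (be n) by (field; lra). lra.
      + intros n Hn. unfold cnt. rewrite (Hbad n Hn). ring. }
  assert (Htot0 : 0 <= tot) by (eapply Rle_trans; [apply (HPsi0 0%nat) | apply HPsit]).
  destruct (nfloor_ex tot Htot0) as [Nmax [HN1 HN2]].
  exists H, Nmax. split; [|split; [|split]].
  - intros i j L. destruct (HH i) as [A1 _]. destruct (HH j) as [_ A2].
    specialize (HPsim i j L). apply Nat.lt_succ_r, INR_lt. rewrite S_INR. lra.
  - intros i j L Eg EH.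
    (* Equal integer parts force an increment below [1]. All its parts are nonnegative, so each is
       below [1] separately: the [cnt] part excludes a change of block, and the two halves of [phi]
       bound length and energy. *)
    assert (Hd : Psi j - Psi i < 1).
    { destruct (HH i) as [A1 _]. destruct (HH j) as [_ A2]. rewrite EH in A1. lra. }
    unfold Psi in Hd.
    assert (Sp : rsum phi (S j) = rsum phi (S i) + rsum (fun l => phi (S i + l)%nat) (j - i)).
    { replace (S j) with (S i + (j - i))%nat by lia. apply rsum_split. }
    rewrite Sp in Hd.
    assert (Sp0 : 0 <= rsum (fun l => phi (S i + l)%nat) (j - i)) by (apply rsum_nonneg; auto).
    assert (Lb := blk_mono i j ltac:(lia)).
    assert (Eb : blk i = blk j).
    { apply Nat.le_antisymm; [exact Lb|]. apply Nat.nlt_ge. intros Q.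
      assert (Z : rsum cnt (S (blk i)) <= rsum cnt (blk j)) by (apply rsum_mono; auto).
      change (rsum cnt (S (blk j))) with (rsum cnt (blk j) + cnt (blk j)) in Hd.
      unfold cnt at 2 in Hd. rewrite Eg in Hd. lra. }
    split; [exact Eb|]. rewrite Eb in Hd.
    set (n := blk j) in *. assert (Q1 := Pbe n Eg). assert (Q2 := Pbb n Eg).
    assert (Q3 := P2 n). assert (Q4 : 0 < be n / eps) by (apply Rdiv_lt_0_compat; lra).
    fold (be n).
    rewrite (rsum_ext (fun l => phi (S i + l)%nat) (fun l => be n / eps * (/ 2 ^ n +
      2 ^ n / bb c n * Cmod (dd c (S i + l)) ^ 2))) in Hd.
    2:{ intros l Hl. assert (B1 := blk_mono i (S i + l) ltac:(lia)).
        assert (B2 := blk_mono (S i + l) j ltac:(lia)).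
        assert (B3 : blk (S i + l) = n) by (unfold n in *; lia).
        unfold phi. rewrite B3, Eg. ring. }
    rewrite rsum_scal, rsum_plus, rsum_const, rsum_scal in Hd.
    set (E := rsum (fun l => Cmod (dd c (S i + l)) ^ 2) (j - i)) in *.
    assert (HE : 0 <= E) by (apply rsum_nonneg; intros; apply pow2_ge_0).
    assert (HL := pos_INR (j - i)).
    assert (X1 : 0 <= be n / eps * (INR (j - i) * / 2 ^ n)).
    { apply Rmult_le_pos; [lra|]. apply Rmult_le_pos; [exact HL|].
      apply Rlt_le, Rinv_0_lt_compat; lra. }
    assert (X2 : 0 <= be n / eps * (2 ^ n / bb c n * E)).
    { apply Rmult_le_pos; [lra|]. apply Rmult_le_pos; [|exact HE].
      apply Rlt_le, Rdiv_lt_0_compat; lra. }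
    rewrite Rmult_plus_distr_l in Hd. split.
    + apply Rmult_le_reg_l with (be n / eps * / 2 ^ n).
      { apply Rmult_lt_0_compat; [exact Q4 | now apply Rinv_0_lt_compat]. }
      replace (be n / eps * / 2 ^ n * (2 ^ n * eps / be n)) with 1 by (field; lra). lra.
    + apply Rmult_le_reg_l with (be n / eps * (2 ^ n / bb c n)).
      { apply Rmult_lt_0_compat; [exact Q4 | apply Rdiv_lt_0_compat; lra]. }
      replace (be n / eps * (2 ^ n / bb c n) * (be n * eps / 2 ^ n))
        with (be n * be n / bb c n) by (field; lra).
      rewrite Hbe2. replace (bb c n / bb c n) with 1 by (field; lra). lra.
  - intros j. destruct (HH j) as [A1 _]. specialize (HPsit j).
    apply Nat.lt_succ_r, INR_lt. rewrite S_INR. lra.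
  - exact HN1.
Qed.

(** Schur's test with unit weights. A row sum is bounded by the energy allowed to an interval, a
    column meets at most as many rows as the allowed length, and the product of these two bounds is
    [eps ^ 2]. *)
Lemma fsb_intervals c eps (H : nat -> nat) : 0 < eps ->
  (forall i j, (i < j)%nat -> good c eps (blk j) = true -> H i = H j ->
     blk i = blk j /\
     INR (j - i) <= 2 ^ blk j * eps / sqrt (bb c (blk j)) /\
     rsum (fun l => Cmod (dd c (S i + l)) ^ 2) (j - i) <= sqrt (bb c (blk j)) * eps / 2 ^ blk j) ->
  fsb (fun i j => if andb (andb (Nat.ltb i j) (good c eps (blk j))) (Nat.eqb (H i) (H j))
                  then dd c j else RtoC 0) (eps ^ 2).
Proof.
  intros He HS.
  set (rel := fun i j => andb (andb (Nat.ltb i j) (good c eps (blk j))) (Nat.eqb (H i) (H j))).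
  assert (Hrel : forall i j, rel i j = true ->
    (i < j)%nat /\ good c eps (blk j) = true /\ H i = H j).
  { intros i j R. unfold rel in R. apply Bool.andb_true_iff in R as [R R3].
    apply Bool.andb_true_iff in R as [R1 R2]. apply Nat.ltb_lt in R1. apply Nat.eqb_eq in R3.
    auto. }
  assert (P2 : forall n, 0 < 2 ^ n) by (intros; apply pow_lt; lra).
  set (E := fun n => sqrt (bb c n) * eps / 2 ^ n).
  assert (HE : forall n, 0 <= E n).
  { intros n. apply Rmult_le_pos; [apply Rmult_le_pos; [apply sqrt_pos | lra]|].
    apply Rlt_le, Rinv_0_lt_compat, P2. }
  apply (fsb_schur _ rel (fun _ => 1) (fun i => E (blk i))).
  - intros i j R. unfold rel in R. now rewrite R.
  - intros; lra.
  (* The last related column controls the whole row: if it is [J], all nonzero entries lie between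
     [i] and [J], where the energy bound of this pair applies. *)
  - intros i J. induction J as [|J IH]; [apply HE|].
    destruct (rel i J) eqn:R.
    + destruct (Hrel i J R) as [L [Eg EH]]. destruct (HS i J L Eg EH) as [Eb [_ Hen]].
      fold (E (blk J)) in Hen. rewrite <- Eb in Hen. eapply Rle_trans; [|exact Hen].
      replace (S J) with (S i + (J - i))%nat by lia. rewrite rsum_split.
      rewrite rsum_zero.
      * rewrite Rplus_0_l. apply rsum_le. intros l _. rewrite Rmult_1_r.
        destruct (andb _ _); [lra|]. rewrite Cmod_0. rewrite pow_ne_zero by lia. apply pow2_ge_0.
      * intros l Hl. destruct (Nat.ltb_spec i l); [lia|]. simpl. rewrite Cmod_0. ring.
    + cbn [rsum]. fold (rel i J). rewrite R, Cmod_0. rewrite pow_ne_zero by lia. lra.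
  - intros j m. rewrite Rmult_1_r.
    destruct (good c eps (blk j)) eqn:Eg.
    + assert (Hb := good_true _ _ _ Eg). set (n := blk j) in *.
      set (W := 2 ^ n * eps / sqrt (bb c n)).
      assert (HW : 0 <= W).
      { apply Rlt_le, Rdiv_lt_0_compat; [apply Rmult_lt_0_compat; [apply P2 | lra] | lra]. }
      apply Rle_trans with (E n * rsum (fun i => if rel i j then 1 else 0) m).
      * rewrite <- rsum_scal. apply rsum_le. intros i _. destruct (rel i j) eqn:R; [|lra].
        destruct (Hrel i j R) as [L [Eg' EH]]. destruct (HS i j L Eg' EH) as [Eb _].
        rewrite Eb. fold n. lra.
      * apply Rle_trans with (E n * W).
        -- apply Rmult_le_compat_l; [apply HE|].
           apply (count_window (fun i => rel i j) j m W HW). intros i R.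
           destruct (Hrel i j R) as [L [Eg' EH]].
           destruct (HS i j L Eg' EH) as [_ [Q _]]. split; [exact L | exact Q].
        -- apply Req_le. unfold E, W. field. split; [lra | specialize (P2 n); lra].
    + rewrite rsum_zero; [apply pow2_ge_0|]. intros i _.
      destruct (rel i j) eqn:R; [|reflexivity].
      destruct (Hrel i j R) as [_ [Eg' _]]. congruence.
Qed.

Lemma mrank_diag c eps N0 : exists n,
  mrank (fun i j => if andb (Nat.eqb i j) (Nat.ltb i N0)
           then (if Rlt_dec eps (Cmod (c i)) then c i else RtoC 0) else RtoC 0) n /\
  INR n = rsum (fun i => if Rlt_dec eps (Cmod (c i)) then 1 else 0) N0.
Proof.
  induction N0 as [|N0 [n [IH En]]].
  - exists 0%nat. split; [|reflexivity]. exists basis, (fun _ _ => RtoC 0).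
    split; [apply sq_summable_basis|]. intros i j. rewrite Bool.andb_false_r. reflexivity.
  - cbn [rsum]. destruct (Rlt_dec eps (Cmod (c N0))) as [L|L].
    + exists (n + 1)%nat. split; [|rewrite plus_INR, En; reflexivity].
      assert (R1 : mrank (fun i j => basis N0 i * (c N0 * basis N0 j))%C 1).
      { exists (fun _ => basis N0), (fun _ j => c N0 * basis N0 j)%C.
        split; [intros; apply sq_summable_basis|]. intros i j. simpl. ring. }
      eapply mrank_ext; [|apply (mrank_plus _ _ _ _ IH R1)].
      intros i j. cbv beta. rewrite !basis_eq.
      destruct (Nat.eqb_spec i j) as [<-|D]; simpl andb; cbv iota.
      * destruct (Nat.ltb_spec i N0), (Nat.ltb_spec i (S N0)), (Nat.eqb_spec i N0);
          try lia; subst; try ring.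
        destruct (Rlt_dec eps (Cmod (c N0))); [ring | contradiction].
      * destruct (Nat.eqb_spec i N0), (Nat.eqb_spec j N0); try lia; ring.
    + exists n. rewrite Rplus_0_r. split; [|exact En].
      eapply mrank_ext; [|exact IH]. intros i j. cbv beta.
      destruct (Nat.eqb i j); simpl andb; cbv iota; [|reflexivity].
      destruct (Nat.ltb_spec i N0), (Nat.ltb_spec i (S N0)); try lia; try reflexivity.
      replace i with N0 by lia. destruct (Rlt_dec _ _); [contradiction | reflexivity].
Qed.

(** The good columns with code [H j = r + 1] carry the constant value [dd c j] in all rows with
    [H i <= r], which is one rank-one term. Nothing lies above the columns of code [0], so [Nmax]
    terms suffice. *)
Lemma mrank_intervals c eps (H : nat -> nat) N0 Nmax :
  (forall i j, (i <= j)%nat -> (H i <= H j)%nat) ->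
  (forall j, (H j <= Nmax)%nat) ->
  (forall n, (N0 <= n)%nat -> good c eps n = false) ->
  mrank (fun i j => if andb (good c eps (blk j)) (Nat.ltb (H i) (H j))
                    then dd c j else RtoC 0) Nmax.
Proof.
  intros Hm Hmax Hbad. set (J0 := (2 ^ S N0 + 1)%nat).
  (* The cut at [J0] makes the indicator square summable. It removes no entry: [H i < H j] forces
     [i < j], and every good column lies before [J0]. *)
  exists (fun r i => if andb (Nat.ltb (H i) (S r)) (Nat.ltb i J0) then RtoC 1 else RtoC 0).
  exists (fun r j => if andb (good c eps (blk j)) (Nat.eqb (H j) (S r)) then dd c j else RtoC 0).
  split.
  - intros r. apply sq_summable_iff. eexists. intros n.
    apply (sqn_finite_support _ J0). intros i Hi. apply Nat.ltb_ge in Hi.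
    now rewrite Hi, Bool.andb_false_r.
  - intros i j. destruct (good c eps (blk j)) eqn:Eg.
    + simpl andb. destruct (H j) as [|h] eqn:Eh.
      * symmetry. apply csum_zero. intros r _. simpl. ring.
      * rewrite (csum_ext _ (fun r => if Nat.eqb h r then
          ((if andb (Nat.ltb (H i) (S r)) (Nat.ltb i J0) then RtoC 1 else RtoC 0) * dd c j)%C
          else RtoC 0)).
        2:{ intros r _. cbv iota. change (Nat.eqb (S h) (S r)) with (Nat.eqb h r).
            destruct (Nat.eqb h r); [reflexivity | ring]. }
        rewrite (csum_delta h (fun r =>
          ((if andb (Nat.ltb (H i) (S r)) (Nat.ltb i J0) then RtoC 1 else RtoC 0) * dd c j)%C)).
        assert (Q := Hmax j). rewrite Eh in Q.
        destruct (Nat.ltb_spec h Nmax); [|lia].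
        destruct (Nat.ltb_spec (H i) (S h)) as [L|L]; simpl andb; cbv iota; [|ring].
        destruct (Nat.ltb_spec i J0) as [L'|L']; [ring|]. exfalso.
        assert (Hij : (i < j)%nat).
        { apply Nat.nle_gt. intros Q'. specialize (Hm j i Q'). lia. }
        assert (Hb : (blk j < N0)%nat).
        { apply Nat.nle_gt. intros Q'. specialize (Hbad _ Q'). congruence. }
        assert (B := blk_lt_pow j).
        assert (2 ^ S (blk j) <= 2 ^ S N0)%nat by (apply Nat.pow_le_mono_r; lia).
        unfold J0 in L'. lia.
    + simpl andb. cbv iota. symmetry. apply csum_zero. intros; ring.
Qed.

(** The remainder consists of the diagonal squares, the small blocks and the small diagonal entries,
    with constants [1], [36] and [1]. Adding them by the parallelogram bound gives
    [2 * (2 * 1 + 2 * 36) + 2 * 1 = 150]. *)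
Lemma Tc_decomposition c eps N0 : 0 < eps ->
  (forall n, (N0 <= n)%nat -> sqrt (bb c n) <= eps) ->
  (forall i, (N0 <= i)%nat -> Cmod (c i) <= eps) ->
  exists (P : nat -> nat -> C) (J0 N : nat),
    (forall i j, (J0 <= j)%nat -> P i j = RtoC 0) /\ mrank P N /\
    INR N <= rsum (fun i => if Rlt_dec eps (Cmod (c i)) then 1 else 0) N0
      + 5 * rsum (fun n => if Rlt_dec eps (sqrt (bb c n)) then sqrt (bb c n) / eps else 0) N0 /\
    fsb (fun i j => Tc c i j - P i j)%C (150 * eps ^ 2).
Proof.
  intros He HN Hc.
  destruct (interval_code c eps N0 He HN) as [H [Nmax [Hmono [Hsame [Hmax HNmax]]]]].
  assert (Hbad : forall n, (N0 <= n)%nat -> good c eps n = false).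
  { intros n Hn. unfold good. destruct (Rlt_dec _ _) as [L|]; [|reflexivity].
    specialize (HN n Hn). lra. }
  destruct (mrank_diag c eps N0) as [nd [Rd Ed]].
  assert (Rs := mrank_intervals c eps H N0 Nmax Hmono Hmax Hbad).
  set (J0 := (2 ^ S N0 + 1)%nat).
  assert (HJ0 : (N0 < J0)%nat).
  { unfold J0. assert (S N0 < 2 ^ S N0)%nat by (apply Nat.pow_gt_lin_r; lia). lia. }
  eexists. exists J0, (nd + Nmax)%nat. split; [|split; [exact (mrank_plus _ _ _ _ Rd Rs)|split]].
  - intros i j Hj. cbv beta.
    assert (Hb : (N0 <= blk j)%nat).
    { apply Nat.nlt_ge. intros Q. assert (B := blk_lt_pow j).
      assert (2 ^ S (blk j) <= 2 ^ S N0)%nat by (apply Nat.pow_le_mono_r; lia).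
      unfold J0 in Hj. lia. }
    rewrite (Hbad _ Hb). simpl andb. cbv iota.
    destruct (Nat.eqb_spec i j) as [->|]; simpl andb; cbv iota; [|ring].
    destruct (Nat.ltb_spec j N0); [lia | ring].
  - rewrite plus_INR, Ed. lra.
  - assert (F1 := fsb_intervals c eps H He Hsame).
    assert (F2 := fsb_hardy c (fun n => negb (good c eps n)) eps).
    assert (F3 := fsb_diag (fun i => if Rlt_dec eps (Cmod (c i)) then RtoC 0 else c i) (eps ^ 2)).
    replace (150 * eps ^ 2) with (2 * (2 * eps ^ 2 + 2 * (36 * eps ^ 2)) + 2 * eps ^ 2) by ring.
    eapply fsb_ext; [|apply fsb_plus; [apply fsb_plus; [exact F1 | apply F2] | apply F3]].
    + intros i j. cbv beta. rewrite Tc_eq.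
      destruct (Nat.eqb_spec i j) as [->|D].
      * destruct (Nat.ltb_spec j j); [lia|].
        destruct (Nat.ltb_spec (H j) (H j)); [lia|]. simpl andb. rewrite Bool.andb_false_r. cbv iota.
        destruct (Nat.ltb_spec j N0) as [L|L].
        -- destruct (Rlt_dec eps (Cmod (c j))); ring.
        -- destruct (Rlt_dec eps (Cmod (c j))) as [Q|Q]; [|ring].
           specialize (Hc j L). lra.
      * simpl andb. cbv iota. destruct (Nat.ltb_spec i j) as [L|L]; simpl andb.
        -- destruct (good c eps (blk j)); simpl andb; simpl negb; cbv iota; [|ring].
           assert (Q := Hmono i j ltac:(lia)).
           destruct (Nat.eqb_spec (H i) (H j)), (Nat.ltb_spec (H i) (H j)); try lia; ring.
        -- cbv iota. assert (Q := Hmono j i L).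
           destruct (Nat.ltb_spec (H i) (H j)); [lia|]. rewrite Bool.andb_false_r. ring.
    + intros n Hn. apply good_false; [lra|]. now apply Bool.negb_true_iff.
    + intros i. cbv beta. destruct (Rlt_dec eps (Cmod (c i))) as [L|L].
      * rewrite Cmod_0, pow_ne_zero by lia. apply pow2_ge_0.
      * apply pow_incr. split; [apply Cmod_ge_0 | lra].
Qed.

(** * Sufficiency *)

Lemma mrank_0 M i j : mrank M 0 -> M i j = RtoC 0.
Proof. intros [V [w [_ H]]]. apply H. Qed.

Lemma INR_le_0 n : INR n <= 0 -> n = 0%nat.
Proof. intros H. destruct n as [|n]; [reflexivity|]. rewrite S_INR in H. assert (Q := pos_INR n). lra. Qed.

Lemma Tc_fsb c M : 0 < M -> (forall k, Cmod (c k) <= M) -> (forall n, sqrt (bb c n) <= M) ->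
  fsb (Tc c) (150 * M ^ 2).
Proof.
  intros HM Hc Hb.
  destruct (Tc_decomposition c M 0 HM (fun n _ => Hb n) (fun n _ => Hc n))
    as [P [J0 [N [_ [HR [HN HF]]]]]].
  cbn [rsum] in HN. rewrite (INR_le_0 N) in HR by lra.
  eapply fsb_ext; [|exact HF]. intros i j. cbv beta. rewrite (mrank_0 P i j HR). ring.
Qed.

(** * Compactness from coordinatewise limits *)

Lemma Bolzano_Weierstrass_bounded (u : nat -> R) (M : R) : (forall n, Rabs (u n) <= M) ->
  exists l, forall eps N, 0 < eps -> exists n, (N <= n)%nat /\ Rabs (u n - l) < eps.
Proof.
  intros Hu. destruct (Bolzano_Weierstrass u (fun x => - M <= x <= M)) as [l Hl].
  - apply compact_P3.
  - intros n. specialize (Hu n). apply Rabs_le_between in Hu. exact Hu.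
  - exists l. intros eps N He.
    apply (Hl (disc l (mkposreal eps He)) N). exists (mkposreal eps He). intros x Hx. exact Hx.
Qed.

(* Cluster points are chosen coordinate by coordinate, keeping all of the previous ones
   approached simultaneously, and only then is the subsequence extracted. *)
Lemma diagonal_extraction (u : nat -> nat -> R) (M : R) : (forall k i, Rabs (u k i) <= M) ->
  exists (phi : nat -> nat) (l : nat -> R), (forall k, (phi k < phi (S k))%nat) /\
    forall i, is_lim_seq (fun k => u (phi k) i) (l i).
Proof.
  intros Hu.
  set (Q := fun t (l : nat -> R) => forall eps N, 0 < eps ->
    exists n, (N <= n)%nat /\ forall i, (i < t)%nat -> Rabs (u n i - l i) < eps).
  assert (Q0 : Q 0%nat (fun _ => 0)).
  { intros eps N _. exists N. split; [lia | intros; lia]. }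
  assert (QS : forall t l, Q t l -> exists l', Q (S t) l' /\ forall i, (i < t)%nat -> l' i = l i).
  { intros t l HQ.
    assert (Hp : forall p, exists n, (p <= n)%nat /\
      forall i, (i < t)%nat -> Rabs (u n i - l i) < / INR (S p)).
    { intros p. apply HQ. apply Rinv_0_lt_compat, lt_0_INR. lia. }
    set (n := fun p => proj1_sig (constructive_indefinite_description _ (Hp p))).
    assert (Hn : forall p, (p <= n p)%nat /\
      forall i, (i < t)%nat -> Rabs (u (n p) i - l i) < / INR (S p)).
    { intros p. unfold n. now destruct (constructive_indefinite_description _ (Hp p)). }
    (* Along [n p] the first [t] coordinates already converge to [l], so a cluster value of
       coordinate [t] along this sequence is approached together with all of them. *)
    destruct (Bolzano_Weierstrass_bounded (fun p => u (n p) t) M) as [v Hv];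
      [intros; apply Hu|].
    exists (fun i => if Nat.eqb i t then v else l i). split.
    - intros eps N He.
      destruct (INR_unbounded (/ eps)) as [p0 Hp0].
      destruct (Hv eps (max N p0) He) as [p [Hp1 Hp2]]. destruct (Hn p) as [Hn1 Hn2].
      exists (n p). split; [lia|]. intros i Hi. destruct (Nat.eqb_spec i t) as [->|D]; [exact Hp2|].
      eapply Rlt_le_trans; [apply Hn2; lia|].
      rewrite <- (Rinv_inv eps). apply Rinv_le_contravar; [now apply Rinv_0_lt_compat|].
      apply Rlt_le, (Rlt_le_trans _ (INR p0)); [lra|]. apply le_INR. lia.
    - intros i Hi. destruct (Nat.eqb_spec i t); [lia | reflexivity]. }
  set (step := fun t (s : {l | Q t l}) =>
    let w := constructive_indefinite_description _ (QS t (proj1_sig s) (proj2_sig s)) in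
    exist (Q (S t)) (proj1_sig w) (proj1 (proj2_sig w))).
  set (Ls := fix Ls t : {l | Q t l} :=
    match t with O => exist (Q 0%nat) _ Q0 | S t => step t (Ls t) end).
  assert (Hagree : forall t d i, (i < t)%nat -> proj1_sig (Ls (d + t)%nat) i = proj1_sig (Ls t) i).
  { intros t d i Hi. induction d as [|d IH]; [reflexivity|]. rewrite <- IH.
    change (Ls (S d + t)%nat) with (step (d + t)%nat (Ls (d + t)%nat)).
    unfold step. simpl.
    destruct (constructive_indefinite_description _ _) as [l' [H1 H2]]. simpl. apply H2. lia. }
  (* Coordinate [i] is chosen at stage [S i] and never changes afterwards, so this diagonal agrees
     with stage [t] on the coordinates that [Q t] mentions. *)
  set (l := fun i => proj1_sig (Ls (S i)) i).
  assert (HQ : forall t, Q t l).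
  { intros t eps N He. destruct (proj2_sig (Ls t) eps N He) as [n [Hn Hd]].
    exists n. split; [exact Hn|]. intros i Hi. specialize (Hd i Hi).
    unfold l. rewrite <- (Hagree (S i) (t - S i)%nat i) by lia.
    now replace (t - S i + S i)%nat with t by lia. }
  assert (Hnx : forall k n, exists m, (n < m)%nat /\
    forall i, (i < k)%nat -> Rabs (u m i - l i) < / INR (S k)).
  { intros k n. apply (HQ k (/ INR (S k)) (S n)). apply Rinv_0_lt_compat, lt_0_INR. lia. }
  set (nx := fun k n => proj1_sig (constructive_indefinite_description _ (Hnx k n))).
  assert (Hnx' : forall k n, (n < nx k n)%nat /\
    forall i, (i < k)%nat -> Rabs (u (nx k n) i - l i) < / INR (S k)).
  { intros k n. unfold nx. now destruct (constructive_indefinite_description _ (Hnx k n)). }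
  set (phi := fix phi k := match k with O => nx 0%nat 0%nat | S k' => nx k (phi k') end).
  exists phi, l. split.
  - intros k. change (phi (S k)) with (nx (S k) (phi k)). apply Hnx'.
  - intros i. apply is_lim_seq_spec. intros eps.
    destruct (INR_unbounded (/ eps)) as [p0 Hp0].
    exists (max p0 (S i)). intros k Hk.
    assert (E : Rabs (u (phi k) i - l i) < / INR (S k)).
    { destruct k as [|k]; [lia|]. apply (Hnx' (S k) (phi k)). lia. }
    eapply Rlt_le_trans; [exact E|]. assert (He := cond_pos eps).
    rewrite <- (Rinv_inv eps). apply Rinv_le_contravar; [now apply Rinv_0_lt_compat|].
    apply Rlt_le, (Rlt_le_trans _ (INR p0)); [lra|]. apply le_INR. lia.
Qed.

(** Real and imaginary parts are interleaved as even and odd coordinates, so one real extraction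
    serves both. *)
Lemma coordinatewise_extraction (xs : nat -> vec) (M : R) :
  (forall k i, Cmod (xs k i) <= M) ->
  exists (phi : nat -> nat) (x : vec), (forall k, (phi k < phi (S k))%nat) /\
    forall i, clim (fun k => xs (phi k) i) (x i).
Proof.
  intros H.
  destruct (diagonal_extraction (fun k i => if Nat.even i then fst (xs k (Nat.div2 i))
    else snd (xs k (Nat.div2 i))) M) as [phi [l [Hphi Hl]]].
  - intros k i. eapply Rle_trans; [|apply (H k (Nat.div2 i))].
    eapply Rle_trans; [|apply Rmax_Cmod]. destruct (Nat.even i); [apply Rmax_l | apply Rmax_r].
  - exists phi, (fun i => (l (2 * i)%nat, l (S (2 * i)))). split; [exact Hphi|]. intros i.
    split; cbn [fst snd].
    + eapply is_lim_seq_ext; [|apply (Hl (2 * i)%nat)]. intros k. cbv beta.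
      rewrite Nat.even_mul. simpl orb. cbv iota. now rewrite Nat.div2_double.
    + eapply is_lim_seq_ext; [|apply (Hl (S (2 * i)))]. intros k. cbv beta.
      rewrite Nat.even_succ, <- Nat.negb_even, Nat.even_mul. simpl orb. simpl negb. cbv iota.
      now rewrite Nat.div2_succ_double.
Qed.

Lemma bounded_op_vsub_arg A x y : bounded_op A -> sq_summable x -> sq_summable y ->
  A (vsub x y) = vsub (A x) (A y).
Proof.
  intros [_ [A2 [A3 _]]] Hx Hy.
  replace (vsub x y) with (vadd x (vscal (- RtoC 1)%C y)).
  - apply functional_extensionality. intros i.
    rewrite A2 by (try apply sq_summable_vscal; assumption).
    unfold vadd. rewrite A3 by exact Hy. unfold vsub, vscal. ring.
  - apply functional_extensionality. intros i. unfold vadd, vsub, vscal. ring.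
Qed.

(** Let [x] be a coordinatewise limit of a subsequence and [h] the difference. [T - P] is small in
    norm on the bounded vectors [h], while [P h] depends on the first [J0] coordinates only, which
    tend to [0]. *)
Lemma mop_compact T K : fsb T K ->
  (forall eta, 0 < eta -> exists (P : nat -> nat -> C) J0 K',
     (forall i j, (J0 <= j)%nat -> P i j = RtoC 0) /\ K' <= eta /\
     fsb (fun i j => T i j - P i j)%C K') ->
  compact_op (mop T).
Proof.
  intros HT HP xs Hxs [M HM].
  assert (HA := mop_bounded T K HT).
  assert (HM0 : 0 <= M) by (eapply Rle_trans; [apply l2norm_nonneg | apply (HM 0%nat)]).
  destruct (coordinatewise_extraction xs M) as [phi [x [Hphi Hx]]].
  { intros k i. eapply Rle_trans; [now apply Cmod_le_l2norm | apply HM]. }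
  assert (Hsx : forall m, sqn x m <= M ^ 2).
  { intros m.
    refine (is_lim_seq_le _ (fun _ => M ^ 2) (sqn x m) _ _
      (clim_sqn (fun k => xs (phi k)) x m Hx) (is_lim_seq_const _)).
    intros k. eapply Rle_trans; [now apply sqn_le_l2norm|].
    apply pow_incr. split; [apply l2norm_nonneg | apply HM]. }
  destruct (l2_of_sqn_bounded x _ Hsx) as [Sx Nx].
  exists phi, (mop T x). split; [exact Hphi|]. split; [now apply HA|].
  apply is_lim_seq_0_iff; [intros; apply l2norm_nonneg|]. intros eps He.
  (* As [l2norm h ^ 2 <= 4 * M ^ 2], this makes the first part at most [eps ^ 2 / 16]. The second is
     made equally small below, and twice their sum is [(eps / 2) ^ 2]. The [+ 1] keeps the
     denominator positive. *)
  destruct (HP (eps ^ 2 / (64 * (M ^ 2 + 1)))) as [P [J0 [K' [HP0 [HK' HF]]]]].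
  { assert (Z := pow2_ge_0 M). apply Rdiv_lt_0_compat; [now apply pow_lt | lra]. }
  assert (HFP : fsb P (2 * K + 2 * K')).
  { eapply fsb_ext; [|exact (fsb_minus _ _ _ _ HT HF)]. intros i j. cbv beta. ring. }
  set (KP := 2 * K + 2 * K') in *. assert (HKP := fsb_nonneg P KP HFP).
  assert (Hlim : is_lim_seq (fun k => sqn (vsub (xs (phi k)) x) J0) 0).
  { replace 0 with (sqn (fun _ => RtoC 0) J0).
    - apply (clim_sqn (fun k => vsub (xs (phi k)) x)). intros i. unfold vsub.
      replace (RtoC 0) with (x i + - RtoC 1 * x i)%C by ring.
      eapply clim_ext; [|apply clim_plus; [apply Hx | apply clim_scal]].
      + intros k. simpl. instantiate (1 := fun _ => x i). cbv beta. ring.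
      + apply clim_eventually_const with 0%nat. reflexivity.
    - unfold sqn. apply rsum_zero. intros; rewrite Cmod_0; ring. }
  rewrite is_lim_seq_0_iff in Hlim by (intros; apply sqn_nonneg).
  destruct (Hlim (eps ^ 2 / (16 * (KP + 1)))) as [N HN].
  { apply Rdiv_lt_0_compat; [now apply pow_lt | lra]. }
  exists N. intros k Hk. specialize (HN k Hk).
  rewrite <- bounded_op_vsub_arg by auto.
  set (h := vsub (xs (phi k)) x) in *.
  destruct (l2norm_sq_vsub (xs (phi k)) x (Hxs _) Sx) as [Sh Nh]. fold h in Sh, Nh.
  assert (Nk : l2norm (xs (phi k)) ^ 2 <= M ^ 2)
    by (apply pow_incr; split; [apply l2norm_nonneg | apply HM]).
  apply Rle_lt_trans with (eps / 2); [|lra]. apply l2norm_le; [lra|]. intros m.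
  assert (E : mop T h = vadd (mop (fun i j => T i j - P i j)%C h) (mop P h)).
  { rewrite <- (mop_minus T P K KP K' h HT HFP HF Sh).
    apply functional_extensionality. intros i. unfold vadd, vsub. ring. }
  rewrite E. eapply Rle_trans; [apply sqn_vadd|].
  assert (B1 := mop_sqn _ K' h m HF Sh).
  assert (B2 : sqn (mop P h) m <= KP * sqn h J0).
  { eapply Rle_trans; [|apply (HFP m J0 h)]. apply Req_le, rsum_ext. intros i _.
    rewrite (mop_finite_columns P KP J0 h i); auto.
    intros j Hj. rewrite HP0 by exact Hj. ring. }
  assert (HK'0 := fsb_nonneg _ _ HF). assert (Z := pow2_ge_0 M).
  assert (B3 : K' * l2norm h ^ 2 <= eps ^ 2 / 16).
  { apply Rle_trans with (eps ^ 2 / (64 * (M ^ 2 + 1)) * (4 * (M ^ 2 + 1))).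
    - apply Rmult_le_compat; [exact HK'0 | apply pow2_ge_0 | exact HK' | lra].
    - apply Req_le. field. lra. }
  assert (B4 : KP * sqn h J0 <= eps ^ 2 / 16).
  { apply Rle_trans with ((KP + 1) * (eps ^ 2 / (16 * (KP + 1)))).
    - apply Rmult_le_compat; [exact HKP | apply sqn_nonneg | lra | lra].
    - apply Req_le. field. lra. }
  replace ((eps / 2) ^ 2) with (eps ^ 2 / 4) by field. lra.
Qed.

Lemma sqrt_bb_eventually_le c : is_lim_seq (bb c) 0 ->
  forall eps, 0 < eps -> exists N, forall n, (N <= n)%nat -> sqrt (bb c n) <= eps.
Proof.
  intros H eps He. rewrite is_lim_seq_0_iff in H by apply bb_nonneg.
  destruct (H (eps ^ 2)) as [N HN]; [now apply pow_lt|]. exists N. intros n Hn.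
  rewrite <- (sqrt_pow2 eps) by lra. apply sqrt_le_1_alt. specialize (HN n Hn). lra.
Qed.

Lemma Tc_compact c : is_lim_seq (fun k => Cmod (c k)) 0 -> is_lim_seq (bb c) 0 ->
  forall K, fsb (Tc c) K -> compact_op (mop (Tc c)).
Proof.
  intros Hc Hb K HK. apply (mop_compact _ K HK). intros eta Heta.
  set (eps := sqrt (eta / 150)).
  assert (He : 0 < eps) by (apply sqrt_lt_R0; lra).
  assert (He2 : eps ^ 2 = eta / 150) by (apply pow2_sqrt; lra).
  destruct (sqrt_bb_eventually_le c Hb eps He) as [N1 H1].
  rewrite is_lim_seq_0_iff in Hc by (intros; apply Cmod_ge_0).
  destruct (Hc eps He) as [N2 H2].
  destruct (Tc_decomposition c eps (max N1 N2) He) as [P [J0 [N [HP [_ [_ HF]]]]]].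
  - intros n Hn. apply H1. lia.
  - intros n Hn. apply Rlt_le, H2. lia.
  - exists P, J0, (150 * eps ^ 2). split; [exact HP|]. split; [rewrite He2; lra | exact HF].
Qed.

(** * Approximation numbers and the Schatten estimate *)

Lemma rpow_series_eventually_le (u : nat -> R) q : 0 <= q ->
  ex_series (fun n => rpow (u n) q) ->
  forall eps, 0 < eps -> exists N, forall n, (N <= n)%nat -> u n <= eps.
Proof.
  intros Hq Hs eps He. apply ex_series_lim_0 in Hs.
  rewrite is_lim_seq_0_iff in Hs by (intros; apply rpow_nonneg).
  destruct (Hs (rpow eps q)) as [N HN]; [now apply rpow_gt_0|].
  exists N. intros n Hn. specialize (HN n Hn). apply Rnot_lt_le. intros H.
  apply Rlt_le, (rpow_mono _ _ q) in H; lra.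
Qed.

Lemma Tc_approx_num c K B N0 k : fsb (Tc c) K -> 0 < B ->
  (forall n, (N0 <= n)%nat -> sqrt (bb c n) <= lev B k) ->
  (forall i, (N0 <= i)%nat -> Cmod (c i) <= lev B k) ->
  exists N, approx_num (mop (Tc c)) N <= 13 * lev B k /\
    INR N <= rsum (fun i => if Rlt_dec (lev B k) (Cmod (c i)) then 1 else 0) N0
      + 5 * rsum (fun n => if Rlt_dec (lev B k) (sqrt (bb c n))
                           then sqrt (bb c n) / lev B k else 0) N0.
Proof.
  intros HK HB Hb Hc. assert (He := lev_pos B k HB). set (eps := lev B k) in *.
  destruct (Tc_decomposition c eps N0 He Hb Hc) as [P [J0 [N [HP [HR [HN HF]]]]]].
  assert (HFP : fsb P (2 * K + 2 * (150 * eps ^ 2))).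
  { eapply fsb_ext; [|exact (fsb_minus _ _ _ _ HK HF)]. intros i j. cbv beta. ring. }
  exists N. split; [|exact HN].
  apply (proj1 (proj2 (approx_num_spec (mop (Tc c)) N (mop_bounded _ _ HK))) (mop P)).
  - lra.
  - exact (mop_bounded _ _ HFP).
  - exact (mop_rank _ _ J0 N HFP HP HR).
  - intros x Hx. rewrite (mop_minus _ _ _ _ _ x HK HFP HF Hx).
    eapply Rle_trans; [apply (mop_l2norm _ _ x HF Hx)|].
    apply Rmult_le_compat_r; [apply l2norm_nonneg|].
    (* The constant [13] is chosen because [13 ^ 2 = 169] exceeds [150]. *)
    apply sq_le_cancel; [lra|]. rewrite pow2_sqrt by (assert (Q := pow2_ge_0 eps); lra).
    assert (Q := pow2_ge_0 eps). nra.
Qed.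

(** An approximation number above [13 * lev B k] has index below [N k], so bracketing reduces the
    series to the sum of [rpow (lev B k) q * INR (N k)]. A large diagonal entry costs [lev ^ q]
    there and a large block [be n * lev ^ (q - 1)]; both are geometric in the level. *)
Lemma Tc_schatten c K q : 1 < q -> fsb (Tc c) K ->
  ex_series (fun k => rpow (Cmod (c k)) q) ->
  ex_series (fun n => rpow (sqrt (bb c n)) q) ->
  forall B, 0 < B -> (forall k, Cmod (c k) <= B) -> (forall n, sqrt (bb c n) <= B) ->
  ex_series (fun n => rpow (approx_num (mop (Tc c)) n) q).
Proof.
  intros Hq HK Sc Sb B HB HcB HbB.
  set (a := approx_num (mop (Tc c))).
  assert (HA := mop_bounded _ _ HK).
  set (be := fun n => sqrt (bb c n)).
  assert (Hbe : forall n, 0 <= be n) by (intros; apply sqrt_pos).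
  assert (Hex : forall k, exists N0N : nat * nat, a (snd N0N) <= 13 * lev B k /\
    INR (snd N0N) <= rsum (fun i => if Rlt_dec (lev B k) (Cmod (c i)) then 1 else 0) (fst N0N)
      + 5 * rsum (fun n => if Rlt_dec (lev B k) (be n) then be n / lev B k else 0) (fst N0N)).
  { intros k.
    destruct (rpow_series_eventually_le _ q ltac:(lra) Sc (lev B k) (lev_pos B k HB)) as [N1 H1].
    destruct (rpow_series_eventually_le _ q ltac:(lra) Sb (lev B k) (lev_pos B k HB)) as [N2 H2].
    destruct (Tc_approx_num c K B (max N1 N2) k HK HB) as [N HN].
    - intros n Hn. apply H2. lia.
    - intros n Hn. apply H1. lia.
    - exists (max N1 N2, N). exact HN. }
  set (N0 := fun k => fst (proj1_sig (constructive_indefinite_description _ (Hex k)))).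
  set (N := fun k => snd (proj1_sig (constructive_indefinite_description _ (Hex k)))).
  assert (HN : forall k, a (N k) <= 13 * lev B k /\
    INR (N k) <= rsum (fun i => if Rlt_dec (lev B k) (Cmod (c i)) then 1 else 0) (N0 k)
      + 5 * rsum (fun n => if Rlt_dec (lev B k) (be n) then be n / lev B k else 0) (N0 k)).
  { intros k. unfold N, N0. now destruct (constructive_indefinite_description _ (Hex k)). }
  clearbody N N0. clear Hex.
  (* At the top level nothing exceeds [B], so [N 0 = 0] and the estimate there already bounds [a 0],
     hence every [a n]. *)
  assert (Ha0 : forall n, a n <= 13 * B).
  { intros n. destruct (HN 0%nat) as [H1 H2]. rewrite lev_0 in *.
    rewrite !rsum_zero in H2.
    - rewrite (INR_le_0 (N 0%nat)) in H1 by lra.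
      eapply Rle_trans; [apply approx_num_antitone; [exact HA | apply Nat.le_0_l] | exact H1].
    - intros i _. destruct (Rlt_dec _ _) as [L|]; [|reflexivity]. specialize (HbB i).
      unfold be in L. lra.
    - intros i _. destruct (Rlt_dec _ _) as [L|]; [|reflexivity]. specialize (HcB i). lra. }
  destruct (sum_levels_below (q - 1) ltac:(lra)) as [C1 [HC1 L1]].
  destruct (sum_levels_below q ltac:(lra)) as [C2 [HC2 L2]].
  set (Vc := Series (fun k => rpow (Cmod (c k)) q)).
  set (Vb := Series (fun n => rpow (be n) q)).
  assert (Hlevels : forall KK, rsum (fun k => rpow (lev B k) q * INR (N k)) KK
    <= C2 * Vc + 5 * (C1 * Vb)).
  { intros KK. destruct (finite_choice_bound (fun k n => n = N0 k) KK) as [NN HNN];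
      [intros k _; now exists (N0 k)|].
    apply Rle_trans with (rsum (fun k =>
      rsum (fun i => if Rle_dec (lev B k) (Cmod (c i)) then rpow (lev B k) q else 0) NN
      + 5 * rsum (fun n => be n *
          (if Rle_dec (lev B k) (be n) then rpow (lev B k) (q - 1) else 0)) NN) KK).
    - apply rsum_le. intros k Hk. destruct (HNN k Hk) as [n [Hn ->]].
      assert (Hl := lev_pos B k HB).
      destruct (HN k) as [_ H2].
      eapply Rle_trans; [apply Rmult_le_compat_l; [apply rpow_nonneg | exact H2]|].
      rewrite Rmult_plus_distr_l. apply Rplus_le_compat.
      + rewrite <- rsum_scal. eapply Rle_trans; [|apply (rsum_mono _ (N0 k) NN); [lia|]].
        * apply rsum_le. intros i _.
          destruct (Rlt_dec (lev B k) (Cmod (c i))), (Rle_dec (lev B k) (Cmod (c i))); try lra.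
          assert (Z := rpow_nonneg (lev B k) q). lra.
        * intros i. destruct (Rle_dec _ _); [apply rpow_nonneg | lra].
      + rewrite (Rmult_comm (rpow _ _)), Rmult_assoc. apply Rmult_le_compat_l; [lra|].
        rewrite Rmult_comm, <- rsum_scal.
        eapply Rle_trans; [|apply (rsum_mono _ (N0 k) NN); [lia|]].
        * apply rsum_le. intros i _. assert (Z := rpow_nonneg (lev B k) (q - 1)).
          specialize (Hbe i). rewrite (rpow_minus_1 (lev B k) q) by lra.
          destruct (Rlt_dec (lev B k) (be i)), (Rle_dec (lev B k) (be i)); try lra.
          -- apply Req_le. field. lra.
          -- rewrite Rmult_0_r. nra.
        * intros i. apply Rmult_le_pos; [apply Hbe|].
          destruct (Rle_dec _ _); [apply rpow_nonneg | lra].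
    - rewrite rsum_plus, rsum_scal. apply Rplus_le_compat; [|apply Rmult_le_compat_l; [lra|]].
      + rewrite rsum_swap.
        apply Rle_trans with (rsum (fun i => C2 * rpow (Cmod (c i)) q) NN).
        * apply rsum_le. intros i _. apply L2; [exact HB | apply Cmod_ge_0].
        * rewrite rsum_scal. apply Rmult_le_compat_l; [exact HC2|].
          apply rsum_le_Series; [intros; apply rpow_nonneg | exact Sc].
      + rewrite rsum_swap.
        apply Rle_trans with (rsum (fun n => C1 * rpow (be n) q) NN).
        * apply rsum_le. intros n _. rewrite rsum_scal, (rpow_minus_1 (be n) q) by apply Hbe.
          assert (Z := L1 B KK (be n) HB (Hbe n)). specialize (Hbe n). nra.
        * rewrite rsum_scal. apply Rmult_le_compat_l; [exact HC1|].
          apply rsum_le_Series; [intros; apply rpow_nonneg | exact Sb]. }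
  apply ex_series_iff_rsum_bounded; [intros; apply rpow_nonneg|].
  set (c26 := rpow 26 q). assert (Hc26 : 0 < c26) by (apply rpow_gt_0; lra).
  exists (c26 * (C2 * Vc + 5 * (C1 * Vb))). intros m. fold a.
  (* Bracketing [a n / 13] gives [13 * lev B k < a n <= 26 * lev B k]. The lower bound yields
     [n < N k] by monotonicity, and the upper one is the origin of [c26]. *)
  destruct (finite_choice_bound
    (fun n k => 0 < a n -> (n < N k)%nat /\ a n <= 26 * lev B k) m) as [KK HKK].
  { intros n _. destruct (Rlt_le_dec 0 (a n)) as [H|H].
    - destruct (lev_bracket B (a n / 13) HB) as [k Hk]; [specialize (Ha0 n); lra|].
      exists k. intros _. split; [|lra]. apply Nat.nle_gt. intros Q.
      destruct (HN k) as [H1 _].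
      assert (Z := approx_num_antitone _ _ _ HA Q). fold a in Z. lra.
    - exists 0%nat. intros; lra. }
  apply Rle_trans with (c26 * rsum (fun k => rpow (lev B k) q *
    rsum (fun n => if Nat.ltb n (N k) then 1 else 0) m) KK).
  - erewrite (rsum_ext (fun k => rpow (lev B k) q * _));
      [|intros k _; rewrite <- rsum_scal; reflexivity].
    rewrite rsum_swap, <- rsum_scal. apply rsum_le. intros n Hn.
    assert (P : forall k, 0 <= rpow (lev B k) q * (if Nat.ltb n (N k) then 1 else 0)).
    { intros k. apply Rmult_le_pos; [apply rpow_nonneg|]. destruct (Nat.ltb n (N k)); lra. }
    destruct (Rlt_le_dec 0 (a n)) as [H|H].
    + destruct (HKK n Hn) as [k [Hk Hb]]. destruct (Hb H) as [Q1 Q2].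
      assert (Hl := lev_pos B k HB).
      apply Rle_trans with (c26 * rpow (lev B k) q).
      * unfold c26. rewrite <- rpow_mult_distr by lra. apply rpow_mono; lra.
      * apply Rmult_le_compat_l; [lra|].
        eapply Rle_trans; [|apply (rsum_term _ KK k P Hk)].
        cbv beta. apply Nat.ltb_lt in Q1. rewrite Q1. lra.
    + rewrite rpow_le_0 by exact H. apply Rmult_le_pos; [lra|]. apply rsum_nonneg; auto.
  - apply Rmult_le_compat_l; [lra|]. eapply Rle_trans; [|apply (Hlevels KK)].
    apply rsum_le. intros k _. apply Rmult_le_compat_l; [apply rpow_nonneg|].
    apply Rle_trans with (rsum (fun n => if Nat.ltb n (N k) then 1 else 0) (max m (N k))).
    + apply rsum_mono; [lia|]. intros n. destruct (Nat.ltb n (N k)); lra.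
    + rewrite (rsum_tail_zero _ (N k)).
      * rewrite <- (Rmult_1_r (INR (N k))), <- rsum_const. apply rsum_le.
        intros n Hn. destruct (Nat.ltb _ _); lra.
      * lia.
      * intros n Hn. apply Nat.ltb_ge in Hn. now rewrite Hn.
Qed.

(** * Dyadic test vectors and the theorem *)

Lemma sum_n_m_rsum (f : nat -> R) a k :
  sum_n_m f a (a + k) = rsum (fun i => f (a + i)%nat) (S k).
Proof.
  induction k as [|k IH].
  - rewrite Nat.add_0_r, sum_n_n. simpl. rewrite Nat.add_0_r. lra.
  - rewrite Nat.add_succ_r, sum_n_Sm by lia. rewrite IH. cbn [rsum].
    now rewrite Nat.add_succ_r.
Qed.

Lemma bb_dyad c n : bb c (S n) = dyad c (S n).
Proof.
  unfold bb, dyad, blk_energy. f_equal. set (N := S n).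
  assert (HN : (0 < 2 ^ N)%nat) by (apply Nat.neq_0_lt_0, Nat.pow_nonzero; lia).
  replace (2 ^ S N + 1)%nat with (1 + (2 ^ N + 2 ^ N))%nat by (simpl; lia).
  rewrite rsum_split, rsum_split. rewrite (rsum_zero _ 1).
  2:{ intros i Hi. replace i with 0%nat by lia. reflexivity. }
  rewrite (rsum_zero _ (2 ^ N)).
  2:{ intros i Hi. destruct (Nat.eqb_spec (blk (1 + i)) N) as [E|]; [|reflexivity].
      exfalso. unfold blk in E. simpl Nat.pred in E.
      destruct (Nat.eq_dec i 0) as [->|D]; [unfold N in E; discriminate|].
      apply Nat.log2_lt_pow2 in Hi; lia. }
  rewrite !Rplus_0_l.
  replace (2 ^ S N - 1)%nat with (2 ^ N + (2 ^ N - 1))%nat by (simpl; lia).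
  rewrite sum_n_m_rsum. replace (S (2 ^ N - 1)) with (2 ^ N)%nat by lia.
  apply rsum_ext. intros i Hi.
  replace (Nat.eqb (blk (1 + (2 ^ N + i))) N) with true.
  - unfold dd. change (1 + (2 ^ N + i))%nat with (S (2 ^ N + i)). simpl Nat.pred.
    rewrite <- (Cmod_opp (c (2 ^ N + i)%nat - c (S (2 ^ N + i)))%C), Copp_minus_distr.
    reflexivity.
  - symmetry. apply Nat.eqb_eq. unfold blk.
    change (Nat.pred (1 + (2 ^ N + i))) with (2 ^ N + i)%nat.
    apply Nat.log2_unique; [lia|]. rewrite Nat.pow_succ_r'. lia.
Qed.

(** Disjoint supports: at coordinate [i] only [e (g i)] and, within its length, [f (h i)] can be
    nonzero. Sums of vectors thus collapse to one term per coordinate, and the functionals read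
    disjoint parts of [x]. *)
Lemma block_test_system e f L (g h : nat -> nat) :
  (forall l i, e l i <> RtoC 0 -> g i = l) ->
  (forall l n, sqn (e l) n <= 1) ->
  (forall k i, (i < L k)%nat -> f k i <> RtoC 0 -> h i = k) ->
  (forall k, sqn (f k) (L k) <= 1) ->
  test_system e f L.
Proof.
  intros Hg He Hh Hf. split; [|split].
  - intros l. apply sq_summable_iff. exists 1. apply He.
  - intros m z n.
    apply Rle_trans with (rsum (fun i => rsum (fun l => Cmod (z l) ^ 2 * Cmod (e l i) ^ 2) m) n).
    + apply rsum_le. intros i _.
      rewrite (csum_ext _ (fun l => if Nat.eqb (g i) l then (z l * e l i)%C else RtoC 0)).
      * rewrite (csum_delta (g i) (fun l => (z l * e l i)%C)).
        assert (P : forall l, 0 <= Cmod (z l) ^ 2 * Cmod (e l i) ^ 2)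
          by (intros; apply Rmult_le_pos; apply pow2_ge_0).
        destruct (Nat.ltb_spec (g i) m) as [Lt|Lt].
        -- rewrite Cmod_mult, Rpow_mult_distr.
           apply (rsum_term (fun l => Cmod (z l) ^ 2 * Cmod (e l i) ^ 2)); auto.
        -- rewrite Cmod_0, pow_ne_zero by lia. apply rsum_nonneg; auto.
      * intros l _. destruct (Nat.eqb_spec (g i) l) as [|D]; [reflexivity|].
        destruct (classic (e l i = RtoC 0)) as [->|N]; [ring|]. now apply Hg in N.
    + rewrite rsum_swap. unfold sqn. apply rsum_le. intros l _. rewrite rsum_scal.
      specialize (He l n). unfold sqn in He. assert (Z := pow2_ge_0 (Cmod (z l))). nra.
  - intros x m Hx.
    destruct (finite_choice_bound (fun k n => n = L k) m) as [Lm HL];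
      [intros k _; now exists (L k)|].
    eapply Rle_trans; [|apply (sqn_le_l2norm x Lm Hx)].
    eapply Rle_trans; [|apply (rsum_fibers_le h (fun i => Cmod (x i) ^ 2) Lm m);
      intros; apply pow2_ge_0].
    apply rsum_le. intros k Hk. destruct (HL k Hk) as [n [Hn ->]].
    assert (P : forall i, 0 <= if Nat.eqb (h i) k then Cmod (x i) ^ 2 else 0).
    { intros i. destruct (Nat.eqb (h i) k); [apply pow2_ge_0 | lra]. }
    eapply Rle_trans; [|apply (rsum_mono _ (L k) Lm); [lia | exact P]].
    assert (Z : Cmod (fnl f L k x) ^ 2 <=
      sqn (f k) (L k) * rsum (fun i => if Nat.eqb (h i) k then Cmod (x i) ^ 2 else 0) (L k)).
    { unfold fnl. rewrite (csum_ext _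
        (fun i => f k i * (if Nat.eqb (h i) k then x i else RtoC 0))%C).
      - eapply Rle_trans; [apply csum_CS|]. apply Req_le. f_equal. apply rsum_ext.
        intros i _. destruct (Nat.eqb (h i) k); [reflexivity | rewrite Cmod_0; ring].
      - intros i Hi. destruct (Nat.eqb_spec (h i) k) as [|D]; [reflexivity|].
        destruct (classic (f k i = RtoC 0)) as [->|N]; [ring|]. now apply Hh in N. }
    eapply Rle_trans; [exact Z|].
    assert (0 <= rsum (fun i => if Nat.eqb (h i) k then Cmod (x i) ^ 2 else 0) (L k))
      by (apply rsum_nonneg; auto).
    specialize (Hf k). nra.
Qed.

Lemma basis_test_system : test_system basis basis S.
Proof.
  apply (block_test_system _ _ _ (fun i => i) (fun i => i)).
  - intros l i H. rewrite basis_eq in H. destruct (Nat.eqb_spec i l); [assumption | congruence].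
  - intros l n. rewrite sqn_basis. destruct (Nat.ltb l n); lra.
  - intros k i _ H. rewrite basis_eq in H. destruct (Nat.eqb_spec i k); [assumption | congruence].
  - intros k. rewrite sqn_basis. destruct (Nat.ltb k (S k)); lra.
Qed.

Lemma basis_fnl A c k : has_matrix A (Tc c) -> fnl basis S k (A (basis k)) = c k.
Proof.
  intros HA. unfold fnl. rewrite csum_basis.
  destruct (Nat.ltb_spec k (S k)); [|lia]. rewrite HA, Tc_eq, Nat.eqb_refl, Nat.ltb_irrefl. ring.
Qed.

Definition blk_vec (c : nat -> C) (n : nat) : vec := fun j =>
  if Nat.eqb (blk j) (S n) then (RtoC (/ sqrt (blk_energy c (S n))) * Cconj (dd c j))%C else RtoC 0.

(** The normalised constant on the rows from [2 ^ n] to [2 ^ S n - 1]; the upper end is imposed by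
    the length [2 ^ S n] given to [fnl]. *)
Definition blk_fnl (n i : nat) : C :=
  if Nat.leb (2 ^ n) i then RtoC (/ sqrt (2 ^ n)) else RtoC 0.

Lemma sqrt_inv_sq s : 0 < s -> (/ sqrt s) ^ 2 = / s.
Proof.
  intros H. rewrite <- (pow2_sqrt s) at 2 by lra. field.
  apply Rgt_not_eq, sqrt_lt_R0, H.
Qed.

Lemma blk_test_system c : test_system (blk_vec c) blk_fnl (fun n => 2 ^ S n)%nat.
Proof.
  apply (block_test_system _ _ _ (fun i => Nat.pred (blk i)) Nat.log2).
  - intros l i H. unfold blk_vec in H. destruct (Nat.eqb_spec (blk i) (S l)); [lia | congruence].
  - intros l n. unfold sqn.
    rewrite (rsum_ext _ (fun j => (/ sqrt (blk_energy c (S l))) ^ 2 *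
      (if Nat.eqb (blk j) (S l) then Cmod (dd c j) ^ 2 else 0))).
    + rewrite rsum_scal. assert (Z := blk_energy_partial c (S l) n).
      assert (Z0 := blk_energy_nonneg c (S l)).
      set (s := blk_energy c (S l)) in *.
      (* When the block carries no energy the vector vanishes, whatever value [/ 0] has. *)
      destruct (Req_dec s 0) as [E|D].
      * assert (Y : 0 <= rsum (fun j => if Nat.eqb (blk j) (S l)
          then Cmod (dd c j) ^ 2 else 0) n).
        { apply rsum_nonneg. intros j _. destruct (Nat.eqb _ _); [apply pow2_ge_0 | lra]. }
        replace (rsum _ n) with 0 by lra. lra.
      * rewrite sqrt_inv_sq by lra.
        apply Rle_trans with (/ s * s); [|rewrite Rinv_l by exact D; lra].
        apply Rmult_le_compat_l; [apply Rlt_le, Rinv_0_lt_compat; lra | exact Z].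
    + intros j _. unfold blk_vec. destruct (Nat.eqb (blk j) (S l)).
      * rewrite Cmod_mult, Cmod_R, Cmod_Cconj, Rpow_mult_distr, pow2_abs. reflexivity.
      * rewrite Cmod_0. ring.
  - intros k i Hi H. unfold blk_fnl in H. destruct (Nat.leb_spec (2 ^ k) i); [|congruence].
    apply Nat.log2_unique; lia.
  - intros k. unfold sqn. assert (P : 0 < 2 ^ k) by (apply pow_lt; lra).
    replace (2 ^ S k)%nat with (2 ^ k + 2 ^ k)%nat by (simpl; lia).
    rewrite rsum_split, rsum_zero.
    + rewrite (rsum_ext _ (fun _ => / 2 ^ k)).
      * rewrite rsum_const, INR_pow2, Rinv_r by lra. lra.
      * intros i _. unfold blk_fnl. destruct (Nat.leb_spec (2 ^ k) (2 ^ k + i)); [|lia].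
        rewrite Cmod_R, pow2_abs. now apply sqrt_inv_sq.
    + intros i Hi. unfold blk_fnl. destruct (Nat.leb_spec (2 ^ k) i); [lia|].
      rewrite Cmod_0. ring.
Qed.

Lemma finite_support_expansion (x : vec) J : (forall j, (J <= j)%nat -> x j = RtoC 0) ->
  x = (fun i => csum (fun j => x j * basis j i)%C J).
Proof.
  intros H. apply functional_extensionality. intros i.
  rewrite (csum_ext _ (fun j => if Nat.eqb i j then x j else RtoC 0)).
  - rewrite (csum_delta i x). destruct (Nat.ltb_spec i J); [reflexivity | now apply H].
  - intros j _. rewrite basis_eq. destruct (Nat.eqb i j); ring.
Qed.

(** The rows are taken one block before the columns: every row below [2 ^ S n] lies strictly above
    all columns of block [S n], so the matrix has entries [d_j] there and the image is constantly
    [sqrt s]. The [2 ^ n] rows give [sqrt (2 ^ n * s)]; the missing factor [2] under the root is the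
    price of the shift. *)
Lemma blk_fnl_value A c n : bounded_op A -> has_matrix A (Tc c) ->
  Cmod (fnl blk_fnl (fun n => 2 ^ S n)%nat n (A (blk_vec c n))) = sqrt (dyad c (S n) / 2).
Proof.
  intros HA HM. set (s := blk_energy c (S n)).
  assert (Hs : 0 <= s) by apply blk_energy_nonneg.
  set (J := (2 ^ S (S n) + 1)%nat).
  assert (Hv : forall i, (i < 2 ^ S n)%nat -> A (blk_vec c n) i = RtoC (sqrt s)).
  { intros i Hi.
    rewrite (finite_support_expansion (blk_vec c n) J).
    2:{ intros j Hj. unfold blk_vec. destruct (Nat.eqb_spec (blk j) (S n)) as [E|]; [|reflexivity].
        assert (L := blk_lt_pow j). rewrite E in L. unfold J in Hj. lia. }
    destruct (bounded_op_csum A (blk_vec c n) basis J HA sq_summable_basis) as [_ ->].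
    rewrite (csum_ext _ (fun j => RtoC (/ sqrt s *
      (if Nat.eqb (blk j) (S n) then Cmod (dd c j) ^ 2 else 0)))).
    - rewrite csum_RtoC, rsum_scal. change (rsum _ J) with s. f_equal.
      destruct (Req_dec s 0) as [->|D]; [rewrite sqrt_0; ring|].
      rewrite <- (pow2_sqrt s) at 2 by exact Hs. field.
      apply Rgt_not_eq, sqrt_lt_R0. lra.
    - intros j _. rewrite HM, Tc_eq. unfold blk_vec. fold s.
      destruct (Nat.eqb_spec (blk j) (S n)) as [E|]; [|rewrite Rmult_0_r; ring].
      assert (L : (2 ^ S n < j)%nat).
      { unfold blk in E. destruct (Nat.eq_dec (Nat.pred j) 0) as [Z|Z].
        - rewrite Z in E. discriminate.
        - assert (Q := Nat.log2_spec (Nat.pred j) ltac:(lia)). rewrite E in Q. lia. }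
      destruct (Nat.eqb_spec i j); [lia|]. destruct (Nat.ltb_spec i j); [|lia].
      rewrite RtoC_mult, <- Cmult_conj_sq. ring. }
  assert (P : 0 < 2 ^ n) by (apply pow_lt; lra).
  unfold fnl.
  rewrite (csum_ext _ (fun i => RtoC (if Nat.leb (2 ^ n) i then / sqrt (2 ^ n) * sqrt s else 0))).
  - rewrite csum_RtoC.
    replace (2 ^ S n)%nat with (2 ^ n + 2 ^ n)%nat by (simpl; lia).
    rewrite rsum_split, rsum_zero.
    + rewrite (rsum_ext _ (fun _ => / sqrt (2 ^ n) * sqrt s)).
      * rewrite rsum_const, INR_pow2, Rplus_0_l, Cmod_R.
        replace (2 ^ n * (/ sqrt (2 ^ n) * sqrt s)) with (sqrt (dyad c (S n) / 2)).
        -- apply Rabs_right, Rle_ge, sqrt_pos.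
        -- rewrite <- bb_dyad. unfold bb. fold s.
           replace (2 ^ S n * s / 2) with (2 ^ n * s) by (simpl; field).
           rewrite sqrt_mult by lra. rewrite <- (pow2_sqrt (2 ^ n)) at 2 by lra.
           field. apply Rgt_not_eq, sqrt_lt_R0, P.
      * intros i _. destruct (Nat.leb_spec (2 ^ n) (2 ^ n + i)); [reflexivity | lia].
    + intros i Hi. destruct (Nat.leb_spec (2 ^ n) i); [lia | reflexivity].
  - intros i Hi. rewrite (Hv i Hi). unfold blk_fnl.
    destruct (Nat.leb (2 ^ n) i); [now rewrite RtoC_mult | ring].
Qed.

Lemma dyad_nonneg c n : 0 <= dyad c n.
Proof.
  unfold dyad. apply Rmult_le_pos; [apply pow_le; lra|].
  assert (P : (0 < 2 ^ n)%nat) by (apply Nat.neq_0_lt_0, Nat.pow_nonzero; lia).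
  replace (2 ^ S n - 1)%nat with (2 ^ n + (2 ^ n - 1))%nat by (simpl; lia).
  rewrite sum_n_m_rsum. apply rsum_nonneg. intros; apply pow2_ge_0.
Qed.

Lemma dyad_of_sqrt_half c n : dyad c n = 2 * sqrt (dyad c n / 2) ^ 2.
Proof. assert (H := dyad_nonneg c n). rewrite pow2_sqrt by lra. field. Qed.

Lemma Tc_bounded_necessity c A : bounded_op A -> has_matrix A (Tc c) ->
  (exists M, forall k, Cmod (c k) <= M) /\ (exists M, forall n, dyad c n <= M).
Proof.
  intros HA HM. split.
  - destruct (test_system_bounded _ _ _ A basis_test_system HA) as [M [_ H]].
    exists M. intros k. rewrite <- (basis_fnl A c k HM). apply H.
  - destruct (test_system_bounded _ _ _ A (blk_test_system c) HA) as [M [HM0 H]].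
    (* The test system sees only the indices [S n]; the single value [dyad c 0] is added to the
       bound. *)
    exists (Rmax (dyad c 0) (2 * M ^ 2)). intros [|n]; [apply Rmax_l|].
    eapply Rle_trans; [|apply Rmax_r]. rewrite dyad_of_sqrt_half.
    apply Rmult_le_compat_l; [lra|]. apply pow_incr. split; [apply sqrt_pos|].
    rewrite <- (blk_fnl_value A c n HA HM). apply H.
Qed.

Lemma Tc_compact_necessity c A : bounded_op A -> has_matrix A (Tc c) -> compact_op A ->
  is_lim_seq (fun k => Cmod (c k)) 0 /\ is_lim_seq (dyad c) 0.
Proof.
  intros HA HM HC. split.
  - eapply is_lim_seq_ext; [|exact (test_system_compact _ _ _ A basis_test_system HA HC)].
    intros k. simpl. now rewrite (basis_fnl A c k HM).
  - apply is_lim_seq_incr_1.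
    assert (H := test_system_compact _ _ _ A (blk_test_system c) HA HC).
    assert (H2 := is_lim_seq_scal_l _ 2 _ (is_lim_seq_mult' _ _ 0 0 H H)).
    replace (Rbar_mult 2 (0 * 0)) with (Finite 0) in H2 by (simpl; f_equal; ring).
    eapply is_lim_seq_ext; [|exact H2]. intros n. cbv beta.
    rewrite (blk_fnl_value A c n HA HM). rewrite (dyad_of_sqrt_half c (S n)) at 3. ring.
Qed.

Lemma Tc_schatten_necessity c A q : bounded_op A -> has_matrix A (Tc c) -> 1 < q ->
  ex_series (fun n => rpow (approx_num A n) q) ->
  ex_series (fun k => rpow (Cmod (c k)) q) /\ ex_series (fun n => rpow (dyad c n) (q / 2)).
Proof.
  intros HA HM Hq Hs. split.
  - eapply ex_series_ext; [|exact (test_system_schatten _ _ _ A q basis_test_system HA Hq Hs)].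
    intros k. cbv beta. now rewrite (basis_fnl A c k HM).
  - apply ex_series_incr_1.
    assert (H := test_system_schatten _ _ _ A q (blk_test_system c) HA Hq Hs).
    (* This factor undoes the division by [2] under the square root in [blk_fnl_value]. *)
    apply (ex_series_scal_l (rpow (sqrt 2) q)) in H.
    eapply ex_series_ext; [|exact H]. intros n. cbv beta.
    rewrite (blk_fnl_value A c n HA HM).
    assert (Z := dyad_nonneg c (S n)).
    rewrite <- (rpow_sqrt (dyad c (S n))) by exact Z.
    unfold scal; simpl; unfold mult; simpl.
    rewrite <- rpow_mult_distr, <- sqrt_mult by (try apply sqrt_pos; lra).
    do 2 f_equal. field.
Qed.

Lemma Tc_bound_const c : (exists M, forall k, Cmod (c k) <= M) -> (exists M, forall n, dyad c n <= M) ->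
  exists B, 0 < B /\ (forall k, Cmod (c k) <= B) /\ (forall n, sqrt (bb c n) <= B).
Proof.
  intros [M1 H1] [M2 H2].
  (* [bb c 0] is not governed by the dyadic sums, so this one value enters separately; adding [1] to
     [M] afterwards makes the bound positive. *)
  set (M := Rmax M1 (Rmax (sqrt (bb c 0)) (sqrt M2))).
  assert (Q0 : 0 <= M1) by (eapply Rle_trans; [apply Cmod_ge_0 | apply (H1 0%nat)]).
  assert (Q1 : M1 <= M) by apply Rmax_l.
  assert (Q2 : sqrt (bb c 0) <= M) by (eapply Rle_trans; [apply Rmax_l | apply Rmax_r]).
  assert (Q3 : sqrt M2 <= M) by (eapply Rle_trans; [apply Rmax_r | apply Rmax_r]).
  exists (M + 1). split; [lra|]. split.
  - intros k. specialize (H1 k). lra.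
  - intros [|n]; [lra|]. rewrite bb_dyad.
    assert (sqrt (dyad c (S n)) <= sqrt M2) by (apply sqrt_le_1_alt, H2). lra.
Qed.

Lemma bounded_of_eventually_bounded (u : nat -> R) (N : nat) (b : R) :
  (forall n, (N <= n)%nat -> u n <= b) -> exists M, forall n, u n <= M.
Proof.
  revert b. induction N as [|N IH]; intros b H.
  - exists b. intros n. apply H. lia.
  - apply (IH (Rmax b (u N))). intros n Hn. destruct (Nat.eq_dec n N) as [->|D].
    + apply Rmax_r.
    + eapply Rle_trans; [apply H; lia | apply Rmax_l].
Qed.

Lemma bounded_of_lim_0 (u : nat -> R) : is_lim_seq u 0 -> exists M, forall n, u n <= M.
Proof.
  intros H. apply is_lim_seq_spec in H. destruct (H (mkposreal 1 Rlt_0_1)) as [N HN].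
  apply (bounded_of_eventually_bounded u N 1). intros n Hn. specialize (HN n Hn).
  simpl in HN. rewrite Rminus_0_r in HN. apply Rabs_def2 in HN. lra.
Qed.

Lemma bounded_of_rpow_series (u : nat -> R) q : 0 <= q ->
  ex_series (fun n => rpow (u n) q) -> exists M, forall n, u n <= M.
Proof.
  intros Hq Hs. destruct (rpow_series_eventually_le u q Hq Hs 1 Rlt_0_1) as [N HN].
  exact (bounded_of_eventually_bounded u N 1 HN).
Qed.

Theorem theorem1p4 (c : nat -> C) :
  (defines_bounded (Tc c) <->
     (exists M, forall k, Cmod (c k) <= M) /\
     (exists M, forall n, dyad c n <= M)) /\
  (defines_compact (Tc c) <->
     is_lim_seq (fun k => Cmod (c k)) 0 /\
     is_lim_seq (dyad c) 0) /\
  (forall q : R, 1 < q ->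
     (defines_schatten q (Tc c) <->
        ex_series (fun k => rpow (Cmod (c k)) q) /\
        ex_series (fun n => rpow (dyad c n) (q / 2)))).
Proof.
  split; [|split].
  - split.
    + intros [A [HA HM]]. now apply (Tc_bounded_necessity c A).
    + intros [H1 H2]. destruct (Tc_bound_const c H1 H2) as [B [HB [Hc Hb]]].
      assert (HF := Tc_fsb c B HB Hc Hb). exists (mop (Tc c)).
      split; [exact (mop_bounded _ _ HF) | exact (mop_has_matrix _ _ HF)].
  - split.
    + intros [A [HA [HM HC]]]. now apply (Tc_compact_necessity c A).
    + intros [H1 H2].
      destruct (Tc_bound_const c (bounded_of_lim_0 _ H1) (bounded_of_lim_0 _ H2))
        as [B [HB [Hc Hb]]].
      assert (HF := Tc_fsb c B HB Hc Hb). exists (mop (Tc c)).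
      split; [exact (mop_bounded _ _ HF)|]. split; [exact (mop_has_matrix _ _ HF)|].
      apply (Tc_compact c H1) with (2 := HF).
      apply is_lim_seq_incr_1. apply is_lim_seq_incr_1 in H2.
      eapply is_lim_seq_ext; [|exact H2]. intros n. symmetry. apply bb_dyad.
  - intros q Hq. split.
    + intros [A [HA [HM HS]]]. now apply (Tc_schatten_necessity c A).
    + intros [H1 H2].
      destruct (Tc_bound_const c (bounded_of_rpow_series _ q ltac:(lra) H1)
        (bounded_of_rpow_series _ (q / 2) ltac:(lra) H2)) as [B [HB [Hc Hb]]].
      assert (HF := Tc_fsb c B HB Hc Hb). exists (mop (Tc c)).
      split; [exact (mop_bounded _ _ HF)|]. split; [exact (mop_has_matrix _ _ HF)|].
      apply (Tc_schatten c _ q Hq HF H1) with (B := B); auto.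
      apply ex_series_incr_1. apply (proj1 (ex_series_incr_1 (fun n => rpow (dyad c n) (q / 2)))) in H2.
      eapply ex_series_ext; [|exact H2]. intros n. cbv beta.
      now rewrite bb_dyad, rpow_sqrt by apply dyad_nonneg.
Qed.
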